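(* Let $(\mathcal A,D,\mathcal H)$ be a spectral triple with finite non-zero box dimension $d$. Then $|D|^{-d}$ is singularly traceable, namely it gives rise to a singular trace $\tau$ which is non-trivial on the ideal generated by $|D|^{-d}$. In particular the functional $a\mapsto\tau(a|D|^{-d})$ is a non-trivial trace state on the algebra $\mathcal A$.
   Context: A spectral triple $(\mathcal A,D,\mathcal H)$ consists of an algebra $\mathcal A$ acting on a Hilbert space $\mathcal H$ (by bounded operators) and a self-adjoint operator $D$ on $\mathcal H$ such that $[D,a]$ is bounded for every $a\in\mathcal A$ and $D$ has compact resolvent. It is assumed that $0$ is not an eigenvalue of $D$ (in general $D$ is replaced by $D|_{\ker(D)^\perp}$), so $|D|^{-1}$ is compact. For a compact operator $T$, $\mu_n(T)$ denotes its $n$-th singular value (singular values arranged in non-increasing order, counted with multiplicity). The box dimension of the spectral triple is $d_B(\mathcal A,D,\mathcal H):=\left(\liminf_{n\to\infty}\frac{\log\mu_n(D^{-1})}{\log(1/n)}\right)^{-1}$. A singular trace on a two-sided ideal of compact operators in $\mathcal B(\mathcal H)$ is a positive, unitarily invariant linear functional on the ideal which vanishes on finite-rank projections. A positive compact operator $T$ is singularly traceable if there is a (finite, i.e. everywhere defined) singular trace $\tau$ on the two-sided ideal of $\mathcal B(\mathcal H)$ generated by $T$ with $\tau$ non-trivial (equivalently $\tau(T)\neq0$; $\tau$ is normalized by $\tau(T)=1$). ''Trace state'' means a positive functional $\varphi$ with $\varphi(ab)=\varphi(ba)$, normalized via $\tau(|D|^{-d})=1$. *)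

(* Defs.v *)
From mathcomp Require Export all_boot all_order all_algebra.
From mathcomp Require Export complex.
From mathcomp Require Export all_classical all_reals all_analysis.

Set Implicit Arguments.
Unset Strict Implicit.
Unset Printing Implicit Defensive.

Import Order.TTheory GRing.Theory Num.Theory Num.Def.
Import numFieldNormedType.Exports.

Local Open Scope classical_set_scope.
Local Open Scope ring_scope.

(* A Hilbert space is a complete normed module over R[i] together with a form
   dot satisfying hilbert_dot; dot is linear in its first argument. *)
Definition hilbert_dot (R : realType) (H : completeNormedModType R[i])
  (dot : {dot H for conjC}) : Prop := forall x : H, dot x x = `|x| ^+ 2.

(* Values of op_fun outside op_dom are irrelevant. *)
Record unbounded_op (R : realType) (H : completeNormedModType R[i]) :=
  UnboundedOp {
    op_dom : set H;
    op_fun :> H -> H;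
    op_dom0 : op_dom 0;
    op_domP : forall (c : R[i]) x y,
      op_dom x -> op_dom y -> op_dom (c *: x + y);
    op_funP : forall (c : R[i]) x y,
      op_dom x -> op_dom y -> op_fun (c *: x + y) = c *: op_fun x + op_fun y
  }.

Section Operators.
Context (R : realType) (H : completeNormedModType R[i]).
Context (dot : {dot H for conjC}).
Implicit Types (S T X Y U P : H -> H) (D : unbounded_op H) (J : set (H -> H)).

Definition bounded_op T : Prop :=
  linear T /\ exists M : R[i], forall x, `|T x| <= M * `|x|.

Definition compact_op T : Prop :=
  linear T /\ precompact (T @` [set x | `|x| <= 1]).

Definition positive_op T : Prop := forall x, 0 <= dot (T x) x.

(* The Hilbert space adjoint of a bounded T: the representing vector is unique,
   and it exists by Riesz' theorem. *)
Definition adjoint T : H -> H :=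
  fun y => xget 0 [set z | forall x, dot (T x) y = dot x z].

Definition unitary_op U : Prop :=
  [/\ bounded_op U, adjoint U \o U =1 id & U \o adjoint U =1 id].

Definition finite_rank_projection P : Prop :=
  [/\ bounded_op P, P \o P =1 P, adjoint P =1 P &
      exists (n : nat) (e : 'I_n -> H), forall x,
        exists c : 'I_n -> R[i], P x = \sum_(i < n) c i *: e i].

(* The inverse of f : A -> H, with value 0 off the image of A. *)
Definition inverse_op (A : set H) (f : H -> H) : H -> H :=
  fun y => xget 0 [set x | A x /\ f x = y].

(* The graph of the adjoint of D equals the graph of D. *)
Definition self_adjoint D : Prop :=
  dense (op_dom D) /\
  forall y z, (forall x, op_dom D x -> dot (D x) y = dot x z) <->
              (op_dom D y /\ D y = z).

Definition compact_resolvent D : Prop :=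
  exists l : R[i],
    set_bij (op_dom D) setT (fun x => D x - l *: x) /\
    compact_op (inverse_op (op_dom D) (fun x => D x - l *: x)).

Definition trivial_kernel D : Prop :=
  forall x, op_dom D x -> D x = 0 -> x = 0.

Definition op_inv D : H -> H := inverse_op (op_dom D) D.

(* Functional calculus |D|^s for a self-adjoint D with compact resolvent: the
   eigenvectors of D span a dense subspace, so the bounded operator acting as
   |l|^s on each eigenspace ker (D - l) is unique; it exists for s <= 0 when 0
   is not an eigenvalue. *)
Definition abs_power D (s : R) : H -> H :=
  xget (0 : H -> H) [set T | bounded_op T /\
    forall (l : R) x, op_dom D x -> D x = (l%:C)%C *: x ->
      T x = ((`|l| `^ s)%:C)%C *: x].

(* The n-th singular value, n >= 1: the n-th term of the non-increasing
   sequence of eigenvalues of |T| = (T^* T)^(1/2), repeated according to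
   multiplicity; 0 when |T| has fewer than n positive eigenvalues. *)
Definition singular_value T (n : nat) : R :=
  sup [set s | s = 0 \/
    0 <= s /\ exists (e : 'I_n -> H) (r : 'I_n -> R),
      (forall i j, dot (e i) (e j) = (i == j)%:R) /\
      forall i, s <= r i /\
                adjoint T (T (e i)) = ((r i ^+ 2)%:C)%C *: e i].

(* Extended logarithm and division: lne 0 = -oo, 0^-1 = +oo, +oo^-1 = 0. *)
Definition box_dimension D : \bar R :=
  ((limn_einf (fun n : nat => lne (singular_value (op_inv D) n)%:E /
                              lne (n%:R^-1)%:E))^-1)%E.

Definition two_sided_ideal J : Prop :=
  [/\ J `<=` bounded_op, J 0,
      forall X Y, J X -> J Y -> J (X + Y) &
      forall S X, bounded_op S -> J X -> J (S \o X) /\ J (X \o S)].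

Definition ideal_generated T : set (H -> H) :=
  smallest two_sided_ideal [set T].

(* The values of tau outside J are irrelevant. *)
Definition singular_trace J (tau : (H -> H) -> R[i]) : Prop :=
  [/\ forall (c : R[i]) X Y, J X -> J Y -> tau (c *: X + Y) = c * tau X + tau Y,
      forall X, J X -> positive_op X -> 0 <= tau X,
      forall U X, unitary_op U -> J X -> tau (U \o X \o adjoint U) = tau X &
      forall P, J P -> finite_rank_projection P -> tau P = 0].

Definition singularly_traceable T : Prop :=
  [/\ compact_op T, positive_op T &
      exists tau, singular_trace (ideal_generated T) tau /\
                  exists2 X, ideal_generated T X & tau X != 0].

(* A is an associative, not necessarily unital, complex algebra with product
   mulA, acting on H through pi. *)
Record spectral_triple (A : lmodType R[i]) (mulA : A -> A -> A)
    (pi : A -> H -> H) D : Prop := {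
  st_mulA : associative mulA;
  st_mull : forall b, linear (mulA ^~ b);
  st_mulr : forall a, linear (mulA a);
  st_pi_linear : linear pi;
  st_pi_mul : forall a b, pi (mulA a b) = pi a \o pi b;
  st_pi_bounded : forall a, bounded_op (pi a);
  st_self_adjoint : self_adjoint D;
  st_compact_resolvent : compact_resolvent D;
  st_commutator : forall a,
    (forall x, op_dom D x -> op_dom D (pi a x)) /\
    exists M : R[i], forall x, op_dom D x ->
      `|D (pi a x) - pi a (D x)| <= M * `|x|
}.

(* Positive tracial linear functional. Positivity is tested on all the elements
   acting as positive operators, hence on every a^* a when pi is a
   *-representation of a *-algebra. The last clause says that phi has value 1 on
   the identity operator, if A contains it. *)
Definition trace_state (A : lmodType R[i]) (mulA : A -> A -> A)
    (pi : A -> H -> H) (phi : A -> R[i]) : Prop :=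
  [/\ scalar phi,
      forall a, positive_op (pi a) -> 0 <= phi a,
      forall a b, phi (mulA a b) = phi (mulA b a) &
      forall e, pi e =1 id -> phi e = 1].

End Operators.

(* Main.v *)
Require Import Defs.
From mathcomp Require Import ring lra zify.

Set Implicit Arguments.
Unset Strict Implicit.
Unset Printing Implicit Defensive.
Import Order.TTheory GRing.Theory Num.Theory Num.Def.
Import numFieldNormedType.Exports.
Local Open Scope classical_set_scope.
Local Open Scope ring_scope.

(** The eigenvectors e n of D form an orthonormal basis, with eigenvalues dl n
    of non-decreasing modulus, and |D|^-d is the diagonal operator S with entries
    s n = |dl n|^-d ([spectral_data], [abs_power_diag]).

    Existence of the trace. That the box dimension is d means that the lower limit
    of log (s n) / log (1/n) is 1, so that n * s n is eventually below every
    positive power of n and infinitely often above any given negative one. Therefore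
    one finds, arbitrarily far out, windows [n, N) on which n * s n + N * s N is
    negligible compared with the sum of the s j ([windows]). An element of the
    ideal generated by S is a finite sum X of operators A_i S B_i; let
    val X be the trace of the sum of the B_i A_i S', where S' is the part of S in
    the window, divided by the trace of S'. If X has nonnegative real part, then
    that of val X is at least -C (n s n + N s N) divided by the trace of S'
    ([window_trace_pos]): this
    compares the window with two cutoffs of finite dimension. Hence the limit of
    val along an ultrafilter of better and better windows depends on X only and
    is positive; it takes the value 1 at S, it is unitarily invariant by its
    shape, and it vanishes on finite rank operators because the windows leave
    every index ([singular_trace_exists]).

    The state. Let tau be any singular trace with tau S = 1 and phi a = tau (a S).
    Unitary invariance gives tau (B X) = tau (X B) for bounded B, because B is a
    combination of four unitaries ([tau_cyclic]). If a is positive with square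
    root Q, then phi a = tau (Q S Q) is nonnegative ([phi_positive]); thus phi is
    bounded, and it vanishes on norm limits of finite rank operators.

    Traciality of phi. Cut the basis into levels according to the annulus
    La q^k <= |dl n| < La q^(k+1), with q^d = 1 + de. As [D, a] is bounded, the
    blocks of a between nonadjacent levels decay geometrically
    ([gap_up], [gap_down]), so that
    a differs from a block tridiagonal nu by norm limits of finite rank operators
    ([near_diagonal]), which phi ignores. Up to a relative error de, S is scalar
    on each level, with ratio 1 + de between adjacent levels; so S nu and nu S
    differ by O(de) S, and |phi (nu b) - phi (b nu)| <= 28 |b| |nu| de
    ([tridiagonal_commutator]). Since de is arbitrary, phi (a b) = phi (b a)
    ([phi_tracial]). *)

(** * Complex numbers and the geometry of the Hilbert space *)

Section Modulus.
Context {R : realType}.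
Implicit Types (z w : R[i]) (a : R).

(** [`|z|] lies in [R[i]]; all the estimates are made in [R], where [lra] and [nra]
    apply. *)
Definition cmod z : R := complex.Re `|z|.

Lemma normCE z : `|z| = (cmod z)%:C%C.
Proof. by rewrite /cmod RRe_real // normr_real. Qed.

Lemma cmod_ge0 z : 0 <= cmod z.
Proof. by rewrite -ler0c -normCE. Qed.

Lemma cmodM z w : cmod (z * w) = cmod z * cmod w.
Proof. by apply: complexI; rewrite -normCE normrM rmorphM. Qed.

Lemma cmodD z w : cmod (z + w) <= cmod z + cmod w.
Proof. by rewrite -lecR rmorphD /= -!normCE ler_normD. Qed.

Lemma cmodN z : cmod (- z) = cmod z.
Proof. by rewrite /cmod normrN. Qed.

Lemma cmodR a : cmod a%:C%C = `|a|.
Proof. by rewrite /cmod normc_def /= expr0n addr0 sqrtr_sqr. Qed.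

Lemma cmod0 : cmod 0 = 0.
Proof. by rewrite /cmod normr0. Qed.

Lemma cmod_eq0 z : cmod z = 0 -> z = 0.
Proof. by move=> h; apply/normr0_eq0; rewrite normCE h. Qed.

Lemma cmod_sqr z : cmod z ^+ 2 = complex.Re z ^+ 2 + complex.Im z ^+ 2.
Proof. by apply: complexI; rewrite rmorphXn /= -normCE add_Re2_Im2. Qed.

Lemma conjCc z : z^* = conjc z.
Proof. by []. Qed.

Lemma cReJ z : complex.Re z^* = complex.Re z. Proof. by case: z. Qed.
Lemma cImJ z : complex.Im z^* = - complex.Im z. Proof. by case: z. Qed.

Lemma conjRC a : (a%:C%C)^* = a%:C%C :> R[i].
Proof. by rewrite conjCc conjc_real. Qed.

Lemma cmodJ z : cmod z^* = cmod z.
Proof. by rewrite /cmod norm_conjC. Qed.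

Lemma mulCJ z : z * z^* = (cmod z ^+ 2)%:C%C.
Proof. by rewrite -normCK normCE rmorphXn. Qed.

Lemma cReD z w : complex.Re (z + w) = complex.Re z + complex.Re w.
Proof. by case: z; case: w. Qed.
Lemma cImD z w : complex.Im (z + w) = complex.Im z + complex.Im w.
Proof. by case: z; case: w. Qed.
Lemma cReN z : complex.Re (- z) = - complex.Re z.
Proof. by case: z. Qed.
Lemma cImN z : complex.Im (- z) = - complex.Im z.
Proof. by case: z. Qed.
Lemma cReM z w : complex.Re (z * w) = complex.Re z * complex.Re w - complex.Im z * complex.Im w.
Proof. by case: z; case: w. Qed.
Lemma cImM z w : complex.Im (z * w) = complex.Re z * complex.Im w + complex.Im z * complex.Re w.
Proof. by case: z; case: w. Qed.
Lemma ReRM a z : complex.Re (a%:C%C * z) = a * complex.Re z.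
Proof. by rewrite cReM /= mul0r subr0. Qed.
Lemma ImRM a z : complex.Im (a%:C%C * z) = a * complex.Im z.
Proof. by rewrite cImM /= mul0r addr0. Qed.

Lemma Re_sum (I : Type) (r : seq I) (P : pred I) (F : I -> R[i]) :
  complex.Re (\sum_(i <- r | P i) F i) = \sum_(i <- r | P i) complex.Re (F i).
Proof. by apply: big_morph => //; exact: cReD. Qed.

Lemma ler_Re z : `|complex.Re z| <= cmod z.
Proof. by rewrite -lecR -normCE normc_ge_Re. Qed.

Lemma ler_Im z : `|complex.Im z| <= cmod z.
Proof.
rewrite -(ler_pXn2r (n:=2)) ?nnegrE ?cmod_ge0// cmod_sqr real_normK ?num_real//.
by rewrite lerDr sqr_ge0.
Qed.

Lemma ler_cmod z : cmod z <= `|complex.Re z| + `|complex.Im z|.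
Proof.
rewrite -(ler_pXn2r (n:=2)) ?nnegrE ?cmod_ge0 ?addr_ge0// cmod_sqr.
rewrite -[in leLHS](real_normK (num_real (complex.Re z))).
rewrite -[in leLHS](real_normK (num_real (complex.Im z))).
have := normr_ge0 (complex.Re z); have := normr_ge0 (complex.Im z); nra.
Qed.

Lemma cmod_sum (I : Type) (r : seq I) (P : pred I) (F : I -> R[i]) :
  cmod (\sum_(i <- r | P i) F i) <= \sum_(i <- r | P i) cmod (F i).
Proof.
elim/big_rec2: _ => [|i x y _ h]; first by rewrite cmod0.
by apply: (le_trans (cmodD _ _)); rewrite lerD2l.
Qed.

Lemma complex_eqP z w : complex.Re z = complex.Re w ->
  complex.Im z = complex.Im w -> z = w.
Proof. by case: z => ? ?; case: w => ? ? /= -> ->. Qed.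

End Modulus.

Section Norm.
Context {R : realType} {H : completeNormedModType R[i]}.
Context (dot : {dot H for conjC}) (hdot : hilbert_dot dot).
Implicit Types (x y z : H) (c : R[i]).

Definition hnorm x : R := complex.Re `|x|.

Lemma normHE x : `|x| = (hnorm x)%:C%C.
Proof. by rewrite /hnorm RRe_real // ger0_real. Qed.

Lemma hnorm_ge0 x : 0 <= hnorm x.
Proof. by rewrite -ler0c -normHE. Qed.

Lemma hnormD x y : hnorm (x + y) <= hnorm x + hnorm y.
Proof. by rewrite -lecR rmorphD /= -!normHE ler_normD. Qed.

Lemma hnormN x : hnorm (- x) = hnorm x.
Proof. by rewrite /hnorm normrN. Qed.

Lemma hnormC x y : hnorm (x - y) = hnorm (y - x).
Proof. by rewrite -hnormN opprB. Qed.

Lemma hnormB x y : hnorm (x - y) <= hnorm x + hnorm y.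
Proof. by rewrite -(hnormN y) hnormD. Qed.

Lemma hnormZ c x : hnorm (c *: x) = cmod c * hnorm x.
Proof. by apply: complexI; rewrite -normHE normrZ rmorphM /= -normHE -normCE. Qed.

Lemma hnorm0 : hnorm 0 = 0.
Proof. by rewrite /hnorm normr0. Qed.

Lemma hnorm_eq0 x : hnorm x = 0 -> x = 0.
Proof. by move=> h; apply/normr0_eq0; rewrite normHE h. Qed.

Lemma hnorm_gt0 x : x != 0 -> 0 < hnorm x.
Proof.
by move=> x0; rewrite lt_neqAle hnorm_ge0 andbT eq_sym; apply: contra_neq x0 => /hnorm_eq0.
Qed.

Lemma hnorm_sum (I : Type) (r : seq I) (P : pred I) (F : I -> H) :
  hnorm (\sum_(i <- r | P i) F i) <= \sum_(i <- r | P i) hnorm (F i).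
Proof.
elim/big_rec2: _ => [|i x y _ h]; first by rewrite hnorm0.
by apply: (le_trans (hnormD _ _)); rewrite lerD2l.
Qed.

Lemma dotxx x : dot x x = (hnorm x ^+ 2)%:C%C.
Proof. by rewrite hdot normHE rmorphXn. Qed.

Lemma dotC x y : dot x y = (dot y x)^*.
Proof. by rewrite hermC expr0 mul1r. Qed.

Lemma dotDl x y z : dot (x + y) z = dot x z + dot y z.
Proof. exact: linearDl. Qed.
Lemma dotBl x y z : dot (x - y) z = dot x z - dot y z.
Proof. exact: linearBl. Qed.
Lemma dotZl c x z : dot (c *: x) z = c * dot x z.
Proof. exact: linearZl_LR. Qed.
Lemma dot0l z : dot 0 z = 0.
Proof. exact: linear0l. Qed.
Lemma dotNl x z : dot (- x) z = - dot x z.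
Proof. exact: linearNl. Qed.
Lemma dotDr x y z : dot z (x + y) = dot z x + dot z y.
Proof. by rewrite dotC dotDl rmorphD /= -!dotC. Qed.
Lemma dotNr x z : dot z (- x) = - dot z x.
Proof. by rewrite dotC dotNl rmorphN /= -!dotC. Qed.
Lemma dotBr x y z : dot z (x - y) = dot z x - dot z y.
Proof. by rewrite dotDr dotNr. Qed.
Lemma dotZr c x z : dot z (c *: x) = c^* * dot z x.
Proof. by rewrite dotC dotZl rmorphM /= -!dotC. Qed.
Lemma dot0r z : dot z 0 = 0.
Proof. by rewrite dotC dot0l rmorph0. Qed.
Lemma dot_suml (I : Type) (r : seq I) (P : pred I) (F : I -> H) z :
  dot (\sum_(i <- r | P i) F i) z = \sum_(i <- r | P i) dot (F i) z.
Proof. by apply: (big_morph (fun x => dot x z)) => [x y|]; rewrite ?dotDl ?dot0l. Qed.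
Lemma dot_sumr (I : Type) (r : seq I) (P : pred I) (F : I -> H) z :
  dot z (\sum_(i <- r | P i) F i) = \sum_(i <- r | P i) dot z (F i).
Proof. by apply: (big_morph (dot z)) => [x y|]; rewrite ?dotDr ?dot0r. Qed.

Lemma hnormD_sqr x y : hnorm (x + y) ^+ 2 = hnorm x ^+ 2 + hnorm y ^+ 2 + 2 * complex.Re (dot x y).
Proof.
apply: complexI; rewrite -dotxx dotDl !dotDr (dotC y x) !rmorphD /= -!dotxx.
by apply: complex_eqP; rewrite !(cReD, cImD) ?(cReJ, cImJ) /= ?mulr_natl ?mulr2n; lra.
Qed.

Lemma hnormB_sqr x y : hnorm (x - y) ^+ 2 = hnorm x ^+ 2 + hnorm y ^+ 2 - 2 * complex.Re (dot x y).
Proof. by rewrite hnormD_sqr hnormN dotNr cReN mulrN. Qed.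

Lemma dot_eq0 x : dot x x = 0 -> x = 0.
Proof.
rewrite dotxx => /(@complexI _ _ 0)/eqP; rewrite sqrf_eq0 => /eqP; exact: hnorm_eq0.
Qed.

Lemma cauchy_schwarz x y : cmod (dot x y) <= hnorm x * hnorm y.
Proof.
have [->|y0] := eqVneq y 0; first by rewrite dot0r cmod0 mulr_ge0 ?hnorm_ge0.
have yp := hnorm_gt0 y0.
pose t : R := (hnorm y ^+ 2)^-1.
pose c := (t)%:C%C * dot x y.
have h : 0 <= hnorm (x - c *: y) ^+ 2 by rewrite sqr_ge0.
move: h; rewrite hnormB_sqr hnormZ dotZr /c rmorphM /= conjRC -mulrA [_^* * _]mulrC mulCJ.
rewrite ReRM /= cmodM cmodR ger0_norm ?invr_ge0 ?sqr_ge0// => h.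
rewrite -(ler_pXn2r (n:=2)) ?nnegrE ?cmod_ge0 ?mulr_ge0 ?hnorm_ge0//.
have ty : t * hnorm y ^+ 2 = 1 by rewrite mulVf // expf_neq0 // gt_eqF.
have tp : 0 < t by rewrite invr_gt0 exprn_gt0.
move: (cmod _) (hnorm x) (hnorm y) ty h => a X Y ty h.
have {}h : 0 <= X ^+ 2 - t * a ^+ 2.
  have -> : X ^+ 2 - t * a ^+ 2 = X ^+ 2 + (t * a * Y) ^+ 2 - 2 * (t * a ^+ 2)
     + (t * a ^+ 2) * (1 - t * Y ^+ 2) by ring.
  by rewrite ty subrr mulr0 addr0.
have -> : a ^+ 2 = (t * Y ^+ 2) * a ^+ 2 by rewrite ty mul1r.
by nra.
Qed.

Lemma Re_dot_le x y : `|complex.Re (dot x y)| <= hnorm x * hnorm y.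
Proof. exact: le_trans (ler_Re _) (cauchy_schwarz _ _). Qed.

Lemma dot_ext x y : (forall z, dot x z = dot y z) -> x = y.
Proof.
by move=> h; apply/eqP; rewrite -subr_eq0; apply/eqP/dot_eq0; rewrite dotBl h subrr.
Qed.

Lemma hnorm_cauchy (u : nat -> H) :
  (forall e : R, 0 < e -> exists N, forall m n, (N <= m)%N -> (N <= n)%N -> hnorm (u m - u n) < e) ->
  exists y, forall e : R, 0 < e -> exists N, forall n, (N <= n)%N -> hnorm (u n - y) < e.
Proof.
move=> hu.
have /cvg_ex[y uy] : cvg (u @ \oo).
  apply/cauchy_cvgP/cauchy_exP => e e0.
  have er : e = (complex.Re e)%:C%C by rewrite RRe_real // gtr0_real.
  have /hu[N hN] : 0 < complex.Re e by rewrite -ltcR -er.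
  exists (u N); exists N => // n /= Nn.
  rewrite -ball_normE /= normHE er ltcR; exact: hN.
exists y => e e0.
have /cvgrPdist_lt/(_ (e%:C%C)) := uy.
rewrite ltcR => /(_ e0)[N _ hN]; exists N => n Nn.
by have := hN n Nn; rewrite /= normHE ltcR hnormC.
Qed.

Lemma hnorm_small x : (forall e : R, 0 < e -> hnorm x <= e) -> x = 0.
Proof.
move=> h; apply: hnorm_eq0; apply/eqP; rewrite eq_le hnorm_ge0 andbT.
by apply/ler_addgt0Pr => e e0; rewrite add0r h.
Qed.

Section LinearMaps.
Context (T : H -> H) (lT : linear T).

Lemma linD x y : T (x + y) = T x + T y.
Proof. by have := lT 1 x y; rewrite !scale1r. Qed.

Lemma lin0 : T 0 = 0.
Proof. by apply: (@addrI _ (T 0)); rewrite -linD !addr0. Qed.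

Lemma linZ c x : T (c *: x) = c *: T x.
Proof. by have := lT c x 0; rewrite lin0 !addr0. Qed.

Lemma linN x : T (- x) = - T x.
Proof. by rewrite -scaleN1r linZ scaleN1r. Qed.

Lemma linB x y : T (x - y) = T x - T y.
Proof. by rewrite linD linN. Qed.

Lemma lin_sum (I : Type) (r : seq I) (P : pred I) (F : I -> H) :
  T (\sum_(i <- r | P i) F i) = \sum_(i <- r | P i) T (F i).
Proof. by apply: (big_morph T) => [x y|]; rewrite ?linD ?lin0. Qed.

End LinearMaps.

Lemma bounded_opP (T : H -> H) : bounded_op T <->
  linear T /\ exists2 M : R, 0 <= M & forall x, hnorm (T x) <= M * hnorm x.
Proof.
split=> [[lT [M hM]]|[lT [M M0 hM]]]; split=> //; last first.
  by exists M%:C%C => x; rewrite !normHE -rmorphM lecR.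
exists (cmod M) => [|x]; first exact: cmod_ge0.
have [->|x0] := eqVneq x 0; first by rewrite lin0// hnorm0 mulr0.
have xp : 0 < `|x| by rewrite normr_gt0.
rewrite -lecR rmorphM /= -!normHE -normCE (le_trans (hM x))//.
rewrite ler_pM2r// real_ler_norm// ger0_real//.
by rewrite -(pmulr_lge0 _ xp) (le_trans _ (hM x)).
Qed.

Lemma bounded_lin (T : H -> H) : bounded_op T -> linear T.
Proof. by case. Qed.

Lemma bounded_comp (S T : H -> H) : bounded_op S -> bounded_op T -> bounded_op (S \o T).
Proof.
move=> /bounded_opP[lS [M M0 hM]] /bounded_opP[lT [N N0 hN]].
apply/bounded_opP; split=> [a x y /=|]; first by rewrite lT lS.
exists (M * N) => [|x]; first exact: mulr_ge0.
by rewrite -mulrA /= (le_trans (hM _))// ler_wpM2l.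
Qed.

Lemma bounded_id : bounded_op (id : H -> H).
Proof. by apply/bounded_opP; split=> //; exists 1 => // x; rewrite mul1r. Qed.

Lemma bounded_0 : bounded_op (0 : H -> H).
Proof.
apply/bounded_opP; split=> [a x y|]; first by rewrite /= scaler0 addr0.
by exists 0 => // x; rewrite mul0r hnorm0.
Qed.

Lemma bounded_add (S T : H -> H) : bounded_op S -> bounded_op T -> bounded_op (S + T).
Proof.
move=> /bounded_opP[lS [M M0 hM]] /bounded_opP[lT [N N0 hN]].
apply/bounded_opP; split=> [a x y|].
  by rewrite !fctE lT lS scalerDr addrACA.
exists (M + N) => [|x]; first exact: addr_ge0.
by rewrite fctE mulrDl (le_trans (hnormD _ _))// lerD.
Qed.

Lemma bounded_scale c (T : H -> H) : bounded_op T -> bounded_op (c *: T).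
Proof.
move=> /bounded_opP[lT [N N0 hN]].
apply/bounded_opP; split=> [a x y|].
  by rewrite !fctE lT scalerDr !scalerA mulrC.
exists (cmod c * N) => [|x]; first by rewrite mulr_ge0 ?cmod_ge0.
by rewrite fctE hnormZ -mulrA ler_wpM2l ?cmod_ge0.
Qed.

Definition orthn (f : nat -> H) (r : nat) :=
  forall i j, (i < r)%N -> (j < r)%N -> dot (f i) (f j) = (i == j)%:R.

Definition proj (f : nat -> H) (r : nat) x := \sum_(i < r) dot x (f i) *: f i.

Lemma dot_comb (f : nat -> H) r (u : nat -> R[i]) j : orthn f r -> (j < r)%N ->
  dot (\sum_(i < r) u i *: f i) (f j) = u j.
Proof.
move=> of_ jr; rewrite dot_suml (bigD1 (Ordinal jr)) //= dotZl of_// eqxx mulr1.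
rewrite big1 ?addr0// => i ij; rewrite dotZl of_// -val_eqE /= in ij *.
by rewrite (negPf ij) mulr0.
Qed.

Lemma hnorm_comb (f : nat -> H) r (u : nat -> R[i]) : orthn f r ->
  hnorm (\sum_(i < r) u i *: f i) ^+ 2 = \sum_(i < r) cmod (u i) ^+ 2.
Proof.
move=> of_; apply: complexI; rewrite -dotxx dot_sumr rmorph_sum /=.
by apply: eq_bigr => j _; rewrite dotZr dot_comb// mulrC mulCJ.
Qed.

Lemma dot_proj f r x j : orthn f r -> (j < r)%N -> dot (proj f r x) (f j) = dot x (f j).
Proof. by move=> of_ jr; rewrite (dot_comb (fun i => dot x (f i))). Qed.

Lemma hnorm_proj f r x : orthn f r -> hnorm (proj f r x) ^+ 2 = \sum_(i < r) cmod (dot x (f i)) ^+ 2.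
Proof. by move=> of_; rewrite (hnorm_comb (fun i => dot x (f i))). Qed.

Lemma proj_residual f r x : orthn f r ->
  hnorm (x - proj f r x) ^+ 2 = hnorm x ^+ 2 - \sum_(i < r) cmod (dot x (f i)) ^+ 2.
Proof.
move=> of_; rewrite hnormB_sqr hnorm_proj//.
have -> : dot x (proj f r x) = (\sum_(i < r) cmod (dot x (f i)) ^+ 2)%:C%C.
  rewrite dot_sumr rmorph_sum /=; apply: eq_bigr => i _.
  by rewrite dotZr mulrC mulCJ.
by rewrite /=; lra.
Qed.

Lemma bessel f r x : orthn f r -> \sum_(i < r) cmod (dot x (f i)) ^+ 2 <= hnorm x ^+ 2.
Proof. by move=> of_; rewrite -subr_ge0 -proj_residual// sqr_ge0. Qed.

Lemma hnorm_proj_le f r x : orthn f r -> hnorm (proj f r x) <= hnorm x.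
Proof.
move=> of_; rewrite -(ler_pXn2r (n:=2)) ?nnegrE ?hnorm_ge0// hnorm_proj//; exact: bessel.
Qed.

Lemma dot_residual f r x j : orthn f r -> (j < r)%N -> dot (x - proj f r x) (f j) = 0.
Proof. by move=> of_ jr; rewrite dotBl dot_proj// subrr. Qed.

Lemma proj_comb (f : nat -> H) r (u : nat -> R[i]) : orthn f r ->
  proj f r (\sum_(i < r) u i *: f i) = \sum_(i < r) u i *: f i.
Proof. by move=> of_; apply: eq_bigr => i _; rewrite dot_comb. Qed.

Lemma proj_lin f r : linear (proj f r).
Proof.
move=> a x y; rewrite /proj scaler_sumr -big_split /=; apply: eq_bigr => i _.
by rewrite dotDl dotZl scalerDl scalerA.
Qed.

Lemma proj_ext f f' r r' v : orthn f' r' -> (r <= r')%N ->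
  (forall i, (i < r)%N -> f' i = f i) -> proj f r v = v -> proj f' r' v = v.
Proof.
move=> of' rr ff <-.
have -> : proj f r v = \sum_(i < r') (if (i < r)%N then dot v (f i) else 0) *: f' i.
  rewrite /proj (big_ord_widen _ (fun i => dot v (f i) *: f i) rr) big_mkcond /=.
  by apply: eq_bigr => i _; case: ifP => [ir|_]; [rewrite ff|rewrite scale0r].
by rewrite (proj_comb (fun i => if (i < r)%N then dot v (f i) else 0)).
Qed.

(** The new family extends the old one, so that applying this twice produces nested
    subspaces; the bound on r' controls their dimensions. *)
Lemma gram_schmidt (l : seq H) f r : orthn f r ->
  exists f' r', [/\ orthn f' r', (r <= r' <= r + size l)%N,
    forall i, (i < r)%N -> f' i = f i & forall v, v \in l -> proj f' r' v = v].
Proof.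
elim: l f r => [|v l IH] f r of_.
  by exists f, r; split=> //; rewrite addn0 leqnn.
have [f1 [r1 [of1 /andP[rr1 r1r] ff1 vf1]]] : exists f1 r1, [/\ orthn f1 r1, (r <= r1 <= r.+1)%N,
    forall i, (i < r)%N -> f1 i = f i & proj f1 r1 v = v].
  have [vv|vv] := eqVneq (v - proj f r v) 0.
    exists f, r; split=> //; first by rewrite leqnn leqnSn.
    by apply/esym/eqP; rewrite -subr_eq0 vv.
  set w := v - _ in vv; pose u := ((hnorm w)^-1)%:C%C *: w.
  have wp := hnorm_gt0 vv.
  have uu : dot u u = 1.
    rewrite dotxx hnormZ cmodR ger0_norm ?invr_ge0 ?hnorm_ge0// mulVf ?gt_eqF//.
    by rewrite expr1n.
  have uf j : (j < r)%N -> dot u (f j) = 0.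
    by move=> jr; rewrite dotZl dot_residual// mulr0.
  pose f1 i := if (i < r)%N then f i else u.
  have of1 : orthn f1 r.+1.
    move=> i j; rewrite !ltnS /f1 => ir jr.
    case: (ltnP i r) => [ir'|ri]; case: (ltnP j r) => [jr'|rj].
    - exact: of_.
    - by rewrite dotC uf// rmorph0 ltn_eqF// (leq_trans ir').
    - by rewrite uf// gtn_eqF// (leq_trans jr').
    - by rewrite uu (_ : i = j) ?eqxx//; apply/eqP; rewrite eqn_leq (leq_trans ir rj) (leq_trans jr ri).
  exists f1, r.+1; split=> //; rewrite ?leqnn ?leqnSn//.
    by move=> i ir; rewrite /f1 ir.
  have -> : v = proj f r v + (hnorm w)%:C%C *: u.
    by rewrite scalerA -rmorphM divff ?gt_eqF// rmorph1 scale1r addrC subrK.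
  rewrite (linD (@proj_lin _ _)); congr (_ + _).
    apply: (@proj_ext f _ r) => //; first by move=> i ir; rewrite /f1 ir.
    exact: (@proj_comb _ _ (fun i => dot v (f i))).
  rewrite (linZ (@proj_lin _ _)); congr (_ *: _).
  rewrite /proj big_ord_recr /= big1 => [|i _]; last first.
    by rewrite /f1 ltn_ord uf// scale0r.
  by rewrite /f1 ltnn uu scale1r add0r.
have [f2 [r2 [of2 /andP[rr2 r2r] ff2 lf2]]] := IH f1 r1 of1.
exists f2, r2; split=> //.
- rewrite (leq_trans rr1)//= (leq_trans r2r)// addnS -addSn leq_add2r//.
- by move=> i ir; rewrite ff2 ?ff1// (leq_trans ir).
- move=> x; rewrite inE => /predU1P[->|]; last exact: lf2.
  exact: (@proj_ext f1 _ r1).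
Qed.

Lemma orthn_count (e g : nat -> H) m n : orthn e m -> orthn g n ->
  (forall i, (i < n)%N -> proj e m (g i) = g i) -> (n <= m)%N.
Proof.
move=> oe og ge.
have key (k : nat) (h : nat -> H) : orthn h k -> \sum_(i < k) hnorm (h i) ^+ 2 = k%:R.
  move=> oh; rewrite (eq_bigr (fun=> 1)) ?sumr_const ?card_ord// => i _.
  by apply: complexI; rewrite -dotxx oh// eqxx.
have h1 : n%:R = \sum_(i < n) \sum_(j < m) cmod (dot (g i) (e j)) ^+ 2.
  rewrite -(key n g)//; apply: eq_bigr => i _.
  by rewrite -hnorm_proj// ge.
rewrite -(ler_nat R) h1 -(key m e)// exchange_big /=.
apply: ler_sum => j _; apply: le_trans (bessel (e j) og).
by apply: ler_sum => i _; rewrite dotC cmodJ.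
Qed.

Lemma le_eps (a b : R) : (forall e : R, 0 < e -> a <= b + e) -> a <= b.
Proof. by move=> h; apply/ler_addgt0Pr. Qed.

Lemma archi_inv (e : R) : 0 < e -> exists N, forall n, (N <= n)%N -> n.+1%:R^-1 < e.
Proof.
move=> e0; exists (Num.trunc e^-1) => n Nn.
rewrite invf_plt ?posrE ?ltr0n//; apply: (lt_le_trans (truncnS_gt _)).
by rewrite ler_nat.
Qed.

Lemma parallelogram x y : hnorm (x + y) ^+ 2 + hnorm (x - y) ^+ 2 = 2 * hnorm x ^+ 2 + 2 * hnorm y ^+ 2.
Proof. by rewrite hnormD_sqr hnormB_sqr; lra. Qed.

(** Otherwise c = <x, z> / |z|^2 would give a smaller norm. *)
Lemma orth_of_min x z : (forall c, hnorm x <= hnorm (x - c *: z)) -> dot x z = 0.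
Proof.
move=> h; apply/eqP; rewrite -[_ == _]negbK; apply/negP => xz0.
have z0 : z != 0 by apply: contraNneq xz0 => ->; rewrite dot0r.
have zp := hnorm_gt0 z0.
pose t : R := (hnorm z ^+ 2)^-1.
have tz : t * hnorm z ^+ 2 = 1 by rewrite mulVf // expf_neq0 // gt_eqF.
have tp : 0 < t by rewrite invr_gt0 exprn_gt0.
have := h (t%:C%C * dot x z); rewrite -(ler_pXn2r (n:=2)) ?nnegrE ?hnorm_ge0//.
rewrite hnormB_sqr hnormZ dotZr rmorphM /= conjRC -mulrA [_^* * _]mulrC mulCJ.
rewrite ReRM /= cmodM cmodR ger0_norm ?(ltW tp)// => {}h.
have ap : 0 < cmod (dot x z).
  by rewrite lt_neqAle cmod_ge0 andbT eq_sym; apply: contra_neq xz0 => /cmod_eq0.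
move: (cmod _) (hnorm x) (hnorm z) ap tz h => a X Y ap ty h.
have : 0 < t * a ^+ 2 by rewrite mulr_gt0 ?exprn_gt0.
have -> : t * a ^+ 2 = (t * a * Y) ^+ 2 + (t * a ^+ 2) * (1 - t * Y ^+ 2) by ring.
rewrite ty subrr mulr0 addr0.
have : (t * a * Y) ^+ 2 = t * a ^+ 2 * (t * Y ^+ 2) by ring.
rewrite ty mulr1; lra.
Qed.

(** By the parallelogram law, a sequence that minimizes the distance from y to M is
    Cauchy; its limit is the orthogonal projection of y. *)
Lemma closed_subspace_proj (M : set H) y : M 0 ->
  (forall c u v, M u -> M v -> M (c *: u + v)) ->
  (forall (u : nat -> H) v, (forall n, M (u n)) ->
    (forall e : R, 0 < e -> exists N, forall n, (N <= n)%N -> hnorm (u n - v) < e) -> M v) ->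
  exists2 v, M v & forall z, M z -> dot (y - v) z = 0.
Proof.
move=> M0 Ml Mc.
pose S := [set hnorm (y - v) | v in M].
have S0 : has_inf S.
  by split; [exists (hnorm (y - 0)), 0|exists 0 => _ [v _ <-]; exact: hnorm_ge0].
pose dl := inf S.
have dlB v : M v -> dl <= hnorm (y - v) by move=> Mv; apply: ge_inf; [case: S0|exists v].
have dl0 : 0 <= dl by apply: lb_le_inf; [case: S0|move=> _ [v _ <-]; exact: hnorm_ge0].
have ex n : exists v, M v /\ hnorm (y - v) ^+ 2 < dl ^+ 2 + n.+1%:R^-1.
  have hp : 0 < n.+1%:R^-1 :> R by rewrite invr_gt0 ltr0n.
  have sp : 0 < Num.sqrt (dl ^+ 2 + n.+1%:R^-1) - dl.
    rewrite subr_gt0 -(ltr_pXn2r (n:=2)) ?nnegrE ?sqrtr_ge0// sqr_sqrtr ?ltrDl//.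
    by rewrite addr_ge0 ?sqr_ge0 ?ltW.
  have [_ [v Mv <-]] := inf_adherent sp S0; rewrite [ltRHS]addrC subrK => dlv; exists v; split=> //.
  rewrite -(@sqr_sqrtr _ (dl ^+ 2 + _)); last by rewrite addr_ge0 ?sqr_ge0 ?ltW.
  by rewrite ltr_pXn2r// ?nnegrE ?sqrtr_ge0 ?hnorm_ge0.
have /choice[u hu] := ex.
have mid m n : dl ^+ 2 *+ 4 <= hnorm ((y - u m) + (y - u n)) ^+ 2.
  have : M (2^-1 *: u m + 2^-1 *: u n).
    by apply: (Ml); [case: (hu m)|rewrite -[_ *: _]addr0; apply: (Ml) => //; case: (hu n)].
  move=> /dlB; rewrite -(ler_pXn2r (n:=2)) ?nnegrE ?hnorm_ge0// => h.
  have -> : (y - u m) + (y - u n) = 2 *: (y - (2^-1 *: u m + 2^-1 *: u n)).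
    rewrite scalerBr scalerDr !scalerA mulfV ?pnatr_eq0// !scale1r opprD addrACA.
    by rewrite scaler_nat mulr2n.
  rewrite hnormZ exprMn (_ : cmod 2 = 2).
    by rewrite -mulr_natl -natrX ler_wpM2l// ler0n.
  by rewrite -(rmorph_nat (real_complex R)) cmodR ger0_norm// ler0n.
have cau m n : hnorm (u m - u n) ^+ 2 <= 2 * (m.+1%:R^-1 + n.+1%:R^-1).
  have := parallelogram (y - u n) (y - u m).
  have -> : (y - u n) - (y - u m) = u m - u n by rewrite opprB addrC subrKA.
  have := mid n m; have [_] := hu m; have [_] := hu n.
  move: (m.+1%:R^-1) (n.+1%:R^-1) => a b h1 h2 h3 h4; lra.
have [e e0|v uv] := @hnorm_cauchy u.
  have e40 : 0 < e ^+ 2 / 4 by rewrite divr_gt0 ?exprn_gt0 ?ltr0n.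
  have [N hN] := archi_inv e40.
  exists N => m n Nm Nn.
  rewrite -(ltr_pXn2r (n:=2)) ?nnegrE ?hnorm_ge0 ?(ltW e0)// (le_lt_trans (cau m n))//.
  by move: (hN m Nm) (hN n Nn); move: (m.+1%:R^-1) (n.+1%:R^-1) => a b; lra.
have Mv : M v by apply: Mc uv => n; case: (hu n).
exists v => // z Mz; apply: orth_of_min => c.
apply: (@le_trans _ _ dl); last first.
  rewrite -addrA -opprD; apply: dlB; rewrite addrC; exact: Ml.
suff le_e (e : R) : 0 < e -> hnorm (y - v) <= dl + e by apply/ler_addgt0Pr.
move=> e0; have e20 : 0 < e / 2 by rewrite divr_gt0.
have [N1 h1] := uv _ e20; have [N2 h2] := archi_inv (exprn_gt0 2 e20).
pose n := maxn N1 N2.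
have {}h1 := h1 n (leq_maxl _ _); have {}h2 := h2 n (leq_maxr _ _).
have [Mu hun] := hu n.
have : hnorm (y - u n) <= dl + e / 2.
  rewrite -(ler_pXn2r (n:=2)) ?nnegrE ?hnorm_ge0 ?addr_ge0 ?(ltW e20)//.
  by move: (n.+1%:R^-1) h2 hun => a h2 hun; nra.
have := hnormD (y - u n) (u n - v); rewrite subrKA; lra.
Qed.

End Norm.

(** * Orthonormal bases, diagonal operators and adjoints *)

Lemma sum_cauchy {R : realType} (u : nat -> R) (B : R) : (forall n, 0 <= u n) ->
  (forall n, \sum_(i < n) u i <= B) ->
  forall e, 0 < e -> exists N, forall n, (N <= n)%N -> \sum_(N <= i < n) u i < e.
Proof.
move=> u0 uB e e0; pose S := range (fun n => \sum_(0 <= i < n) u i).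
have hS : has_sup S.
  split; first by exists (\sum_(0 <= i < 0) u i), 0%N.
  by exists B => _ [n _ <-]; rewrite big_mkord.
have [_ [N _ <-] hN] := sup_adherent e0 hS.
exists N => n Nn.
have : \sum_(0 <= i < n) u i <= sup S by apply: ub_le_sup; [case: hS|exists n].
by rewrite (@big_cat_nat _ _ _ N)//=; lra.
Qed.

Section Compact.
Context {R : realType} {H : completeNormedModType R[i]}.

Lemma compact_cluster (K : H -> H) (x : nat -> H) (B : R) : compact_op K ->
  (forall n, hnorm (x n) <= B) ->
  exists y, forall (e : R) N, 0 < e -> exists2 n, (N <= n)%N & hnorm (K (x n) - y) < e.
Proof.
move=> [lK]; rewrite precompactE => cK xB.
pose B' := maxr B 1.
have B0 : 0 < B' by rewrite lt_max ltr01 orbT.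
pose z n := K ((B'^-1)%:C%C *: x n).
have Fz : (z @ \oo) (closure (K @` [set x : H | `|x| <= 1])).
  exists 0%N => // n _; apply: subset_closure; exists ((B'^-1)%:C%C *: x n) => //=.
  rewrite normHE -[1]/(1%:C%C) lecR hnormZ cmodR ger0_norm ?invr_ge0 ?(ltW B0)//.
  by rewrite mulrC ler_pdivrMr// mul1r le_max xB.
have [w [_ wz]] := cK _ _ Fz.
exists (B'%:C%C *: w) => e N e0.
have eB : 0 < e / B' by rewrite divr_gt0.
have FA : (z @ \oo) [set z n | n in [set n | (N <= n)%N]].
  by exists N => // n Nn; exists n.
have nB : nbhs w (ball w (e / B')%:C%C) by apply: nbhsx_ballx; rewrite ltcR.
have [_ [[n Nn <-]]] := wz _ _ FA nB.
rewrite -ball_normE /= normHE ltcR => h; exists n => //.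
have -> : K (x n) = B'%:C%C *: z n.
  by rewrite /z (linZ lK) scalerA -rmorphM mulfV ?gt_eqF// scale1r.
by rewrite -scalerBr hnormZ hnormC cmodR gtr0_norm// mulrC -ltr_pdivlMr.
Qed.

End Compact.

Section Basis.
Context {R : realType} {H : completeNormedModType R[i]}.
Context (dot : {dot H for conjC}) (hdot : hilbert_dot dot).
Context (e : nat -> H).
Hypothesis oe : forall i j, dot (e i) (e j) = (i == j)%:R.
Hypothesis te : forall x, (forall i, dot x (e i) = 0) -> x = 0.
Implicit Types (x y z : H) (u : nat -> R[i]).

Lemma basis_orthn n : orthn dot e n.
Proof. by move=> i j _ _; exact: oe. Qed.
Arguments basis_orthn : clear implicits.

Lemma coef_proj x M i : dot (proj dot e M x) (e i) = (i < M)%N%:R * dot x (e i).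
Proof.
have [iM|Mi] := ltnP i M; first by rewrite (dot_proj _ (basis_orthn M))// mul1r.
rewrite mul0r dot_suml big1// => k _; rewrite dotZl oe ltn_eqF ?mulr0//.
exact: leq_trans (ltn_ord k) Mi.
Qed.

Lemma coef_ext x y : (forall i, dot x (e i) = dot y (e i)) -> x = y.
Proof.
by move=> h; apply/eqP; rewrite -subr_eq0; apply/eqP/te => i; rewrite dotBl h subrr.
Qed.

Lemma riesz_fischer_lim u (B : R) : (forall n, \sum_(i < n) cmod (u i) ^+ 2 <= B) ->
  exists y, (forall i, dot y (e i) = u i) /\
    forall eps : R, 0 < eps ->
      exists N, forall n, (N <= n)%N -> hnorm (\sum_(i < n) u i *: e i - y) < eps.
Proof.
move=> uB; pose w n := \sum_(i < n) u i *: e i.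
have wB m n : (n <= m)%N -> hnorm (w m - w n) ^+ 2 = \sum_(n <= i < m) cmod (u i) ^+ 2.
  move=> nm; pose v i := if (n <= i)%N then u i else 0.
  have -> : w m - w n = \sum_(i < m) v i *: e i.
    rewrite /w -(big_mkord xpredT (fun i => u i *: e i)) (@big_cat_nat _ _ _ n)//=.
    rewrite big_mkord addrAC subrr add0r -(big_mkord xpredT (fun i => v i *: e i)).
    rewrite [RHS](@big_cat_nat _ _ _ n)//= [X in X + _]big1_seq ?add0r => [|i].
      by apply: eq_big_nat => i /andP[ni _]; rewrite /v ni.
    by rewrite mem_index_iota /= => ir; rewrite /v leqNgt ir scale0r.
  rewrite (hnorm_comb hdot _ (basis_orthn m)) -(big_mkord xpredT (fun i => cmod (v i) ^+ 2)).
  rewrite (@big_cat_nat _ _ _ n)//= [X in X + _]big1_seq ?add0r => [|i].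
    by apply: eq_big_nat => i /andP[ni _]; rewrite /v ni.
  by rewrite mem_index_iota /= => ir; rewrite /v leqNgt ir cmod0 expr0n.
have [eps eps0|y wy] := hnorm_cauchy (u := w).
  have e20 : 0 < eps / 2 by rewrite divr_gt0.
  have [N hN] := sum_cauchy (fun n => sqr_ge0 (cmod (u n))) uB (exprn_gt0 2 e20).
  have wN m : (N <= m)%N -> hnorm (w m - w N) < eps / 2.
    move=> Nm; rewrite -(ltr_pXn2r (n:=2)) ?nnegrE ?hnorm_ge0 ?(ltW e20)// wB//.
    exact: hN.
  exists N => m n Nm Nn; have -> : w m - w n = (w m - w N) + (w N - w n) by rewrite subrKA.
  apply: (le_lt_trans (hnormD _ _)); rewrite (hnormC (w N)).
  have := wN m Nm; have := wN n Nn; lra.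
exists y; split=> // i; apply/eqP; rewrite -subr_eq0; apply/eqP/cmod_eq0.
apply/eqP; rewrite eq_le cmod_ge0 andbT; apply: le_eps => eps eps0; rewrite add0r.
have [N hN] := wy eps eps0; pose n := maxn N i.+1.
have -> : u i = dot (w n) (e i) by rewrite (dot_comb u (basis_orthn n)) ?leq_maxr.
rewrite -dotBl (le_trans (cauchy_schwarz hdot _ _))//.
have -> : hnorm (e i) = 1.
  apply/eqP; rewrite -(@eqrXn2 _ 2) ?hnorm_ge0//; apply/eqP/complexI.
  by rewrite -(dotxx hdot) oe eqxx expr1n.
by rewrite mulr1 hnormC ltW// hN// leq_maxl.
Qed.

Lemma hnorm_basis i : hnorm (e i) = 1.
Proof.
apply/eqP; rewrite -(@eqrXn2 _ 2) ?hnorm_ge0//; apply/eqP/complexI.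
by rewrite -(dotxx hdot) oe eqxx expr1n.
Qed.

Lemma proj_cvg x (eps : R) : 0 < eps ->
  exists N, forall n, (N <= n)%N -> hnorm (proj dot e n x - x) < eps.
Proof.
move=> eps0.
have [y [yx hy]] := riesz_fischer_lim (u := fun i => dot x (e i)) (fun n => bessel hdot x (basis_orthn n)).
have -> : x = y by apply: coef_ext.
have [N hN] := hy _ eps0; exists N => n Nn.
rewrite (_ : proj _ _ _ _ = \sum_(i < n) dot x (e i) *: e i); first exact: hN.
by apply: eq_bigr => i _; rewrite yx.
Qed.

Lemma coef_norm_le x (B : R) : 0 <= B ->
  (forall n, \sum_(i < n) cmod (dot x (e i)) ^+ 2 <= B ^+ 2) -> hnorm x <= B.
Proof.
move=> B0 hB; apply: le_eps => eps eps0.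
have [N hN] := proj_cvg x eps0.
have pB : hnorm (proj dot e N x) <= B.
  by rewrite -(ler_pXn2r (n:=2)) ?nnegrE ?hnorm_ge0// (hnorm_proj hdot _ (basis_orthn N)).
have := hN N (leqnn _); rewrite hnormC => h.
have := hnormD (x - proj dot e N x) (proj dot e N x); rewrite subrK; lra.
Qed.

Lemma riesz_fischer u (B : R) : (forall n, \sum_(i < n) cmod (u i) ^+ 2 <= B) ->
  exists y, forall i, dot y (e i) = u i.
Proof. by move=> /riesz_fischer_lim[y [yu _]]; exists y. Qed.

(** Diagonal operators and adjoints are both obtained here, by prescribing the
    coefficients of their values. *)
Lemma coef_map (c : nat -> H -> R[i]) (B : R) : 0 <= B ->
  (forall i a x y, c i (a *: x + y) = a * c i x + c i y) ->
  (forall n x, \sum_(i < n) cmod (c i x) ^+ 2 <= (B * hnorm x) ^+ 2) ->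
  exists T : H -> H, [/\ linear T, forall x, hnorm (T x) <= B * hnorm x &
    forall x i, dot (T x) (e i) = c i x].
Proof.
move=> B0 cl cB.
have /choice[T hT] : forall x, exists y, forall i, dot y (e i) = c i x.
  by move=> x; apply: riesz_fischer (cB ^~ x).
exists T; split=> //.
  by move=> a x y; apply: coef_ext => i; rewrite dotDl dotZl !hT cl.
move=> x; apply: coef_norm_le; first by rewrite mulr_ge0 ?hnorm_ge0.
move=> n; apply: le_trans (cB n x); rewrite (eq_bigr (fun i : 'I_n => cmod (c i x) ^+ 2))//.
by move=> i _; rewrite hT.
Qed.

Lemma coef_bound x i : cmod (dot x (e i)) <= hnorm x.
Proof. by rewrite (le_trans (cauchy_schwarz hdot _ _))// hnorm_basis mulr1. Qed.

Lemma bounded_ext (S T : H -> H) : bounded_op S -> bounded_op T ->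
  (forall n, S (e n) = T (e n)) -> S = T.
Proof.
move=> /bounded_opP[lS [M M0 hM]] /bounded_opP[lT [N N0 hN]] ST.
apply/funext => x; apply/eqP; rewrite -subr_eq0; apply/eqP/hnorm_small => eps eps0.
have MN : 0 < M + N + 1 by lra.
have [n hn_] := proj_cvg x (divr_gt0 eps0 MN).
have {hn_} := hn_ n (leqnn n); rewrite hnormC => h.
have -> : S x - T x = S (x - proj dot e n x) - T (x - proj dot e n x).
  rewrite (linB lS) (linB lT) opprD opprK addrACA (addrC _ (T (proj _ _ _ _))).
  suff -> : S (proj dot e n x) = T (proj dot e n x) by rewrite subrr addr0.
  rewrite (lin_sum lS) (lin_sum lT); apply: eq_bigr => i _.
  by rewrite (linZ lS) (linZ lT) ST.
apply: (le_trans (hnormB _ _)); move: h; rewrite ltr_pdivlMr// => h.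
have := hM (x - proj dot e n x); have := hN (x - proj dot e n x).
have := hnorm_ge0 (x - proj dot e n x); nra.
Qed.

(** Specified by its coefficients, and chosen by [xget], so that no bound on f occurs
    in the definition; when f is bounded, [diag_coef] applies. *)
Definition diag (f : nat -> R[i]) : H -> H :=
  fun x => xget 0 [set y | forall i, dot y (e i) = f i * dot x (e i)].

Section Diag.
Context (f : nat -> R[i]) (B : R) (fB : forall i, cmod (f i) <= B).

Let B0 : 0 <= B. Proof. exact: le_trans (cmod_ge0 _) (fB 0%N). Qed.

Let diag_map : exists T : H -> H, [/\ linear T, forall x, hnorm (T x) <= B * hnorm x &
    forall x i, dot (T x) (e i) = f i * dot x (e i)].
Proof.
apply: coef_map => // [i a x y|n x].
  by rewrite dotDl dotZl mulrDr mulrCA.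
rewrite exprMn; apply: le_trans (ler_wpM2l (sqr_ge0 B) (bessel hdot x (basis_orthn n))).
rewrite mulr_sumr; apply: ler_sum => i _.
rewrite cmodM exprMn ler_wpM2r ?sqr_ge0//.
by rewrite ler_pXn2r// ?nnegrE ?cmod_ge0.
Qed.

Lemma diag_coef x i : dot (diag f x) (e i) = f i * dot x (e i).
Proof.
have [T [_ _ hT]] := diag_map; move: i.
rewrite /diag; case: xgetP => [y -> //|/(_ (T x)) h]; exfalso; exact/h/hT.
Qed.

Lemma diag_lin : linear (diag f).
Proof.
move=> a x y; apply: coef_ext => i.
by rewrite dotDl dotZl !diag_coef dotDl dotZl mulrDr mulrCA.
Qed.

Lemma diag_norm x : hnorm (diag f x) <= B * hnorm x.
Proof.
have [T [_ hB hT]] := diag_map.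
by rewrite (_ : diag f x = T x)//; apply: coef_ext => i; rewrite hT diag_coef.
Qed.

Lemma diag_bounded : bounded_op (diag f).
Proof. by apply/bounded_opP; split; [exact: diag_lin|exists B => // x; exact: diag_norm]. Qed.

Lemma diag_e n : diag f (e n) = f n *: e n.
Proof.
apply: coef_ext => i; rewrite diag_coef dotZl oe.
by case: eqVneq => [->|]; rewrite ?mulr0.
Qed.

End Diag.

Lemma adjoint_ex (T : H -> H) (M : R) : linear T -> 0 <= M ->
  (forall x, hnorm (T x) <= M * hnorm x) ->
  exists S : H -> H, [/\ linear S, forall x, hnorm (S x) <= M * hnorm x &
    forall x y, dot (T x) y = dot x (S y)].
Proof.
move=> lT M0 hM.
have [i a x y|n y|S [lS hS Sc]] := coef_map (c := fun i y => dot y (T (e i))) M0.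
- by rewrite dotDl dotZl.
- set Q := \sum_(i < n) _; pose w := \sum_(i < n) dot y (T (e i)) *: e i.
  have Q0 : 0 <= Q by apply: sumr_ge0 => i _; exact: sqr_ge0.
  have wQ : hnorm w ^+ 2 = Q by rewrite (hnorm_comb hdot (fun i => dot y (T (e i))) (basis_orthn n)).
  have yw : dot y (T w) = Q%:C%C.
    rewrite /w (lin_sum lT) dot_sumr rmorph_sum /=; apply: eq_bigr => i _.
    by rewrite (linZ lT) dotZr mulrC mulCJ.
  have := cauchy_schwarz hdot y (T w); rewrite yw cmodR ger0_norm// => h1.
  have h2 := ler_wpM2l (hnorm_ge0 y) (hM w).
  rewrite -wQ in h1 Q0 *; rewrite ler_pXn2r ?nnegrE ?mulr_ge0 ?hnorm_ge0//.
  have [w0|w0] := eqVneq (hnorm w) 0; first by rewrite w0 mulr_ge0 ?hnorm_ge0.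
  have wp : 0 < hnorm w by rewrite lt_neqAle hnorm_ge0 andbT eq_sym.
  by rewrite -(ler_pM2r wp) -expr2 (le_trans h1)// (le_trans h2)// mulrA (mulrC M).
exists S; split=> // x y; apply/eqP; rewrite -subr_eq0; apply/eqP/cmod_eq0/eqP.
rewrite eq_le cmod_ge0 andbT; apply: le_eps => eps eps0; rewrite add0r.
pose C := M * hnorm y + hnorm (S y) + 1.
have C0 : 0 < C by rewrite /C; have := mulr_ge0 M0 (hnorm_ge0 y); have := hnorm_ge0 (S y); lra.
have [n hn_] := proj_cvg x (divr_gt0 eps0 C0).
have {hn_} := hn_ n (leqnn n); rewrite hnormC ltr_pdivlMr// => h.
have -> : dot (T x) y - dot x (S y) =
    dot (T (x - proj dot e n x)) y - dot (x - proj dot e n x) (S y).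
  rewrite (linB lT) !dotBl opprD opprK addrACA (addrC _ (dot _ (S y))).
  suff -> : dot (T (proj dot e n x)) y = dot (proj dot e n x) (S y) by rewrite subrr addr0.
  rewrite (lin_sum lT) !dot_suml; apply: eq_bigr => i _.
  by rewrite (linZ lT) !dotZl (dotC _ (T _)) (dotC _ _ (S y)) Sc.
apply: (le_trans (cmodD _ _)); rewrite cmodN.
apply: (le_trans (lerD (cauchy_schwarz hdot _ _) (cauchy_schwarz hdot _ _))).
have := ler_wpM2r (hnorm_ge0 y) (hM (x - proj dot e n x)).
have := hnorm_ge0 (x - proj dot e n x).
move: h; rewrite /C; nra.
Qed.

Lemma adjointP (T : H -> H) : bounded_op T -> forall x y, dot (T x) y = dot x (adjoint dot T y).
Proof.
move=> /bounded_opP[lT [M M0 hM]] x y; have [S [_ _ hS]] := adjoint_ex lT M0 hM.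
move: x; rewrite /adjoint; case: xgetP => [z -> //|/(_ (S y)) h]; exfalso; exact: h.
Qed.

Lemma adjoint_unique (T S : H -> H) : bounded_op T ->
  (forall x y, dot (T x) y = dot x (S y)) -> adjoint dot T = S.
Proof.
move=> bT TS; apply/funext => y; apply: (dot_ext hdot) => z.
by rewrite dotC -adjointP// TS -dotC.
Qed.

Lemma adjoint_bounded (T : H -> H) : bounded_op T -> bounded_op (adjoint dot T).
Proof.
move=> bT; have /bounded_opP[lT [M M0 hM]] := bT.
have [S [lS nS hS]] := adjoint_ex lT M0 hM.
by rewrite (adjoint_unique bT hS); apply/bounded_opP; split=> //; exists M.
Qed.

End Basis.
Arguments basis_orthn {R H dot e} oe n.

(** * The inverse of a self-adjoint operator with compact resolvent *)

Section SelfAdjoint.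
Context {R : realType} {H : completeNormedModType R[i]}.
Context (dot : {dot H for conjC}) (hdot : hilbert_dot dot).
Context (D : unbounded_op H).
Context (sa : self_adjoint dot D) (cr : compact_resolvent D) (tk : trivial_kernel D).
Implicit Types (x y z : H).

Lemma sa_sym x y : op_dom D x -> op_dom D y -> dot (D x) y = dot x (D y).
Proof. by move=> dx dy; apply: ((sa.2 y (D y)).2 _). Qed.

Lemma sa_max y z : (forall x, op_dom D x -> dot (D x) y = dot x z) -> op_dom D y /\ D y = z.
Proof. exact: (sa.2 y z).1. Qed.

Lemma op_domZ c x : op_dom D x -> op_dom D (c *: x) /\ D (c *: x) = c *: D x.
Proof.
move=> dx; have d0 := op_dom0 D; have D0 : D 0 = 0.
  by have := op_funP (-1) d0 d0; rewrite scaler0 addr0 scaleN1r addNr.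
have := op_domP c dx d0; have := op_funP c dx d0.
by rewrite !addr0 D0 addr0.
Qed.

Lemma op_domB x y : op_dom D x -> op_dom D y -> op_dom D (x - y) /\ D (x - y) = D x - D y.
Proof.
move=> dx dy; have := op_domP (-1) dy dx; have := op_funP (-1) dy dx.
by rewrite !scaleN1r ![- _ + _]addrC.
Qed.

Lemma sa_closed x y :
  (forall eps : R, 0 < eps -> exists u, [/\ op_dom D u, hnorm (u - x) < eps & hnorm (D u - y) < eps]) ->
  op_dom D x /\ D x = y.
Proof.
move=> h; apply: sa_max => z dz; apply/eqP; rewrite -subr_eq0; apply/eqP/cmod_eq0/eqP.
rewrite eq_le cmod_ge0 andbT; apply: le_eps => eps eps0; rewrite add0r.
pose C := hnorm (D z) + hnorm z + 1.
have C0 : 0 < C by rewrite /C; have := hnorm_ge0 (D z); have := hnorm_ge0 z; lra.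
have [u [du ux uy]] := h _ (divr_gt0 eps0 C0).
have -> : dot (D z) x - dot z y = dot z (D u - y) - dot (D z) (u - x).
  by rewrite !dotBr (sa_sym dz du) opprB [RHS]addrC subrKA.
apply: (le_trans (cmodD _ _)); rewrite cmodN.
apply: (le_trans (lerD (cauchy_schwarz hdot _ _) (cauchy_schwarz hdot _ _))).
move: ux uy; rewrite !ltr_pdivlMr// /C.
have := hnorm_ge0 (D u - y); have := hnorm_ge0 (u - x); have := hnorm_ge0 (D z); have := hnorm_ge0 z.
nra.
Qed.

(** Otherwise there are unit vectors x_n with D x_n -> 0. They are the images of a
    bounded sequence under the resolvent, hence cluster at a unit vector, which lies
    in the kernel of D since D is closed. *)
Lemma sa_bounded_below : exists2 c : R, 0 < c & forall x, op_dom D x -> c * hnorm x <= hnorm (D x).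
Proof.
apply: contrapT => /forall2NP hc.
have ex n : exists x, [/\ op_dom D x, hnorm x = 1 & hnorm (D x) < n.+1%:R^-1].
  have np : 0 < n.+1%:R^-1 :> R by rewrite invr_gt0 ltr0n.
  have [//|/existsNP[x /not_implyP[dx /negP]]] := hc n.+1%:R^-1.
  rewrite -ltNge => lx.
  have x0 : x != 0 by apply: contraTneq lx => ->; rewrite hnorm0 mulr0 -leNgt hnorm_ge0.
  have xp := hnorm_gt0 x0.
  have [dcx Dcx] := op_domZ ((hnorm x)^-1)%:C%C dx.
  exists (((hnorm x)^-1)%:C%C *: x); split=> //.
    by rewrite hnormZ cmodR ger0_norm ?invr_ge0 ?hnorm_ge0// mulVf ?gt_eqF.
  rewrite Dcx hnormZ cmodR ger0_norm ?invr_ge0 ?hnorm_ge0//.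
  by rewrite mulrC ltr_pdivrMr.
have /choice[x hx] := ex.
have [l [[_ inj _] cK]] := cr.
set K := inverse_op _ _ in cK.
have Kx z : op_dom D z -> K (D z - l *: z) = z.
  move=> dz; rewrite /K /inverse_op; case: xgetP => [y _ [dy yz]|/(_ z) h]; last by exfalso; exact/h.
  by apply: inj => //; rewrite inE.
have [n|y hy] := compact_cluster (x := fun n => D (x n) - l *: x n) (B := 1 + cmod l) cK.
  have [_ x1 xn] := hx n; apply: (le_trans (hnormB _ _)); rewrite hnormZ x1 mulr1 lerD2r ltW//.
  by apply: lt_le_trans xn _; rewrite invf_le1 ?ltr0n// ler1n.
have [dy Dy] : op_dom D y /\ D y = 0.
  apply: sa_closed => eps eps0; have [N hN] := archi_inv eps0.
  have [n Nn] := hy eps N eps0; have [dx x1 xn] := hx n; rewrite Kx// => xy.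
  by exists (x n); split=> //; rewrite subr0 (lt_trans xn)// hN.
have y0 := tk dy Dy.
have [n _] := hy 2^-1 0%N ltac:(by rewrite invr_gt0 ltr0n).
have [dx x1 _] := hx n; rewrite Kx// y0 subr0 x1; lra.
Qed.

(** The lower bound makes the range closed. A vector orthogonal to the range is in the
    domain of the adjoint of D, which is D, and in the kernel. *)
Lemma sa_surjective y : exists2 x, op_dom D x & D x = y.
Proof.
have [c c0 hc] := sa_bounded_below.
pose M := [set D x | x in op_dom D].
have [||u v uM uv|v [x dx Dx] hv] := closed_subspace_proj (M := M) hdot y.
- exists 0; first exact: op_dom0.
  by have [_] := op_domZ 0 (op_dom0 D); rewrite !scale0r.
- move=> a _ _ [u du <-] [v dv <-]; exists (a *: u + v); first exact: op_domP.
  exact: op_funP.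
- have /choice[x hx] : forall n, exists x, op_dom D x /\ D x = u n.
    by move=> n; have [x dx Dx] := uM n; exists x.
  have [eps eps0|z hz] := hnorm_cauchy (u := x).
    have ce : 0 < c * eps / 2 by rewrite divr_gt0// mulr_gt0.
    have [N hN] := uv _ ce; exists N => m n Nm Nn.
    have [dm Dm] := hx m; have [dn Dn] := hx n.
    have [dmn Dmn] := op_domB dm dn.
    rewrite -(ltr_pM2l c0) (le_lt_trans (hc _ dmn))// Dmn Dm Dn.
    have -> : u m - u n = (u m - v) - (u n - v) by rewrite opprB addrA subrK.
    have := hnormB (u m - v) (u n - v); have := hN m Nm; have := hN n Nn; lra.
  have [dz Dz] : op_dom D z /\ D z = v; last by exists z.
  apply: sa_closed => eps eps0.
  have [N1 h1] := uv _ eps0; have [N2 h2] := hz _ eps0.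
  exists (x (maxn N1 N2)); have [dx Dx] := hx (maxn N1 N2).
  by rewrite Dx h1 ?leq_maxl// h2 ?leq_maxr.
have [dw Dw] : op_dom D (y - v) /\ D (y - v) = 0.
  apply: sa_max => z dz; rewrite dot0r dotC hv ?rmorph0//; by exists z.
have /eqP := tk dw Dw; rewrite subr_eq0 => /eqP yv.
by exists x => //; rewrite Dx yv.
Qed.

Lemma op_invP y : op_dom D (op_inv D y) /\ D (op_inv D y) = y.
Proof.
rewrite /op_inv /inverse_op; case: xgetP => [x _ //|h].
by have [x dx Dx] := sa_surjective y; case: (h x).
Qed.

Lemma op_inv_unique x y : op_dom D x -> D x = y -> op_inv D y = x.
Proof.
move=> dx Dx; have [dy Dy] := op_invP y; have [dd Dd] := op_domB dy dx.
by apply/eqP; rewrite -subr_eq0; apply/eqP/tk => //; rewrite Dd Dy Dx subrr.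
Qed.

Lemma op_inv_lin : linear (op_inv D).
Proof.
move=> a x y; have [dx Dx] := op_invP x; have [dy Dy] := op_invP y.
by apply: op_inv_unique; [exact: op_domP|rewrite op_funP// Dx Dy].
Qed.

Lemma op_inv_norm : exists2 c : R, 0 <= c & forall x, hnorm (op_inv D x) <= c * hnorm x.
Proof.
have [c c0 hc] := sa_bounded_below; exists c^-1 => [|x]; first by rewrite invr_ge0 ltW.
have [dx Dx] := op_invP x.
by rewrite mulrC ler_pdivlMr// mulrC (le_trans (hc _ dx))// Dx.
Qed.

Lemma op_inv_sym x y : dot (op_inv D x) y = dot x (op_inv D y).
Proof.
have [dx Dx] := op_invP x; have [dy Dy] := op_invP y.
by rewrite -{1}Dy -{2}Dx sa_sym.
Qed.

Lemma op_inv_inj x : op_inv D x = 0 -> x = 0.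
Proof.
move=> x0; have [dx Dx] := op_invP x; rewrite -Dx x0.
by have [_] := op_domZ 0 (op_dom0 D); rewrite !scale0r.
Qed.

(** Compactness passes from the resolvent K at l to the inverse T of D, because
    T = K (1 - l T). *)
Lemma op_inv_cluster (x : nat -> H) (B : R) : (forall n, hnorm (x n) <= B) ->
  exists y, forall (e : R) N, 0 < e -> exists2 n, (N <= n)%N & hnorm (op_inv D (x n) - y) < e.
Proof.
move=> xB; have [c c0 hc] := op_inv_norm.
have [l [[_ inj _] cK]] := cr.
set K := inverse_op _ _ in cK.
have KT z : op_inv D z = K (z - l *: op_inv D z).
  have [dz Dz] := op_invP z.
  rewrite /K /inverse_op; case: xgetP => [y _ [dy yz]|/(_ (op_inv D z)) h].
    by apply: inj; rewrite ?inE// yz Dz.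
  by exfalso; apply: h; rewrite /= Dz.
have [n|y hy] := compact_cluster (x := fun n => x n - l *: op_inv D (x n)) (B := B + cmod l * (c * B)) cK.
  apply: (le_trans (hnormB _ _)); rewrite hnormZ lerD//.
  by rewrite ler_wpM2l ?cmod_ge0// (le_trans (hc _))// ler_wpM2l.
by exists y => eps N eps0; have [n Nn h] := hy eps N eps0; exists n => //; rewrite KT.
Qed.

End SelfAdjoint.

(** * The spectral theorem *)

Section Spectral.
Context {R : realType} {H : completeNormedModType R[i]}.
Context (dot : {dot H for conjC}) (hdot : hilbert_dot dot).
Context (T : H -> H) (lT : linear T) (c : R) (c0 : 0 <= c) (Tc : forall x, hnorm (T x) <= c * hnorm x).
Context (Tsym : forall x y, dot (T x) y = dot x (T y)) (Tinj : forall x, T x = 0 -> x = 0).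
Context (Tcl : forall (x : nat -> H) (B : R), (forall n, hnorm (x n) <= B) ->
  exists y, forall (e : R) N, 0 < e -> exists2 n, (N <= n)%N & hnorm (T (x n) - y) < e).

(** Let m be the norm of T on the space M of the vectors orthogonal to the f i, which
    T preserves. A maximizing sequence x_k of unit vectors satisfies
    T (T x_k) - m^2 x_k -> 0; if T x_k clusters at y, then w = T y is a nonzero vector
    of M with T (T w) = m^2 w. Either T w = - m w, or T w + m w is an eigenvector
    for m. *)
Lemma max_eigenvector (f : nat -> H) (l : nat -> R) n :
  (forall i, (i < n)%N -> T (f i) = (l i)%:C%C *: f i) ->
  (exists2 x, x != 0 & forall i, (i < n)%N -> dot x (f i) = 0) ->
  exists u : H, exists m : R, [/\ hnorm u = 1, forall i, (i < n)%N -> dot u (f i) = 0, T u = m%:C%C *: u &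
    forall x, (forall i, (i < n)%N -> dot x (f i) = 0) -> hnorm (T x) <= `|m| * hnorm x].
Proof.
move=> Tf [x0 x0n0 Mx0].
pose M x := forall i, (i < n)%N -> dot x (f i) = 0.
have MT x : M x -> M (T x).
  by move=> Mx i im; rewrite Tsym Tf// dotZr Mx// mulr0.
have Ml a x y : M x -> M y -> M (a *: x + y).
  by move=> Mx My i im; rewrite dotDl dotZl Mx// My// mulr0 addr0.
have M0 : M 0 by move=> i _; rewrite dot0l.
have MZ a x : M x -> M (a *: x) by move=> Mx; rewrite -[_ *: _]addr0; exact: Ml.
have unit x : x != 0 -> M x -> M (((hnorm x)^-1)%:C%C *: x) /\ hnorm (((hnorm x)^-1)%:C%C *: x) = 1.
  move=> xn0 Mx; split; first exact: MZ.
  by rewrite hnormZ cmodR ger0_norm ?invr_ge0 ?hnorm_ge0// mulVf// gt_eqF// hnorm_gt0.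
pose S := [set hnorm (T x) | x in [set x | M x /\ hnorm x = 1]].
have hS : has_sup S.
  split.
    have [Mu u1] := unit _ x0n0 Mx0.
    by exists (hnorm (T (((hnorm x0)^-1)%:C%C *: x0))), (((hnorm x0)^-1)%:C%C *: x0).
  by exists c => _ [x [_ x1] <-]; rewrite -[c]mulr1 -x1.
pose m := sup S.
have mB x : M x -> hnorm (T x) <= m * hnorm x.
  move=> Mx; have [->|xn0] := eqVneq x 0; first by rewrite (lin0 lT) hnorm0 mulr0.
  have [Mu u1] := unit _ xn0 Mx.
  have : hnorm (T (((hnorm x)^-1)%:C%C *: x)) <= m.
    by apply: ub_le_sup; [case: hS|exists (((hnorm x)^-1)%:C%C *: x)].
  rewrite (linZ lT) hnormZ cmodR ger0_norm ?invr_ge0 ?hnorm_ge0//.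
  by rewrite mulrC ler_pdivrMr// hnorm_gt0.
have m0 : 0 < m.
  rewrite -(pmulr_lgt0 _ (hnorm_gt0 x0n0)) (lt_le_trans _ (mB _ Mx0))//.
  by rewrite hnorm_gt0//; apply: contra_neq x0n0 => /Tinj.
have ex k : exists x, [/\ M x, hnorm x = 1 & hnorm (T (T x) - (m ^+ 2)%:C%C *: x) ^+ 2 <= m ^+ 2 * (2 * m * k.+1%:R^-1)].
  have kp : 0 < k.+1%:R^-1 :> R by rewrite invr_gt0 ltr0n.
  have [_ [x [Mx x1] <-] hx] := sup_adherent kp hS.
  exists x; split=> //; rewrite (hnormB_sqr hdot) hnormZ x1 mulr1 dotZr conjRC ReRM cmodR.
  rewrite Tsym (dotxx hdot) /= real_normK ?num_real//.
  have := mB _ (MT _ Mx); have := mB _ Mx; rewrite x1 mulr1.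
  rewrite -/m in hx; move: hx (hnorm_ge0 (T x)) (hnorm_ge0 (T (T x))).
  move: (hnorm (T x)) (hnorm (T (T x))) (k.+1%:R^-1) kp => a b d kp h a0 b0 am bm.
  have b2 : b ^+ 2 <= (m * a) ^+ 2 by rewrite ler_pXn2r ?nnegrE// mulr_ge0// ltW.
  have : m ^+ 2 - a ^+ 2 <= 2 * m * d by nra.
  have m20 : 0 <= m ^+ 2 by rewrite sqr_ge0.
  move=> h2; have := ler_wpM2l m20 h2; nra.
clearbody m; clear S hS; have /choice[x hx] := ex.
have [k|y hy] := Tcl (x := x) (B := 1); first by have [_ -> _] := hx k.
pose w := T y.
have appr (eps : R) : 0 < eps -> exists z, [/\ M z, hnorm z = m ^+ 2, hnorm (w - z) < eps & hnorm (T (T z) - (m ^+ 2)%:C%C *: z) <= m ^+ 2 * eps].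
  move=> eps0; have c0' := c0; have c10 : 0 < c + 1 by lra.
  have e1 : 0 < eps / 2 / (c + 1) by rewrite !divr_gt0.
  pose A := m ^+ 2 * (2 * m).
  have A0 : 0 < A by rewrite mulr_gt0 ?exprn_gt0// mulr_gt0.
  have e2 : 0 < (eps / 2) ^+ 2 / A by rewrite divr_gt0// exprn_gt0// divr_gt0.
  have [N hN] := archi_inv e2.
  have [k Nk hk] := hy _ N e1; have [Mx x1 hxk] := hx k.
  have s1 : hnorm (T (T (x k)) - (m ^+ 2)%:C%C *: x k) < eps / 2.
    rewrite -(ltr_pXn2r (n:=2)) ?nnegrE ?hnorm_ge0 ?divr_ge0 ?(ltW eps0)//.
    apply: (le_lt_trans hxk); rewrite mulrA -/A mulrC -ltr_pdivlMr//; exact: hN.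
  exists ((m ^+ 2)%:C%C *: x k); split; first exact: MZ.
  - by rewrite hnormZ x1 mulr1 cmodR ger0_norm// sqr_ge0.
  - have -> : w - (m ^+ 2)%:C%C *: x k = (T (T (x k)) - (m ^+ 2)%:C%C *: x k) - T (T (x k) - y).
      by rewrite (linB lT) opprB [RHS]addrC subrKA.
    apply: (le_lt_trans (hnormB _ _)); have := Tc (T (x k) - y).
    move: hk; rewrite ltr_pdivlMr// => hk; have := hnorm_ge0 (T (x k) - y); nra.
  - rewrite !(linZ lT) -scalerBr hnormZ cmodR ger0_norm ?sqr_ge0//.
    rewrite ler_wpM2l ?sqr_ge0//; lra.
have Mw : M w.
  move=> i im; apply/cmod_eq0/eqP; rewrite eq_le cmod_ge0 andbT; apply: le_eps => eps eps0.
  have fp : 0 < hnorm (f i) + 1 by have := hnorm_ge0 (f i); lra.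
  have [z [Mz _ hz _]] := appr _ (divr_gt0 eps0 fp).
  have -> : dot w (f i) = dot (w - z) (f i) by rewrite dotBl Mz// subr0.
  rewrite add0r (le_trans (cauchy_schwarz hdot _ _))//; move: hz; rewrite ltr_pdivlMr//.
  have := hnorm_ge0 (w - z); have := hnorm_ge0 (f i); nra.
have w0 : w != 0.
  have m2 : 0 < m ^+ 2 by rewrite exprn_gt0.
  have [z [_ z1 hz _]] := appr _ m2.
  by apply: contraTneq hz => ->; rewrite sub0r hnormN z1 ltxx.
have TTw : T (T w) = (m ^+ 2)%:C%C *: w.
  apply/eqP; rewrite -subr_eq0; apply/eqP/hnorm_small => eps eps0.
  pose C := c * c + 2 * m ^+ 2 + 1.
  have C0 : 0 < C by rewrite /C; have := mulr_ge0 c0 c0; have := sqr_ge0 m; lra.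
  have [z [_ _ hz hz2]] := appr _ (divr_gt0 eps0 C0).
  have -> : T (T w) - (m ^+ 2)%:C%C *: w =
      T (T (w - z)) + (T (T z) - (m ^+ 2)%:C%C *: z) - (m ^+ 2)%:C%C *: (w - z).
    by rewrite !(linB lT) scalerBr subrKA opprB subrKA.
  have h1 : hnorm (T (T (w - z))) <= c * (c * hnorm (w - z)).
    by rewrite (le_trans (Tc _))// ler_wpM2l.
  apply: (le_trans (hnormB _ _)); apply: (le_trans (lerD (hnormD _ _) (lexx _))).
  rewrite hnormZ cmodR ger0_norm ?sqr_ge0//.
  have q0 := hnorm_ge0 (w - z); have cc := mulr_ge0 c0 c0; have mm := sqr_ge0 m.
  have e0 : 0 <= eps / C by rewrite divr_ge0// ltW.
  have -> : eps = C * (eps / C) by rewrite mulrC divfK// gt_eqF.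
  move: hz hz2 h1; move: (eps / C) (hnorm (w - z)) e0 q0 => d q e0 q0 hz hz2 h1.
  rewrite /C; nra.
have mI : m%:C%C *: (m%:C%C *: w) = (m ^+ 2)%:C%C *: w by rewrite scalerA -rmorphM.
have [v0|vn0] := eqVneq (T w + m%:C%C *: w) 0.
  have [Mu u1] := unit _ w0 Mw.
  exists (((hnorm w)^-1)%:C%C *: w), (- m); split=> //.
    rewrite (linZ lT) [RHS]scalerA [_ * _]mulrC -scalerA; congr (_ *: _).
    by apply/eqP; rewrite rmorphN scaleNr -addr_eq0 v0.
  by move=> x' Mx'; rewrite normrN ger0_norm ?(ltW m0)// mB.
have Mv : M (T w + m%:C%C *: w) by rewrite addrC; apply: Ml => //; exact: MT.
have [Mu u1] := unit _ vn0 Mv.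
exists (((hnorm (T w + m%:C%C *: w))^-1)%:C%C *: (T w + m%:C%C *: w)), m; split=> //.
  rewrite (linZ lT) [RHS]scalerA [_ * _]mulrC -scalerA; congr (_ *: _).
  by rewrite (linD lT) (linZ lT) TTw scalerDr mI addrC.
by move=> x' Mx'; rewrite ger0_norm ?(ltW m0)// mB.
Qed.

Context (infdim : forall (f : nat -> H) n, orthn dot f n ->
  exists2 x, x != 0 & forall i, (i < n)%N -> dot x (f i) = 0).

(** The sequence is built by maximizing on successive orthogonal complements. The
    eigenvalues tend to 0, since otherwise the orthogonal vectors T (e n) could not
    cluster; a vector x orthogonal to all the e n satisfies |T x| <= |lam n| |x| for
    every n, so that T x = 0. *)
Lemma spectral_theorem : exists (e : nat -> H) (lam : nat -> R),
  [/\ forall i j, dot (e i) (e j) = (i == j)%:R,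
      forall x, (forall i, dot x (e i) = 0) -> x = 0,
      forall n, T (e n) = (lam n)%:C%C *: e n,
      forall m n, (m <= n)%N -> `|lam n| <= `|lam m| &
      (forall n, lam n != 0) /\ forall eps : R, 0 < eps -> exists N, forall n, (N <= n)%N -> `|lam n| < eps].
Proof.
pose F (s : seq (H * R)) i := (nth (0, 0) s i).1.
pose L (s : seq (H * R)) i := (nth (0, 0) s i).2.
pose good s := orthn dot (F s) (size s) /\
  forall i, (i < size s)%N -> T (F s i) = (L s i)%:C%C *: F s i.
have /choice[step hstep] : forall s, exists p : H * R, good s ->
    [/\ hnorm p.1 = 1, forall i, (i < size s)%N -> dot p.1 (F s i) = 0, T p.1 = p.2%:C%C *: p.1 &
     forall x, (forall i, (i < size s)%N -> dot x (F s i) = 0) -> hnorm (T x) <= `|p.2| * hnorm x].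
  move=> s; have [[os Ts]|ngs] := pselect (good s); last by exists (0, 0).
  have [u [m um]] := max_eigenvector Ts (infdim os).
  by exists (u, m).
pose st := fix st n := if n is k.+1 then rcons (st k) (step (st k)) else [::].
pose e n := (step (st n)).1; pose lam n := (step (st n)).2.
have sz n : size (st n) = n by elim: n => //= n IH; rewrite size_rcons IH.
have nthst n i : (i < n)%N -> nth (0, 0) (st n) i = step (st i).
  elim: n => // n IH; rewrite ltnS leq_eqVlt => /predU1P[->|im] /=.
    by rewrite nth_rcons sz ltnn eqxx.
  by rewrite nth_rcons sz im IH.
have Fst n i : (i < n)%N -> F (st n) i = e i by move=> im; rewrite /F nthst.
have Lst n i : (i < n)%N -> L (st n) i = lam i by move=> im; rewrite /L nthst.
have goodn n : good (st n).
  elim: n => [|n IH]; first by split.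
  have [u1 uo Tu _] := hstep _ IH; have [ort1 T1] := IH.
  rewrite sz in uo ort1 T1.
  have ee : dot (e n) (e n) = 1 by rewrite (dotxx hdot) u1 expr1n.
  have en i : (i < n)%N -> dot (e n) (e i) = 0 by move=> im; have := uo i im; rewrite Fst.
  split; rewrite sz.
    move=> i j; rewrite !ltnS => im jm; rewrite !Fst ?ltnS//.
    have cs k : (k <= n)%N -> (k < n)%N \/ k = n.
      by rewrite leq_eqVlt => /predU1P[->|]; [right|left].
    case: (cs i im) (cs j jm) => [im'|->] [jm'|->].
    - by have := ort1 i j im' jm'; rewrite !Fst.
    - by rewrite dotC en// rmorph0 ltn_eqF.
    - by rewrite en// gtn_eqF.
    - by rewrite ee eqxx.
  move=> i; rewrite ltnS leq_eqVlt => /predU1P[->|im].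
    by rewrite Fst// Lst.
  by rewrite Fst 1?ltnW// Lst 1?ltnW//; have := T1 i im; rewrite Fst// Lst.
have oe i j : dot (e i) (e j) = (i == j)%:R.
  pose n := (maxn i j).+1.
  have im : (i < n)%N by rewrite ltnS leq_maxl.
  have jm : (j < n)%N by rewrite ltnS leq_maxr.
  by have [on _] := goodn n; have := on i j; rewrite sz !Fst//; apply.
have Te n : T (e n) = (lam n)%:C%C *: e n by have [_ _ ->] := hstep _ (goodn n).
have e1 n : hnorm (e n) = 1 by have [-> _ _] := hstep _ (goodn n).
have Tle n x : (forall i, (i < n)%N -> dot x (e i) = 0) -> hnorm (T x) <= `|lam n| * hnorm x.
  move=> xo; have [_ _ _] := hstep _ (goodn n); apply; rewrite sz => i im.
  by rewrite Fst// xo.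
have hTe n : hnorm (T (e n)) = `|lam n| by rewrite Te hnormZ cmodR e1 mulr1.
have mono m n : (m <= n)%N -> `|lam n| <= `|lam m|.
  move=> mn; rewrite -hTe -[leRHS]mulr1 -(e1 n); apply: Tle => i im.
  by rewrite oe gtn_eqF// (leq_trans im).
have to0 (eps : R) : 0 < eps -> exists N, forall n, (N <= n)%N -> `|lam n| < eps.
  move=> eps0; apply: contrapT => /forallNP hN.
  have big n : eps <= `|lam n|.
    have /existsNP[m /not_implyP[nm /negP]] := hN n; rewrite -leNgt => h.
    exact: le_trans h (mono _ _ nm).
  have [n|y hy] := Tcl (x := e) (B := 1); first by rewrite e1.
  have e20 : 0 < eps / 2 by rewrite divr_gt0.
  have [m _ hm] := hy _ 0%N e20; have [n mn hn_] := hy _ m.+1 e20.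
  have : hnorm (T (e m) - T (e n)) < eps.
    have -> : T (e m) - T (e n) = (T (e m) - y) - (T (e n) - y) by rewrite opprB addrA subrK.
    have := hnormB (T (e m) - y) (T (e n) - y); lra.
  rewrite -(ltr_pXn2r (n:=2)) ?nnegrE ?hnorm_ge0 ?(ltW eps0)//.
  rewrite (hnormB_sqr hdot) !hTe !Te dotZl dotZr oe ltn_eqF// !mulr0 subr0.
  have := big m; have := big n; nra.
exists e, lam; split=> //; last first.
  split=> // n; have e0 : e n != 0 by apply: contra_eq_neq (e1 n) => ->; rewrite hnorm0 eq_sym oner_neq0.
  by apply: contra_neq e0 => l0; apply: Tinj; rewrite Te l0 scale0r.
move=> x xo; apply/Tinj/hnorm_small => eps eps0.
have xp : 0 < hnorm x + 1 by have := hnorm_ge0 x; lra.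
have [N hN] := to0 _ (divr_gt0 eps0 xp).
have := Tle N x (fun i _ => xo i); have := hN N (leqnn _); rewrite ltr_pdivlMr//.
have := hnorm_ge0 x; have := normr_ge0 (lam N); nra.
Qed.

End Spectral.

(** * Windows carrying most of the mass of a sequence of exponent one *)

Section Windows.
Context {R : realType}.
Implicit Types (v s : nat -> R) (r C : R).

Lemma expr_unbounded r C : 1 < r -> exists J, forall j, (J <= j)%N -> C < r ^+ j.
Proof.
move=> r1; exists (Num.trunc (C / (r - 1))).+1 => j Jj.
have bern : 1 + j%:R * (r - 1) <= r ^+ j.
  elim: j {Jj} => [|j IH]; first by rewrite mul0r addr0 expr0.
  rewrite exprS -natr1; have j0 : 0 <= j%:R :> R by rewrite ler0n.
  have : r * (1 + j%:R * (r - 1)) <= r * r ^+ j by rewrite ler_wpM2l//; lra.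
  have : 0 <= j%:R * (r - 1) * (r - 1) by rewrite !mulr_ge0//; lra.
  nra.
have r10 : 0 < r - 1 by lra.
have : C / (r - 1) < j%:R by apply: (lt_le_trans (truncnS_gt _)); rewrite ler_nat.
rewrite ltr_pdivrMr//; lra.
Qed.

(** The values are taken at the right ends of the steps, as in the comparison of a
    decreasing sequence with its dyadic values ([dyadic_sum]). *)
Definition tail_sum v a b := \sum_(a <= k < b) v k.+1.

(** If there were no window, v a + v b would exceed eps times the sum between a and b
    for all K <= a < b. Either some of these sums exceeds 2 / eps * v a, and then v
    grows geometrically from there on, against the upper bound; or none does, and then
    v decays geometrically, against the lower bound. *)
Lemma dyadic_windows v : (forall k, 0 < v k) ->
  (forall r, 1 < r -> exists K, forall k, (K <= k)%N -> v k <= r ^+ k) ->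
  (forall r, 1 < r -> forall K, exists2 k, (K <= k)%N & r ^- k.+1 / 2 <= v k) ->
  forall (eps : R) K, 0 < eps ->
    exists a b, [/\ (K <= a < b)%N & v a + v b <= eps * tail_sum v a b].
Proof.
move=> v0 up lo eps0 K eps00.
pose eps := minr eps0 1.
have eps_gt0 : 0 < eps by rewrite lt_min eps00 ltr01.
have eps_le1 : eps <= 1 by rewrite ge_min lexx orbT.
have eps_le : eps <= eps0 by rewrite ge_min lexx.
have G0 a b : 0 <= tail_sum v a b by apply: sumr_ge0 => i _; exact: ltW.
suff [a [b [ab vab]]] : exists a b, (K <= a < b)%N /\ v a + v b <= eps * tail_sum v a b.
  exists a, b; split=> //; apply: le_trans vab _; exact: ler_wpM2r.
clearbody eps; clear eps_le eps00 eps0.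
have e20 : 0 <= eps / 2 by rewrite divr_ge0// ltW.
apply: contrapT => hnorm.
have h a b : (K <= a < b)%N -> eps * tail_sum v a b < v a + v b.
  by move=> ab; rewrite ltNge; apply/negP => vab; apply: hnorm; exists a, b.
(* q^2 <= r, so that growth at rate r beats growth at rate q with a factor q^j to
   spare. *)
pose r := 1 + eps / 2; pose q := 1 + eps / 8.
have q1 : 1 < q by rewrite /q; lra.
have r0 : 0 < r by rewrite /r; lra.
have q0 : 0 < q by lra.
have qr : q ^+ 2 <= r by rewrite /q /r; nra.
have qrj j : q ^+ j * q ^+ j <= r ^+ j.
  by rewrite -exprMn lerXn2r ?nnegrE ?mulr_ge0 ?(ltW q0) ?(ltW r0).
have GS a b : (a <= b)%N -> tail_sum v a b.+1 = tail_sum v a b + v b.+1.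
  by move=> ab; rewrite /tail_sum big_nat_recr.
have Gmono a b c : (a <= b <= c)%N -> tail_sum v a b <= tail_sum v a c.
  move=> /andP[ab bc]; rewrite /tail_sum (@big_cat_nat _ _ _ b a c)//= lerDl.
  by apply: sumr_ge0 => i _; exact: ltW.
(* A large sum between a and b would make the sums from a grow at rate r. *)
have claim a b : (K <= a)%N -> (a <= b)%N -> tail_sum v a b <= 2 / eps * v a.
  move=> Ka ab; rewrite leNgt; apply/negP => big.
  set G := tail_sum v a b in big.
  have G_gt0 : 0 < G by apply: lt_trans big; rewrite mulr_gt0// divr_gt0.
  have vaG c : (b <= c)%N -> v a <= eps / 2 * tail_sum v a c.
    move=> bc; have := Gmono a b c; rewrite ab bc => /(_ isT); rewrite -/G => h1.
    have : v a <= eps / 2 * G.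
      have -> : v a = eps / 2 * (2 / eps * v a) by field; rewrite gt_eqF.
      exact: (ler_wpM2l e20 (ltW big)).
    by move=> /le_trans; apply; exact: ler_wpM2l.
  have vG c : (b <= c)%N -> eps / 2 * tail_sum v a c <= v c.+1.
    move=> bc; have ac := leq_trans ab bc.
    have := vaG c.+1 (leqW bc); have := h a c.+1; rewrite Ka ltnS ac => /(_ isT).
    have := G0 a c; have := v0 c.+1; rewrite (GS a c ac); nra.
  have Gj j : r ^+ j * G <= tail_sum v a (b + j).
    elim: j => [|j IH]; first by rewrite expr0 mul1r addn0.
    rewrite addnS GS ?exprS -?mulrA; last exact: leq_trans ab (leq_addr _ _).
    have := vG (b + j)%N (leq_addr _ _); have : r * (r ^+ j * G) <= r * tail_sum v a (b + j).
      by rewrite ler_wpM2l// ltW.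
    rewrite /r; lra.
  have [J hJ] := up q q1.
  have [J' hJ'] := expr_unbounded (q ^+ b.+1 / (eps / 2 * G)) q1.
  pose j := maxn J J'.
  have c0 : 0 < eps / 2 * G by rewrite mulr_gt0// divr_gt0.
  have h1 : eps / 2 * (r ^+ j * G) <= v (b + j).+1.
    by apply: le_trans (vG (b + j)%N (leq_addr _ _)); exact: ler_wpM2l.
  have h2 : v (b + j).+1 <= q ^+ b.+1 * q ^+ j.
    by rewrite -exprD addSn hJ// -addSn (leq_trans (leq_maxl J J')) ?leq_addl.
  have := hJ' j (leq_maxr _ _); rewrite ltr_pdivrMr// => h3.
  have qj : 0 < q ^+ j by rewrite exprn_gt0.
  have h4 := ler_wpM2r (ltW c0) (qrj j).
  have h5 : q ^+ b.+1 * q ^+ j < q ^+ j * (eps / 2 * G) * q ^+ j by rewrite ltr_pM2r.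
  have : q ^+ j * (eps / 2 * G) * q ^+ j = q ^+ j * q ^+ j * (eps / 2 * G) by ring.
  have : eps / 2 * (r ^+ j * G) = r ^+ j * (eps / 2 * G) by ring.
  lra.
(* Read backwards from K + j, the sums grow at rate r. *)
have Gdec j : r ^+ j * v (K + j).+1 <= tail_sum v K (K + j).+1.
  have gen k : forall i, (i + k)%N = j ->
      r ^+ k * tail_sum v (K + j) (K + j).+1 <= tail_sum v (K + i) (K + j).+1.
    elim: k => [|k IH] i ki; first by rewrite expr0 mul1r -ki addn0.
    have ij' : (i < j)%N by rewrite -ki -addSnnS leq_addr.
    have IH' : r ^+ k * tail_sum v (K + j) (K + j).+1 <= tail_sum v (K + i.+1) (K + j).+1.
      by apply: IH; rewrite addSnnS.
    have := claim (K + i.+1)%N (K + j).+1; rewrite leq_addr leqW ?leq_add2l// => /(_ isT isT) cl.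
    rewrite {2}/tail_sum big_ltn ?ltnS ?leq_add2l 1?ltnW// -/(tail_sum _ _ _) -!(addnS K i).
    have : r * (r ^+ k * tail_sum v (K + j) (K + j).+1) <= r * tail_sum v (K + i.+1) (K + j).+1.
      by rewrite ler_wpM2l// ltW.
    have : eps / 2 * tail_sum v (K + i.+1) (K + j).+1 <= v (K + i.+1)%N.
      have -> : v (K + i.+1)%N = eps / 2 * (2 / eps * v (K + i.+1)%N) by field; rewrite gt_eqF.
      exact: ler_wpM2l.
    rewrite exprS -mulrA /r; lra.
  have := gen j 0%N (add0n j); rewrite addn0.
  by rewrite {1}/tail_sum big_nat1.
pose C := 2 / eps * v K.
have C0 : 0 < C by rewrite mulr_gt0// divr_gt0.
have [J hJ] := expr_unbounded (C * 2 * q ^+ K.+2) q1.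
have [k Kk hk] := lo q q1 (K + J).+1.
pose j := (k - K.+1)%N.
have kj : k = (K + j).+1 by rewrite /j -addSn subnKC// (leq_trans _ Kk)// ltnS leq_addr.
have Jj : (J <= j)%N by rewrite /j leq_subRL ?addSn// (leq_trans _ Kk)// ltnS leq_addr.
have h1 : r ^+ j * v k <= C.
  by rewrite kj; apply: (le_trans (Gdec j)); apply: claim => //; rewrite leqW// leq_addr.
have h2 := hJ j Jj.
have qj : 0 < q ^+ j by rewrite exprn_gt0.
have qK : 0 < q ^+ K.+2 by rewrite exprn_gt0.
have ek : q ^+ k.+1 = q ^+ K.+2 * q ^+ j by rewrite -exprD kj.
have h3 : 1 <= v k * 2 * (q ^+ K.+2 * q ^+ j).
  rewrite -ek -ler_pdivrMr ?exprn_gt0// mul1r -ler_pdivrMr//.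
have h4 : v k * (q ^+ j * q ^+ j) <= C by apply: le_trans h1; rewrite mulrC ler_wpM2r ?qrj// ltW.
have : q ^+ j <= v k * (q ^+ j * q ^+ j) * 2 * q ^+ K.+2 by nra.
have : v k * (q ^+ j * q ^+ j) * 2 * q ^+ K.+2 <= C * 2 * q ^+ K.+2.
  by rewrite ler_wpM2r ?(ltW qK)// ler_wpM2r.
lra.
Qed.

Lemma dyadic_sum s a b : (forall m n, (m <= n)%N -> s n <= s m) -> (a <= b)%N ->
  tail_sum (fun k => 2 ^+ k * s (2 ^ k)%N) a b <= 2 * \sum_((2 ^ a)%N <= j < (2 ^ b)%N) s j.
Proof.
move=> smono; elim: b => [|b IH]; first by rewrite leqn0 => /eqP->; rewrite /tail_sum !big_geq// mulr0.
rewrite leq_eqVlt => /predU1P[->|]; first by rewrite /tail_sum !big_geq// mulr0.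
rewrite ltnS => ab; rewrite /tail_sum big_nat_recr//= -/(tail_sum (fun k => 2 ^+ k * s (2 ^ k)%N) _ _).
rewrite (@big_cat_nat _ _ _ (2 ^ b)%N)/=; last 2 first.
- by rewrite leq_pexp2l.
- by rewrite leq_pexp2l.
rewrite mulrDr lerD ?IH// exprS -mulrA ler_wpM2l//.
have -> : 2 ^+ b * s (2 ^ b.+1)%N = \sum_((2 ^ b)%N <= j < (2 ^ b.+1)%N) s (2 ^ b.+1)%N.
  rewrite sumr_const_nat expnS mul2n -addnn addnK -[RHS]mulr_natl natrX//.
by apply: ler_sum_nat => i /andP[_ ib]; apply: smono; exact: ltnW.
Qed.

Lemma windows s : (forall m n, (m <= n)%N -> s n <= s m) -> (forall n, 0 < s n) ->
  (forall r, 1 < r -> exists K, forall k, (K <= k)%N -> 2 ^+ k * s (2 ^ k)%N <= r ^+ k) ->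
  (forall r, 1 < r -> forall K, exists2 k, (K <= k)%N & r ^- k.+1 / 2 <= 2 ^+ k * s (2 ^ k)%N) ->
  forall (eps : R) K, 0 < eps -> exists n N, [/\ (K <= n < N)%N &
    n%:R * s n + N%:R * s N <= eps * \sum_(n <= j < N) s j].
Proof.
move=> smono s0 up lo eps K eps0.
have [||a [b [/andP[Ka ab] hab]]] := @dyadic_windows (fun k => 2 ^+ k * s (2 ^ k)%N) _ up lo (eps / 2) K.
- by move=> k; rewrite mulr_gt0// exprn_gt0.
- by rewrite divr_gt0.
exists (2 ^ a)%N, (2 ^ b)%N; split.
  by rewrite ltn_exp2l// ab andbT (leq_trans Ka)// ltnW// ltn_expl.
rewrite !natrX (le_trans hab)//.
have := dyadic_sum smono (ltnW ab).
have e20 : 0 <= eps / 2 by rewrite divr_ge0// ltW.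
by move=> /(ler_wpM2l e20); rewrite mulrA divfK.
Qed.

(** For s = mu ^ d the bounds on mu say that 2^k s(2^k) neither grows geometrically
    nor eventually decays geometrically. *)
Lemma exponent_growth (mu : nat -> R) (d : R) : 0 < d ->
  (forall n, 0 < mu n) -> (forall m n, (m <= n)%N -> mu n <= mu m) ->
  (forall eta : R, 0 < eta -> exists K, forall n, (K <= n)%N ->
     ln (mu n) <= (eta - d^-1) * ln n.+1%:R) ->
  (forall eta : R, 0 < eta -> forall K, exists2 n, (K <= n)%N &
     (- eta - d^-1) * ln n.+1%:R <= ln (mu n)) ->
  forall (eps : R) K, 0 < eps -> exists n N, [/\ (K <= n < N)%N &
    n%:R * mu n `^ d + N%:R * mu N `^ d <= eps * \sum_(n <= j < N) mu j `^ d].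
Proof.
move=> d0 mu0 mumono up lo; pose s n := mu n `^ d.
have dn0 : d != 0 by rewrite gt_eqF.
have s0 n : 0 < s n by rewrite powR_gt0.
have ls n : ln (s n) = d * ln (mu n) by rewrite ln_powR.
have smono m n : (m <= n)%N -> s n <= s m.
  by move=> mn; rewrite ge0_ler_powR ?nnegrE ?(ltW d0) ?(ltW (mu0 _))// mumono.
have ln2 : 0 < ln 2 :> R by rewrite ln_gt0// ltr1n.
have lnp k : ln (2 ^ k)%:R = k%:R * ln 2 :> R.
  by rewrite natrX lnXn// mulr_natl.
have etaE r : 1 < r -> exists eta, [/\ 0 < eta & d * eta * ln 2 = ln r].
  move=> r1; have lr : 0 < ln r by rewrite ln_gt0.
  exists (ln r / (d * ln 2)); split; first by rewrite divr_gt0// mulr_gt0.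
  by field; rewrite dn0 gt_eqF.
have p0 k : 0 < 2 ^+ k * s (2 ^ k)%N by rewrite mulr_gt0// exprn_gt0.
have lnv k : ln (2 ^+ k * s (2 ^ k)%N) = k%:R * ln 2 + d * ln (mu (2 ^ k)%N).
  by rewrite lnM ?posrE ?exprn_gt0// ls -natrX lnp.
apply: (windows smono s0) => r r1.
  have [eta [eta0 er]] := etaE r r1; have [K hK] := up eta eta0.
  exists K => k Kk; have r0 : 0 < r by lra.
  rewrite -ler_ln ?posrE ?exprn_gt0// lnv lnXn// -mulr_natl -er.
  have k1 : (0 < 2 ^ k)%N by rewrite expn_gt0.
  have : ln (mu (2 ^ k)%N) <= (eta - d^-1) * (k%:R * ln 2).
    rewrite -lnp; apply: le_trans (_ : ln (mu (2 ^ k).-1) <= _).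
      by rewrite ler_ln ?posrE// mumono// leq_pred.
    rewrite -[in leRHS](prednK k1); apply: hK.
    by rewrite -ltnS prednK// (leq_trans _ (ltn_expl k (leqnn 2)))// ltnS.
  move=> /(ler_wpM2l (ltW d0)).
  have -> : d * ((eta - d^-1) * (k%:R * ln 2)) = k%:R * (d * eta * ln 2) - k%:R * ln 2 by field.
  lra.
move=> K; have [eta [eta0 er]] := etaE r r1.
have [n Kn hnorm] := lo eta eta0 (2 ^ K)%N.
have n0 : (0 < n)%N by apply: leq_trans Kn; rewrite expn_gt0.
(* n lies in [2^k, 2^(k+1)); this is why the exponent k+1 occurs in the lower bound. *)
pose k := trunc_log 2 n.
have /andP[kn nk] := trunc_log_bounds (leqnn 2) n0.
exists k; first by rewrite /k; apply: trunc_log_max.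
have r0 : 0 < r by lra.
rewrite -ler_ln ?posrE//; last by rewrite divr_gt0// invr_gt0 exprn_gt0.
rewrite lnv ln_div ?posrE ?invr_gt0 ?exprn_gt0// lnV ?posrE ?exprn_gt0// lnXn// -(mulr_natl (ln r)) -er.
have m1 : ln (mu n) <= ln (mu (2 ^ k)%N) by rewrite ler_ln ?posrE// mumono.
have m2 : ln n.+1%:R <= k.+1%:R * ln 2 :> R.
  by rewrite -lnp ler_ln ?posrE ?ltr0n ?expn_gt0// ler_nat.
have di0 : 0 < d^-1 by rewrite invr_gt0.
have m3 : (- eta - d^-1) * (k.+1%:R * ln 2) <= ln (mu (2 ^ k)%N).
  apply: le_trans m1; apply: le_trans hnorm; rewrite -subr_ge0 -mulrBr -opprD mulNr oppr_ge0.
  by rewrite pmulr_rle0 ?subr_le0//; lra.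
have := ler_wpM2l (ltW d0) m3.
have -> : d * ((- eta - d^-1) * (k.+1%:R * ln 2)) = - (k.+1%:R * (d * eta * ln 2)) - k.+1%:R * ln 2 by field.
rewrite -natr1; lra.
Qed.

Lemma limn_einf_bounds (u : nat -> \bar R) (l : R) : limn_einf u = l%:E ->
  forall eta : R, 0 < eta ->
    (exists K, forall n, (K <= n)%N -> ((l - eta)%:E <= u n)%E) /\
    (forall K, exists2 n, (K <= n)%N & (u n < (l + eta)%:E)%E).
Proof.
rewrite limn_einf_lim => ul eta eta0.
have supl : ereal_sup (range (einfs u)) = l%:E.
  by rewrite -ul; apply/esym/cvg_lim => //; exact: cvg_einfs_sup.
split.
  have : ((l - eta)%:E < ereal_sup (range (einfs u)))%E.
    by rewrite supl lte_fin ltrBlDr ltrDl.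
  move=> /ereal_sup_gt[_ [K _ <-] h]; exists K => n Kn.
  by apply: le_trans (ltW h) _; apply: ereal_inf_lbound; exists n.
move=> K; have : (einfs u K < (l + eta)%:E)%E.
  apply: (@le_lt_trans _ _ l%:E); last by rewrite lte_fin ltrDl.
  by rewrite -supl; apply: ereal_sup_ubound; exists K.
by move=> /ereal_inf_lt[_ [n Kn <-] h]; exists n.
Qed.

Lemma lne_ratio (a : R) n : 0 < a ->
  (lne a%:E / lne (n.+2%:R^-1)%:E)%E = (- ln a / ln n.+2%:R)%:E.
Proof.
move=> a0; have l0 : 0 < ln n.+2%:R :> R by rewrite ln_gt0// ltr1n.
rewrite !lne_EFin ?invr_gt0 ?ltr0n// lnV ?posrE ?ltr0n// inver oppr_eq0 gt_eqF//.
by rewrite -EFinM invrN mulrN mulNr.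
Qed.

(** Singular values are numbered from 1, hence the comparison of mu n with n.+1. *)
Lemma liminf_exponent (mu : nat -> R) (sv : nat -> R) (d : R) : d != 0 ->
  (forall n, sv n.+1 = mu n) ->
  (forall n, 0 < mu n) -> (forall e, 0 < e -> exists N, forall n, (N <= n)%N -> mu n < e) ->
  ((limn_einf (fun n : nat => lne (sv n)%:E / lne (n%:R^-1)%:E))^-1)%E = d%:E ->
  [/\ 0 < d,
    (forall eta : R, 0 < eta -> exists K, forall n, (K <= n)%N ->
     ln (mu n) <= (eta - d^-1) * ln n.+1%:R) &
    (forall eta : R, 0 < eta -> forall K, exists2 n, (K <= n)%N &
     (- eta - d^-1) * ln n.+1%:R <= ln (mu n))].
Proof.
move=> dn0 svE mu0 mucv hd.
have hl : limn_einf (fun n : nat => lne (sv n)%:E / lne (n%:R^-1)%:E)%E = (d^-1)%:E.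
  by rewrite -[LHS]inveK hd inver (negPf dn0).
have hb := limn_einf_bounds hl.
have l0 n : 0 < ln n.+2%:R :> R by rewrite ln_gt0// ltr1n.
have uE n : (lne (sv n.+2)%:E / lne (n.+2%:R^-1)%:E)%E = (- ln (mu n.+1) / ln n.+2%:R)%:E.
  by rewrite svE lne_ratio.
split; last 2 first.
- move=> eta eta0; have [[K hK] _] := hb eta eta0; exists K.+1 => -[//|n] Kn.
  have := hK n.+2 (leqW (leqW Kn)); rewrite uE lee_fin ler_pdivlMr// => h; lra.
- move=> eta eta0 K; have [_ hK] := hb eta eta0; have [[|[|n]] // Kn] := hK K.+2.
  rewrite uE lte_fin ltr_pdivrMr// => h; exists n.+1; first exact: ltnW.
  lra.
have d0' : 0 <= d^-1.
  rewrite leNgt; apply/negP => dneg.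
  have e0 : 0 < - d^-1 by rewrite oppr_gt0.
  have [N hN] := mucv 1 ltr01.
  have [_ hK] := hb _ e0; have [[|[|n]] // Kn] := hK N.+2.
  rewrite uE lte_fin subrr ltr_pdivrMr// mul0r oppr_lt0 ltNge ln_le0//.
  by rewrite ltW// hN// ltnW.
by rewrite -invr_gt0 lt_neqAle eq_sym invr_eq0 dn0.
Qed.

(** A zero singular value has logarithm -oo, so that its ratio to log (1/n) is +oo. *)
Lemma liminf_no_eventual0 (sv : nat -> R) (d : R) N :
  (forall n, (N < n)%N -> sv n = 0) ->
  ((limn_einf (fun n : nat => lne (sv n)%:E / lne (n%:R^-1)%:E))^-1)%E = d%:E -> d = 0.
Proof.
move=> sv0 hd; apply/eqP; rewrite -[_ == _]negbK; apply/negP => dn0.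
have hl : limn_einf (fun n : nat => lne (sv n)%:E / lne (n%:R^-1)%:E)%E = (d^-1)%:E.
  by rewrite -[LHS]inveK hd inver (negPf dn0).
have [_ /(_ N.+2)[[|[|n]] // Nn]] := limn_einf_bounds hl ltr01.
have l0 : 0 < ln n.+2%:R :> R by rewrite ln_gt0// ltr1n.
rewrite sv0 ?(leq_trans _ Nn)// {1}/lne lexx lne_EFin ?invr_gt0 ?ltr0n//.
rewrite lnV ?posrE ?ltr0n// inver oppr_eq0 gt_eqF// invrN EFinN.
by rewrite lt0_mulNye// lte_fin oppr_lt0 invr_gt0.
Qed.

End Windows.

(** * Singular values and compactness of diagonal operators *)

Section UltraLimits.
Context {R : realType} {T : Type} (F : set_system T) (FU : UltraFilter F).

Lemma ultra_bounded_limitR (g : T -> R) (B : R) : F [set y | `|g y| <= B] ->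
  exists c : R, forall dl : R, 0 < dl -> F [set y | `|g y - c| < dl].
Proof.
move=> FB; pose S := [set t : R | F [set y | t <= g y]].
have hS : has_sup S.
  split.
    by exists (- B); apply: filterS FB => y /=; rewrite ler_norml => /andP[].
  exists B => t tS; have [y [/= yB yt]] := filter_ex (filterI FB tS).
  by rewrite (le_trans yt)// (le_trans (ler_norm _)).
exists (sup S) => dl dl0.
have [t tS ht] := sup_adherent dl0 hS.
have up : F (~` [set y | sup S + dl <= g y]).
  have [h|//] := in_ultra_setVsetC [set y | sup S + dl <= g y] FU.
  by have := ub_le_sup hS.2 h; rewrite leNgt ltrDl dl0.
apply: filterS (filterI tS up) => y [/= ty /negP]; rewrite -ltNge => yu.
by rewrite ltr_norml; lra.
Qed.

Lemma ultra_bounded_limit (g : T -> R[i]) (B : R) : F [set y | cmod (g y) <= B] ->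
  exists c : R[i], forall dl : R, 0 < dl -> F [set y | cmod (g y - c) < dl].
Proof.
move=> FB.
have [|a ha] := @ultra_bounded_limitR (fun y => complex.Re (g y)) B.
  by apply: filterS FB => y; exact: le_trans (ler_Re _).
have [|b hb] := @ultra_bounded_limitR (fun y => complex.Im (g y)) B.
  by apply: filterS FB => y; exact: le_trans (ler_Im _).
exists (a +i* b)%C => dl dl0; have d20 : 0 < dl / 2 by rewrite divr_gt0.
apply: filterS (filterI (ha _ d20) (hb _ d20)) => y [/= h1 h2].
by apply: le_lt_trans (ler_cmod _) _; rewrite cReD cImD cReN cImN /=; lra.
Qed.

End UltraLimits.

Section SingularValues.
Context {R : realType} {H : completeNormedModType R[i]}.
Context (dot : {dot H for conjC}) (hdot : hilbert_dot dot).

Lemma orth_fam_count (m n : nat) (e : nat -> H) (g : 'I_n -> H) : orthn dot e m ->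
  (forall i j, dot (g i) (g j) = (i == j)%:R) ->
  (forall i, proj dot e m (g i) = g i) -> (n <= m)%N.
Proof.
case: n g => // n g oe og gp.
pose g' (i : nat) := g (inord i).
apply: (@orthn_count _ _ dot hdot e g') => //.
- by move=> i j im jm; rewrite og -val_eqE /= !inordK.
- by move=> i im; rewrite gp.
Qed.

Lemma singular_value_finite_dim (T : H -> H) (f : nat -> H) n N : orthn dot f n ->
  (forall x, (forall i, (i < n)%N -> dot x (f i) = 0) -> x = 0) ->
  (n < N)%N -> singular_value dot T N = 0.
Proof.
move=> of_ tf nN; rewrite /singular_value (_ : [set s | _] = [set 0]) ?sup1//.
apply/seteqP; split=> [s [->//|[_ [g [r [og _]]]]]|s ->]; last by left.
exfalso; suff : (N <= n)%N by rewrite leqNgt nN.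
apply: (orth_fam_count of_ og) => i; apply/esym/eqP; rewrite -subr_eq0; apply/eqP/tf => j jn.
exact: (dot_residual _ of_).
Qed.

(** Orthonormal eigenvectors of T^2 with eigenvalues above |lam n|^2 lie in the span
    of the first n basis vectors, so that there are at most n of them. *)
Lemma singular_value_eigen (T : H -> H) (e : nat -> H) (lam : nat -> R) n :
  (forall i j, dot (e i) (e j) = (i == j)%:R) ->
  (forall x, (forall i, dot x (e i) = 0) -> x = 0) ->
  linear T -> (forall x y, dot (T x) y = dot x (T y)) -> adjoint dot T = T ->
  (forall n, T (e n) = (lam n)%:C%C *: e n) ->
  (forall m n, (m <= n)%N -> `|lam n| <= `|lam m|) ->
  singular_value dot T n.+1 = `|lam n|.
Proof.
move=> oe te lT Tsym aT Te lmono.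
rewrite /singular_value aT; set S := [set s | _].
have Sub s : S s -> s <= `|lam n|.
  move=> [->//|[s0 [g [r [og gr]]]]]; rewrite leNgt; apply/negP => ls.
  suff : (n.+1 <= n)%N by rewrite ltnn.
  apply: (orth_fam_count (basis_orthn oe n) og) => i.
  apply: (coef_ext te) => j; rewrite (coef_proj oe); have [jn|nj] := ltnP j n; first by rewrite mul1r.
  rewrite mul0r.
  have [sr Tg] := gr i.
  have : dot (T (T (g i))) (e j) = ((lam j) ^+ 2)%:C%C * dot (g i) (e j).
    by rewrite Tsym Te dotZr conjRC Tsym Te dotZr conjRC mulrA -rmorphM.
  rewrite Tg dotZl => /eqP; rewrite -subr_eq0 -mulrBl mulf_eq0 => /orP[|/eqP->//].
  rewrite -rmorphB => /eqP/(@complexI _ _ 0)/eqP; rewrite subr_eq0 => /eqP rl.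
  exfalso; have lr : `|lam j| < r i.
    by apply: le_lt_trans (lmono _ _ nj) _; exact: lt_le_trans sr.
  have : `|lam j| ^+ 2 < r i ^+ 2 by rewrite ltr_pXn2r ?nnegrE// (le_trans _ (ltW lr)).
  by rewrite real_normK ?num_real// rl ltxx.
have Sn : S `|lam n|.
  right; split=> //; exists (fun i => e i), (fun i => `|lam i|); split=> // i.
  split; first by apply: lmono; rewrite -ltnS.
  by rewrite Te (linZ lT) Te scalerA -rmorphM -expr2 real_normK ?num_real.
apply/eqP; rewrite eq_le; apply/andP; split.
  by apply: sup_le_ub => [|s /Sub//]; exists (`|lam n|).
by apply: ub_le_sup => //; exists `|lam n| => s /Sub.
Qed.

End SingularValues.

Section DiagCompact.
Context {R : realType} {H : completeNormedModType R[i]}.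
Context (dot : {dot H for conjC}) (hdot : hilbert_dot dot).
Context (e : nat -> H).
Hypothesis oe : forall i j, dot (e i) (e j) = (i == j)%:R.
Hypothesis te : forall x, (forall i, dot x (e i) = 0) -> x = 0.

Lemma cmod_decr_bound (s : nat -> R) : (forall n, 0 <= s n) ->
  (forall m n, (m <= n)%N -> s n <= s m) -> forall i, cmod (s i)%:C%C <= s 0%N.
Proof. by move=> s0 sm i; rewrite cmodR ger0_norm// sm. Qed.

(** It is the square of the symmetric operator with entries sqrt (s n). *)
Lemma diag_positive (s : nat -> R) : (forall n, 0 <= s n) ->
  (forall m n, (m <= n)%N -> s n <= s m) ->
  positive_op dot (diag dot e (fun n => (s n)%:C%C)).
Proof.
move=> s0 sm x; pose q n := Num.sqrt (s n).
have q0 n : 0 <= q n by exact: sqrtr_ge0.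
have qm m n : (m <= n)%N -> q n <= q m by move=> mn; rewrite ler_wsqrtr// sm.
pose Q := diag dot e (fun n => (q n)%:C%C).
have Qc := diag_coef hdot oe te (cmod_decr_bound q0 qm).
have bQ := diag_bounded hdot oe te (cmod_decr_bound q0 qm).
have -> : diag dot e (fun n => (s n)%:C%C) x = Q (Q x).
  apply: (coef_ext te) => i; rewrite !Qc (diag_coef hdot oe te (cmod_decr_bound s0 sm)).
  by rewrite mulrA -rmorphM -expr2 sqr_sqrtr.
have Qs : adjoint dot Q = Q.
  have bA := adjoint_bounded hdot oe te bQ.
  apply: (bounded_ext hdot oe te bA bQ) => n; apply: (coef_ext te) => i.
  rewrite [LHS]dotC -(adjointP hdot oe te bQ) !Qc !oe (eq_sym i).
  by case: (eqVneq n i) => [->|]; rewrite ?mulr0 ?rmorph0// mulr1 conjRC.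
by rewrite (adjointP hdot oe te bQ) Qs (dotxx hdot) ler0c sqr_ge0.
Qed.

(** The image of the unit ball is contained in the set of the y whose tails beyond N
    are bounded by s N for every N. An ultrafilter on this set converges in every
    coefficient, hence in norm because the tails are uniformly small. *)
Lemma diag_compact (s : nat -> R) : (forall n, 0 <= s n) ->
  (forall m n, (m <= n)%N -> s n <= s m) ->
  (forall eps : R, 0 < eps -> exists N, forall n, (N <= n)%N -> s n < eps) ->
  compact_op (diag dot e (fun n => (s n)%:C%C)).
Proof.
move=> s0 sm sc; set S := diag _ _ _.
have lS : linear S := diag_lin hdot oe te (cmod_decr_bound s0 sm).
split=> //.
pose K := [set y : H | hnorm y <= s 0%N /\ forall N, hnorm (y - proj dot e N y) <= s N].
have SK : S @` [set x | `|x| <= 1] `<=` K.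
  move=> _ [x /= x1 <-]; rewrite normHE -[1]/(1%:C%C) lecR in x1.
  split; first by apply: (le_trans (diag_norm hdot oe te (cmod_decr_bound s0 sm) x)); rewrite ler_piMr.
  move=> N; apply: (coef_norm_le hdot oe te) => // n.
  have sN2 : 0 <= s N ^+ 2 by rewrite sqr_ge0.
  apply: (@le_trans _ _ (s N ^+ 2 * hnorm x ^+ 2)); last first.
    by rewrite -exprMn lerXn2r ?nnegrE ?mulr_ge0 ?hnorm_ge0// ler_piMr.
  have bx := bessel hdot x (basis_orthn oe n).
  have := ler_wpM2l sN2 bx; apply: le_trans.
  rewrite mulr_sumr; apply: ler_sum => i _.
  have [iN|Ni] := ltnP i N.
    by rewrite (dot_residual _ (basis_orthn oe N))// cmod0 expr0n mulr_ge0 ?sqr_ge0.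
  have -> : dot (S x - proj dot e N (S x)) (e i) = (s i)%:C%C * dot x (e i).
    by rewrite dotBl (coef_proj oe) (diag_coef hdot oe te (cmod_decr_bound s0 sm)) ltnNge Ni mul0r subr0.
  rewrite cmodM exprMn ler_wpM2r ?sqr_ge0// cmodR ger0_norm// lerXn2r ?nnegrE//.
  exact: sm.
apply: (precompact_subset SK).
have projB N y : hnorm (proj dot e N y) <= hnorm y := hnorm_proj_le hdot y (basis_orthn oe N).
have Kcl p : (forall eps : R, 0 < eps -> exists2 y, K y & hnorm (p - y) < eps) -> K p.
  move=> hp; split=> [|N]; apply: le_eps => eps eps0.
    have [y [yK _] py] := hp _ eps0; have := hnormD (p - y) y; rewrite subrK; lra.
  have e20 : 0 < eps / 2 by rewrite divr_gt0.
  have [y [_ yK] py] := hp _ e20.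
  have -> : p - proj dot e N p = (p - y) + (y - proj dot e N y) - proj dot e N (p - y).
    by rewrite (linB (@proj_lin _ _ dot e N)) subrKA opprB subrKA.
  have := hnormB ((p - y) + (y - proj dot e N y)) (proj dot e N (p - y)).
  have := hnormD (p - y) (y - proj dot e N y).
  have := projB N (p - y); have := yK N; lra.
have cK : compact K.
  rewrite compact_ultra => F FU FK.
  have coord i : exists c : R[i], forall dl : R, 0 < dl -> F [set y | cmod (dot y (e i) - c) < dl].
    apply: (@ultra_bounded_limit _ _ F FU _ (s 0%N)); apply: filterS FK => y [ys _] /=.
    exact: le_trans (coef_bound hdot oe y i) ys.
  have /choice[c hc] := coord.
  have FF : ProperFilter F by exact: ultra_proper.
  have /cauchy_cvgP/cvg_ex[p Fp] : cauchy F.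
    apply/cauchy_exP => eps eps0.
    have er : eps = (complex.Re eps)%:C%C by rewrite RRe_real // gtr0_real.
    move: er eps0; move: (complex.Re eps) => t -> {eps}; rewrite ltcR => t0.
    have t20 : 0 < t / 2 by rewrite divr_gt0.
    have [N hN] := sc _ t20.
    exists (\sum_(i < N) c i *: e i).
    have dl0 : 0 < t / 2 / N.+1%:R by rewrite divr_gt0// ltr0n.
    have FN : F [set y | forall i : 'I_N, cmod (dot y (e i) - c i) < t / 2 / N.+1%:R].
      exact: (@filter_forall _ _ (fun (i : 'I_N) y => cmod (dot y (e i) - c i) < _) F _ (fun i => hc i _ dl0)).
    apply: filterS (filterI FK FN) => y [[_ yK] yN] /=.
    rewrite -ball_normE /= normHE ltcR hnormC.
    have -> : y - \sum_(i < N) c i *: e i = (y - proj dot e N y) +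
        \sum_(i < N) (dot y (e i) - c i) *: e i.
      rewrite -[in RHS]addrA; congr (_ + _); rewrite addrC.
      rewrite /proj -sumrB -sumrN; apply: eq_bigr => i _.
      by rewrite scalerBl addrAC subrr add0r.
    apply: (le_lt_trans (hnormD _ _)).
    have h1 : hnorm (y - proj dot e N y) < t / 2 by apply: le_lt_trans (yK N) (hN N (leqnn _)).
    have h2 : hnorm (\sum_(i < N) (dot y (e i) - c i) *: e i) <= t / 2.
      apply: (le_trans (hnorm_sum _ _ _)).
      apply: (@le_trans _ _ (\sum_(i < N) t / 2 / N.+1%:R)).
        by apply: ler_sum => i _; rewrite hnormZ (hnorm_basis hdot oe) mulr1 ltW.
      rewrite sumr_const card_ord -[_ *+ N]mulr_natr mulrAC ler_pdivrMr ?ltr0n//.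
      by apply: ler_wpM2l; [exact: ltW|rewrite ler_nat].
    lra.
  exists p; split=> //; apply: Kcl => eps eps0.
  have Fb : F (ball p eps%:C%C) by apply: Fp; apply: nbhsx_ballx; rewrite ltcR.
  have [y [yK yb]] := filter_ex (filterI FK Fb).
  by exists y => //; move: yb; rewrite -ball_normE /= normHE ltcR.
rewrite precompactE (_ : closure K = K)//.
by rewrite -(closure_id _).1//; apply: compact_closed => //; exact: norm_hausdorff.
Qed.

End DiagCompact.

(** * The eigenvalues of D *)

Section SpectralData.
Context {R : realType} {H : completeNormedModType R[i]}.
Context (dot : {dot H for conjC}) (hdot : hilbert_dot dot).

(** The inverse of D is symmetric, injective and compact, so that the spectral theorem
    applies once H has infinite dimension; in finite dimension the singular values
    would vanish eventually and the box dimension would be 0. *)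
Theorem spectral_data (D : unbounded_op H) (d : R) : self_adjoint dot D ->
  compact_resolvent D -> trivial_kernel D ->
  box_dimension dot D = d%:E -> d != 0 ->
  exists (e : nat -> H) (dl : nat -> R),
  [/\ (forall i j, dot (e i) (e j) = (i == j)%:R) /\
      (forall x, (forall i, dot x (e i) = 0) -> x = 0),
      (forall n, op_dom D (e n) /\ D (e n) = (dl n)%:C%C *: e n) /\
      (forall n, dl n != 0),
      (forall m n, (m <= n)%N -> `|dl m| <= `|dl n|) /\
      (forall C, exists N, forall n, (N <= n)%N -> C < `|dl n|),
      0 < d &
      forall (eps : R) K, 0 < eps -> exists n N, [/\ (K <= n < N)%N &
        n%:R * `|dl n| `^ (- d) + N%:R * `|dl N| `^ (- d) <= eps * \sum_(n <= j < N) `|dl j| `^ (- d)]].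
Proof.
move=> sa cr tk hd dn0.
pose T := op_inv D.
have lT : linear T := op_inv_lin hdot sa cr tk.
have [c c0 hc] := op_inv_norm hdot sa cr tk.
have Tsym := op_inv_sym hdot sa cr tk.
have bT : bounded_op T by apply/bounded_opP; split=> //; exists c.
have infdim (f : nat -> H) n : orthn dot f n ->
    exists2 x : H, x != 0 & forall i, (i < n)%N -> dot x (f i) = 0.
  move=> of_; apply: contrapT => /forall2NP hx.
  have tf x : (forall i, (i < n)%N -> dot x (f i) = 0) -> x = 0.
    by move=> xf; have [/negP|//] := hx x; rewrite negbK => /eqP.
  move/eqP: dn0; apply; apply: (liminf_no_eventual0 (N := n)) hd => N nN.
  exact: (singular_value_finite_dim hdot _ of_ tf nN).
have [e [lam [oe te Te lmono [lam0 lcv]]]] :=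
  spectral_theorem hdot lT c0 hc Tsym (op_inv_inj hdot sa cr tk) (op_inv_cluster hdot sa cr tk) infdim.
have aT : adjoint dot T = T := adjoint_unique hdot oe te bT Tsym.
have svE n := singular_value_eigen hdot n oe te lT Tsym aT Te lmono.
have mu0 n : 0 < `|lam n| by rewrite normr_gt0.
have [d0 up lo] := liminf_exponent dn0 svE mu0 lcv hd.
have win := exponent_growth d0 mu0 lmono up lo.
exists e, (fun n => (lam n)^-1); split=> //.
- split=> n; last by rewrite invr_neq0.
  have [dT DT] := op_invP hdot sa cr tk (e n).
  have E : e n = (lam n)^-1%:C%C *: T (e n).
    by rewrite Te scalerA -rmorphM mulVf// scale1r.
  have [dE DE] := op_domZ (lam n)^-1%:C%C dT.
  by rewrite E; split=> //; rewrite DE DT -E.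
- split=> [m n mn|C]; first by rewrite !normfV lef_pV2 ?posrE// lmono.
  pose C' := `|C| + 1; have C0 : 0 < C' by rewrite /C'; have := normr_ge0 C; lra.
  have [N hN] := lcv C'^-1 ltac:(by rewrite invr_gt0).
  exists N => n Nn; have := hN n Nn; rewrite normfV -ltf_pV2 ?posrE ?invr_gt0// invrK.
  by apply: lt_trans; rewrite /C'; have := ler_norm C; lra.
- have pE n : `|(lam n)^-1| `^ (- d) = `|lam n| `^ d.
    by rewrite normfV /powR invr_eq0 !gt_eqF// lnV ?posrE// mulrNN.
  move=> eps K eps0; have [n [N [nN h]]] := win eps K eps0.
  by exists n, N; split=> //; rewrite !pE; under eq_bigr do rewrite pE.
Qed.

End SpectralData.

(** * Construction of a singular trace *)

Section Representations.
Context {R : realType} {H : completeNormedModType R[i]}.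

(** A presentation of the operator sum_i A_i S B_i. Traces are first defined on
    presentations, by a formula, and only then shown to depend on the operator alone. *)
Record rep := Rep { rn : nat; rA : nat -> H -> H; rB : nat -> H -> H;
  rAb : forall i, bounded_op (rA i); rBb : forall i, bounded_op (rB i) }.

Definition rop (S : H -> H) (r : rep) : H -> H :=
  fun x => \sum_(i < rn r) rA r i (S (rB r i x)).

Definition switch (m : nat) (A B : nat -> H -> H) (i : nat) : H -> H :=
  if (i < m)%N then A i else B (i - m)%N.

Lemma switch_bounded m A B : (forall i, bounded_op (A i)) -> (forall i, bounded_op (B i)) ->
  forall i, bounded_op (switch m A B i).
Proof. by move=> hA hB i; rewrite /switch; case: ifP. Qed.

Definition rcat (r r' : rep) : rep :=
  Rep (rn r + rn r') (switch_bounded (rn r) (rAb r) (rAb r'))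
    (switch_bounded (rn r) (rBb r) (rBb r')).

Definition rscale (c : R[i]) (r : rep) : rep :=
  Rep (rn r) (fun i => bounded_scale c (rAb r i)) (rBb r).

Definition rmul (U V : H -> H) (bU : bounded_op U) (bV : bounded_op V) (r : rep) : rep :=
  Rep (rn r) (fun i => bounded_comp bU (rAb r i)) (fun i => bounded_comp (rBb r i) bV).

Definition runit : rep := Rep 1 (fun=> @bounded_id R H) (fun=> @bounded_id R H).
Definition rzero : rep := Rep 0 (fun=> @bounded_id R H) (fun=> @bounded_id R H).

Lemma rcat_sum (V : zmodType) (r r' : rep) (F : (H -> H) -> (H -> H) -> V) :
  \sum_(i < rn (rcat r r')) F (rA (rcat r r') i) (rB (rcat r r') i) =
  \sum_(i < rn r) F (rA r i) (rB r i) + \sum_(i < rn r') F (rA r' i) (rB r' i).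
Proof.
rewrite big_split_ord /=; congr (_ + _); apply: eq_bigr => i _.
  by rewrite /switch ltn_ord.
by rewrite /switch ltnNge leq_addr /= addKn.
Qed.

Lemma rop_cat S r r' : rop S (rcat r r') = rop S r + rop S r'.
Proof.
by apply/funext => x; rewrite fctE /rop (rcat_sum _ _ (fun A B => A (S (B x)))).
Qed.

Lemma rop_scale S c r : rop S (rscale c r) = c *: rop S r.
Proof. by apply/funext => x; rewrite fctE /rop scaler_sumr. Qed.

Lemma rop_mul S U V (bU : bounded_op U) (bV : bounded_op V) r :
  rop S (rmul bU bV r) = U \o rop S r \o V.
Proof. by apply/funext => x; rewrite /rop /= (lin_sum (bounded_lin bU)). Qed.

Lemma rop_unit S : rop S runit = S.
Proof. by apply/funext => x; rewrite /rop /= big_ord1. Qed.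

Lemma rop_bounded S r : bounded_op S -> bounded_op (rop S r).
Proof.
move=> bS; pose F i := rA r i \o S \o rB r i.
have bF i : bounded_op (F i) by exact: bounded_comp (bounded_comp (rAb r i) bS) (rBb r i).
suff : bounded_op (\sum_(i < rn r) F i).
  by congr (bounded_op _); apply/funext => x; rewrite fct_sumE.
by elim/big_ind: _ => //; [exact: bounded_0|move=> ? ?; exact: bounded_add].
Qed.

Lemma ideal_rep S X : bounded_op S -> ideal_generated S X -> exists r, rop S r = X.
Proof.
move=> bS /(_ [set X | exists r, rop S r = X]); apply.
split; last by move=> _ ->; exists runit; exact: rop_unit.
split.
- by move=> _ [r <-]; exact: rop_bounded.
- by exists rzero; apply/funext => x; rewrite /rop big_ord0.
- by move=> _ _ [r <-] [r' <-]; exists (rcat r r'); exact: rop_cat.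
- move=> U _ bU [r <-]; split.
    by exists (rmul bU (@bounded_id R H) r); rewrite rop_mul.
  by exists (rmul (@bounded_id R H) bU r); rewrite rop_mul.
Qed.

Lemma ideal_generated_ideal (S : H -> H) : bounded_op S ->
  two_sided_ideal (ideal_generated S).
Proof.
move=> bS; split.
- move=> X XJ; have [r <-] := ideal_rep bS XJ; exact: rop_bounded.
- by move=> J [[_ J0 _ _] _].
- move=> X Y hX hY J hJ; have [[_ _ JD _] _] := hJ.
  by apply: JD; [exact: hX|exact: hY].
- move=> U X bU hX; split=> J hJ; have [[_ _ _ JM] _] := hJ.
    by have [] := JM U X bU (hX _ hJ).
  by have [] := JM U X bU (hX _ hJ).
Qed.

Lemma ideal_generated_gen (S : H -> H) : ideal_generated S S.
Proof. by move=> J [_]; apply. Qed.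

Lemma rep_bound (r : rep) : exists2 C : R, 0 <= C &
  forall (K : H -> H) (b : R), 0 <= b -> (forall x, hnorm (K x) <= b * hnorm x) ->
   forall x, \sum_(i < rn r) hnorm (rA r i (K (rB r i x))) <= C * b * hnorm x.
Proof.
have /choice[a ha] : forall i, exists a : R, 0 <= a /\ forall x, hnorm (rA r i x) <= a * hnorm x.
  by move=> i; have /bounded_opP[_ [a a0 ha]] := rAb r i; exists a.
have /choice[b hb] : forall i, exists a : R, 0 <= a /\ forall x, hnorm (rB r i x) <= a * hnorm x.
  by move=> i; have /bounded_opP[_ [b b0 hb]] := rBb r i; exists b.
exists (\sum_(i < rn r) a i * b i) => [|K k k0 hK x].
  by apply: sumr_ge0 => i _; rewrite mulr_ge0//; [case: (ha i)|case: (hb i)].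
rewrite -mulrA mulr_suml; apply: ler_sum => i _.
have [a0 hai] := ha i; have [b0 hbi] := hb i.
apply: (le_trans (hai _)); rewrite -mulrA ler_wpM2l//.
apply: (le_trans (hK _)); rewrite mulrCA ler_wpM2l//.
Qed.

End Representations.

Section TraceConstruction.
Context {R : realType} {H : completeNormedModType R[i]}.
Context (dot : {dot H for conjC}) (hdot : hilbert_dot dot).
Context (e : nat -> H).
Hypothesis oe : forall i j, dot (e i) (e j) = (i == j)%:R.
Hypothesis te : forall x, (forall i, dot x (e i) = 0) -> x = 0.
Context (s : nat -> R) (s0 : forall n, 0 < s n) (sm : forall m n, (m <= n)%N -> s n <= s m).

Let S := diag dot e (fun n => (s n)%:C%C).

Let sge0 n : 0 <= s n. Proof. exact: ltW. Qed.

Let cut (P : pred nat) := diag dot e (fun j => if P j then (s j)%:C%C else 0).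

Let cut_bound (P : pred nat) a : (forall j, P j -> (a <= j)%N) ->
  forall j, cmod (if P j then (s j)%:C%C else 0) <= s a.
Proof.
move=> hP j; case: ifP => [/hP aj|_]; last by rewrite cmod0.
by rewrite cmodR ger0_norm// sm.
Qed.

Let cut_sum a b x :
  cut (fun j => a <= j < b)%N x = \sum_(a <= j < b) ((s j)%:C%C * dot x (e j)) *: e j.
Proof.
apply: (coef_ext te) => i.
rewrite (diag_coef hdot oe te (@cut_bound _ 0%N _))// dot_suml.
case: ifPn => [/andP[ai ib]|nab].
  rewrite (bigD1_seq i) ?mem_index_iota ?ai ?iota_uniq//= dotZl oe eqxx mulr1.
  by rewrite big1 ?addr0// => k ki; rewrite dotZl oe (negPf ki) mulr0.
rewrite mul0r big1_seq// => k /=; rewrite mem_index_iota => kab.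
rewrite dotZl oe; case: eqVneq => [ki|]; last by rewrite mulr0.
by rewrite -ki kab in nab.
Qed.

Let cut_split n N x : (n <= N)%N -> S x =
  cut (fun j => 0 <= j < n)%N x + cut (fun j => n <= j < N)%N x + cut (fun j => N <= j)%N x.
Proof.
move=> nN; apply: (coef_ext te) => i; rewrite !dotDl.
rewrite (diag_coef hdot oe te (cmod_decr_bound sge0 sm)).
rewrite !(diag_coef hdot oe te (@cut_bound _ 0%N _))// -!mulrDl; congr (_ * _).
have [iN|ni] := ltnP i n; first by rewrite /= (leqNgt N) (leq_trans iN nN) /= !addr0.
by have [iN|Ni] := ltnP i N; rewrite /= ?add0r ?addr0.
Qed.

(** With S' the part of S in the window, this is the trace of the sum of the
    A_i S' B_i, written cyclically as that of B_i A_i S': in this form it is visibly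
    invariant when A_i is replaced by V A_i and B_i by B_i V^-1. *)
Definition window_trace (r : rep) n N : R[i] :=
  \sum_(n <= j < N) (s j)%:C%C * \sum_(i < rn r) dot (rB r i (rA r i (e j))) (e j).

Lemma window_trace_cat r r' n N : window_trace (rcat r r') n N = window_trace r n N + window_trace r' n N.
Proof.
rewrite /window_trace -big_split /=; apply: eq_bigr => j _; rewrite -mulrDr; congr (_ * _).
by rewrite (rcat_sum _ _ (fun A B => dot (B (A (e j))) (e j))).
Qed.

Lemma window_trace_scale c r n N : window_trace (rscale c r) n N = c * window_trace r n N.
Proof.
rewrite /window_trace mulr_sumr; apply: eq_bigr => j _; rewrite mulrCA; congr (_ * _).
rewrite mulr_sumr; apply: eq_bigr => i _.
by rewrite /= (linZ (bounded_lin (rBb r i))) dotZl.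
Qed.

Lemma window_trace_unit n N : window_trace runit n N = (\sum_(n <= j < N) s j)%:C%C.
Proof.
rewrite rmorph_sum; apply: eq_bigr => j _.
by rewrite big_ord1 /= oe eqxx mulr1.
Qed.

Lemma window_trace_mul U V (bU : bounded_op U) (bV : bounded_op V) r n N :
  (forall x, V (U x) = x) -> window_trace (rmul bU bV r) n N = window_trace r n N.
Proof.
move=> VU; apply: eq_bigr => j _; congr (_ * _); apply: eq_bigr => i _.
by rewrite /= VU.
Qed.

Lemma window_trace_bound r : exists C : R, forall n N,
  cmod (window_trace r n N) <= C * \sum_(n <= j < N) s j.
Proof.
have /choice[b hb] : forall i, exists a : R, forall x, hnorm (rB r i (rA r i x)) <= a * hnorm x.
  move=> i; have /bounded_opP[_ [b b0 hb]] := bounded_comp (rBb r i) (rAb r i).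
  by exists b.
exists (\sum_(i < rn r) b i) => n N.
apply: (le_trans (cmod_sum _ _ _)); rewrite mulr_sumr; apply: ler_sum => j _.
rewrite cmodM cmodR ger0_norm// mulrC ler_wpM2r//.
apply: (le_trans (cmod_sum _ _ _)); apply: ler_sum => i _.
apply: (le_trans (coef_bound hdot oe _ _)); apply: (le_trans (hb i _)).
by rewrite (hnorm_basis hdot oe) mulr1.
Qed.

(** Let f be an orthonormal basis, of q members, of the span of the A_i e_j with j < N,
    the first p of which span those with j < n; for m terms A_i S B_i, p <= n m and
    q <= N m. The trace of the window part of X = sum_i A_i S B_i is computed in the
    basis f. Its first p diagonal entries are at least - C s n. At the other f l, the
    part of X that comes from indices below n has zero diagonal entry and the part
    from indices above N contributes at most C s N, while X itself has nonnegative
    real part. *)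
Lemma window_trace_pos r : (forall x, 0 <= complex.Re (dot (rop S r x) x)) ->
  exists2 C : R, 0 <= C & forall n N, (n <= N)%N ->
   - (C * (n%:R * s n + N%:R * s N)) <= complex.Re (window_trace r n N).
Proof.
move=> Xpos; have [C C0 hC] := rep_bound r.
exists ((rn r)%:R * C) => [|n N nN]; first by rewrite mulr_ge0.
pose vs m := [seq rA r i (e j) | j <- iota 0 m, i <- iota 0 (rn r)].
have vsP m i j : (j < m)%N -> (i < rn r)%N -> rA r i (e j) \in vs m.
  by move=> jm ir; apply/allpairsP; exists (j, i); split; rewrite ?mem_iota.
have vs_size m : size (vs m) = (m * rn r)%N by rewrite size_allpairs !size_iota.
have o0 : orthn dot (fun=> 0) 0 by [].
have [f1 [p [of1 /andP[_ pn] _ f1v]]] := gram_schmidt hdot (vs n) o0.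
have [f [q [of_ /andP[pq qN] ff1 fv]]] := gram_schmidt hdot (vs N) of1.
rewrite add0n vs_size in pn; rewrite vs_size in qN.
pose part P x := \sum_(i < rn r) rA r i (cut P (rB r i x)).
have partE a b x : part (fun j => a <= j < b)%N x =
    \sum_(i < rn r) \sum_(a <= j < b) ((s j)%:C%C * dot (rB r i x) (e j)) *: rA r i (e j).
  apply: eq_bigr => i _; rewrite cut_sum (lin_sum (bounded_lin (rAb r i))).
  by apply: eq_bigr => j _; rewrite (linZ (bounded_lin (rAb r i))).
have part_split x : rop S r x = part (fun j => 0 <= j < n)%N x +
    part (fun j => n <= j < N)%N x + part (fun j => N <= j)%N x.
  rewrite -!big_split /=; apply: eq_bigr => i _.
  by rewrite -!(linD (bounded_lin (rAb r i))) -cut_split.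
have part_bound (P : pred nat) a x : (forall j, P j -> (a <= j)%N) ->
    hnorm x = 1 -> `|complex.Re (dot (part P x) x)| <= C * s a.
  move=> hP x1; apply: (le_trans (Re_dot_le hdot _ _)); rewrite x1 mulr1.
  apply: (le_trans (hnorm_sum _ _ _)); rewrite -[leRHS]mulr1 -x1.
  exact: (hC (cut P) (s a) (sge0 a) (diag_norm hdot oe te (cut_bound hP)) x).
have f_unit l : (l < q)%N -> hnorm (f l) = 1.
  move=> lq; apply/eqP; rewrite -(@eqrXn2 _ 2) ?hnorm_ge0//; apply/eqP/complexI.
  by rewrite -(dotxx hdot) of_// eqxx expr1n.
have trE : window_trace r n N = \sum_(l < q) dot (part (fun j => n <= j < N)%N (f l)) (f l).
  transitivity (\sum_(l < q) \sum_(i < rn r) \sum_(n <= j < N)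
      (s j)%:C%C * (dot (rA r i (e j)) (f l) * dot (rB r i (f l)) (e j))); last first.
    apply: eq_bigr => l _; rewrite partE dot_suml; apply: eq_bigr => i _.
    rewrite dot_suml; apply: eq_bigr => j _.
    by rewrite dotZl -mulrA (mulrC (dot (rA _ _ _) _)).
  rewrite exchange_big /= [LHS](eq_bigr (fun j => \sum_(i < rn r) (s j)%:C%C * dot (rB r i (rA r i (e j))) (e j))) => [|j _]; last by rewrite mulr_sumr.
  rewrite exchange_big /=; apply: eq_bigr => i _.
  rewrite exchange_big /=; apply: eq_big_nat => j /andP[_ jN].
  rewrite -mulr_sumr; congr (_ * _).
  rewrite -{1}(fv (rA r i (e j)) (vsP _ _ _ jN (ltn_ord i))).
  rewrite (lin_sum (bounded_lin (rBb r i))) dot_suml; apply: eq_bigr => l _.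
  by rewrite (linZ (bounded_lin (rBb r i))) dotZl.
(* These f l are orthogonal to the A_i e_j with j < n. *)
have low l : (p <= l)%N -> (l < q)%N -> dot (part (fun j => 0 <= j < n)%N (f l)) (f l) = 0.
  move=> pl lq; rewrite partE dot_suml big1// => i _.
  rewrite dot_suml big1_seq// => j /=; rewrite mem_index_iota /= => jn.
  rewrite dotZl -(f1v (rA r i (e j)) (vsP _ _ _ jn (ltn_ord i))).
  rewrite dot_suml big1 ?mulr0// => k _; rewrite dotZl -ff1// of_//.
    by rewrite ltn_eqF ?mulr0// (leq_trans _ pl).
  exact: leq_trans pq.
have step1 l : (l < p)%N -> - (C * s n) <= complex.Re (dot (part (fun j => n <= j < N)%N (f l)) (f l)).
  move=> lp; rewrite lerNl; apply: le_trans (ler_norm _) _; rewrite normrN.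
  by apply: part_bound => [j /andP[]//|]; rewrite f_unit// (leq_trans lp).
have step2 l : (p <= l)%N -> (l < q)%N ->
    - (C * s N) <= complex.Re (dot (part (fun j => n <= j < N)%N (f l)) (f l)).
  move=> pl lq; have := Xpos (f l); rewrite part_split !dotDl low// add0r cReD.
  have := part_bound (fun j => N <= j)%N N (f l) (fun j h => h) (f_unit _ lq).
  rewrite ler_norml => /andP[]; lra.
rewrite trE Re_sum -(big_mkord xpredT (fun l => complex.Re (dot (part (fun j => n <= j < N)%N (f l)) (f l)))).
rewrite (@big_cat_nat _ _ _ p)//=.
have b1 : - (C * s n) *+ p <= \sum_(0 <= l < p) complex.Re (dot (part (fun j => n <= j < N)%N (f l)) (f l)).
  rewrite -[p in leLHS]subn0 -sumr_const_nat; apply: ler_sum_nat => l /andP[_ lp].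
  exact: step1.
have b2 : - (C * s N) *+ (q - p) <= \sum_(p <= l < q) complex.Re (dot (part (fun j => n <= j < N)%N (f l)) (f l)).
  rewrite -sumr_const_nat; apply: ler_sum_nat => l /andP[pl lq].
  exact: step2.
apply: le_trans (lerD b1 b2).
have c1 : (C * s n) *+ p <= (C * s n) *+ (n * rn r) by rewrite ler_wpMn2l// mulr_ge0.
have c2 : (C * s N) *+ (q - p) <= (C * s N) *+ (N * rn r).
  by rewrite ler_wpMn2l// ?mulr_ge0// leq_subLR.
have -> : (rn r)%:R * C * (n%:R * s n + N%:R * s N) = (C * s n) *+ (n * rn r) + (C * s N) *+ (N * rn r).
  rewrite -[_ *+ (n * _)]mulr_natl -[_ *+ (N * _)]mulr_natl !natrM; ring.
rewrite !mulNrn; lra.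
Qed.

Definition rank1 (u v x : H) : H := dot x v *: u.

Lemma rank1_bounded u v : bounded_op (rank1 u v).
Proof.
apply/bounded_opP; split=> [a x y|]; first by rewrite /rank1 dotDl dotZl scalerDl scalerA.
exists (hnorm v * hnorm u) => [|x]; first by rewrite mulr_ge0 ?hnorm_ge0.
rewrite hnormZ mulrAC ler_wpM2r ?hnorm_ge0// mulrC; exact: (cauchy_schwarz hdot).
Qed.

Section Trace.
Context (U : set_system nat) (UU : UltraFilter U) (Uoo : \oo `<=` U).
Context (nn NN : nat -> nat).
Hypothesis nN : forall k, (k < nn k < NN k)%N.
Let Z k := \sum_(nn k <= j < NN k) s j.
Hypothesis win : forall k, (nn k)%:R * s (nn k) + (NN k)%:R * s (NN k) <= k.+1%:R^-1 * Z k.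

Let Z0 k : 0 < Z k.
Proof.
have /andP[_ nk] := nN k; rewrite /Z big_ltn// ltr_wpDr//.
by apply: sumr_ge0.
Qed.

Let UP : ProperFilter U. Proof. exact: ultra_proper. Qed.

Definition ulim (w : nat -> R[i]) z := forall dl : R, 0 < dl -> U [set k | cmod (w k - z) < dl].

Lemma ulim_unique w z z' : ulim w z -> ulim w z' -> z = z'.
Proof.
move=> hz hz'; apply/eqP; rewrite -subr_eq0; apply/eqP/cmod_eq0/eqP.
rewrite eq_le cmod_ge0 andbT; apply: le_eps => dl dl0; have d20 : 0 < dl / 2 by rewrite divr_gt0.
have [k [/= h1 h2]] := filter_ex (filterI (hz _ d20) (hz' _ d20)).
have -> : z - z' = (w k - z') - (w k - z) by rewrite opprB [RHS]addrC subrKA.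
by have := cmodD (w k - z') (- (w k - z)); rewrite cmodN; lra.
Qed.

Lemma ulim_add w w' z z' : ulim w z -> ulim w' z' -> ulim (fun k => w k + w' k) (z + z').
Proof.
move=> hz hz' dl dl0; have d20 : 0 < dl / 2 by rewrite divr_gt0.
apply: filterS (filterI (hz _ d20) (hz' _ d20)) => k [/= h1 h2].
have -> : w k + w' k - (z + z') = (w k - z) + (w' k - z') by rewrite opprD addrACA.
by have := cmodD (w k - z) (w' k - z'); lra.
Qed.

Lemma ulim_scale c w z : ulim w z -> ulim (fun k => c * w k) (c * z).
Proof.
move=> hz dl dl0; have c1 : 0 < cmod c + 1 by have := cmod_ge0 c; lra.
apply: filterS (hz _ (divr_gt0 dl0 c1)) => k /=; rewrite ltr_pdivlMr// -mulrBr cmodM => h.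
have := cmod_ge0 (w k - z); have := cmod_ge0 c; nra.
Qed.

Lemma ulim_cst w z : (forall k, w k = z) -> ulim w z.
Proof. by move=> wz dl dl0; apply: filterE => k /=; rewrite wz subrr cmod0. Qed.

Lemma ulim_ge0 w z C : 0 <= C -> ulim w z ->
  (forall k, - (C * k.+1%:R^-1) <= complex.Re (w k)) -> 0 <= complex.Re z.
Proof.
move=> C0 hz hw; rewrite -oppr_le0; apply: le_eps => dl dl0; rewrite add0r.
have d20 : 0 < dl / 2 by rewrite divr_gt0.
have C1 : 0 < C + 1 by lra.
have [N hN] := archi_inv (divr_gt0 d20 C1).
have UN : U [set k | (N <= k)%N] by apply: Uoo; exists N.
have [k [/= h1 h2]] := filter_ex (filterI (hz _ d20) UN).
have := hN k h2; rewrite ltr_pdivlMr//; have := hw k.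
have : 0 < k.+1%:R^-1 :> R by rewrite invr_gt0 ltr0n.
have := le_lt_trans (ler_Re _) h1; rewrite cReD cReN ltr_norml => /andP[].
move: (k.+1%:R^-1) => a; nra.
Qed.

Let W r k := (Z k)^-1%:C%C * window_trace r (nn k) (NN k).

Definition tr r := xget 0 [set z | ulim (W r) z].

Lemma trP r : ulim (W r) (tr r).
Proof.
have [C hC] := window_trace_bound r.
have [|z hz] := @ultra_bounded_limit R nat U UU (W r) C.
  apply: filterE => k /=; rewrite cmodM cmodR ger0_norm ?invr_ge0 ?(ltW (Z0 k))//.
  by rewrite mulrC ler_pdivrMr// hC.
by rewrite /tr; case: xgetP => [//|/(_ z)].
Qed.

Lemma trE r z : ulim (W r) z -> tr r = z.
Proof. exact: ulim_unique (trP r). Qed.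

Lemma tr_cat r r' : tr (rcat r r') = tr r + tr r'.
Proof.
apply: trE; have := ulim_add (trP r) (trP r'); congr ulim; apply/funext => k.
by rewrite /W window_trace_cat mulrDr.
Qed.

Lemma tr_scale c r : tr (rscale c r) = c * tr r.
Proof.
apply: trE; have := ulim_scale c (trP r); congr ulim; apply/funext => k.
by rewrite /W window_trace_scale mulrCA.
Qed.

Lemma tr_Re_ge0 r : (forall x, 0 <= complex.Re (dot (rop S r x) x)) -> 0 <= complex.Re (tr r).
Proof.
move=> /window_trace_pos[C C0 hC]; apply: (ulim_ge0 C0 (trP r)) => k.
have /andP[_ /ltnW nk] := nN k; have := hC _ _ nk.
rewrite /W ReRM => h; have Zk := Z0 k.
have := ler_wpM2l C0 (win k); have Zi : 0 < (Z k)^-1 by rewrite invr_gt0.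
move=> h2; have : - (C * (k.+1%:R^-1 * Z k)) <= complex.Re (window_trace r (nn k) (NN k)).
  by apply: le_trans h; rewrite lerN2.
move=> /(ler_wpM2l (ltW Zi)); apply: le_trans.
suff -> : (Z k)^-1 * - (C * (k.+1%:R^-1 * Z k)) = - (C * k.+1%:R^-1) by [].
by move: (k.+1%:R^-1) => a; field; rewrite gt_eqF.
Qed.

(** The imaginary part vanishes since i X and - i X have real part 0 as well. *)
Lemma tr_positive r : positive_op dot (rop S r) -> 0 <= tr r.
Proof.
move=> X0; have Xx x : complex.Im (dot (rop S r x) x) = 0 by apply: ger0_Im.
have Rex x : 0 <= complex.Re (dot (rop S r x) x) by have := X0 x; rewrite lecE => /andP[].
have h1 := tr_Re_ge0 Rex.
have Im0 (c : R[i]) : complex.Re c = 0 -> 0 <= complex.Re (c * tr r).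
  move=> c0; rewrite -tr_scale; apply: tr_Re_ge0 => x.
  by rewrite rop_scale fctE dotZl cReM Xx c0 mul0r mulr0 subr0.
have := Im0 (0 +i* 1)%C erefl; have := Im0 (0 +i* -1)%C erefl.
rewrite !cReM /= => h2 h3; rewrite lecE /= h1 andbT; apply/eqP; lra.
Qed.

(** The combination of r and r' that presents 0 has a nonnegative trace, and so does
    its opposite. *)
Lemma tr_well_defined r r' : rop S r = rop S r' -> tr r = tr r'.
Proof.
move=> rr; apply/eqP; rewrite -subr_eq0; apply/eqP.
have key c : 0 <= c * (tr r - tr r').
  rewrite -mulN1r -tr_scale -tr_cat -tr_scale; apply: tr_positive => x.
  by rewrite rop_scale rop_cat rop_scale rr scaleN1r subrr scaler0 dot0l.
have := key 1; have := key (-1); rewrite mul1r mulN1r oppr_ge0 => h1 h2.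
by apply/eqP; rewrite eq_le h1 h2.
Qed.

Definition trace X := xget 0 [set z | exists r, rop S r = X /\ tr r = z].

Lemma trace_rop r : trace (rop S r) = tr r.
Proof.
rewrite /trace; case: xgetP => [z _ [r' [/tr_well_defined <- ->//]]|/(_ (tr r)) h].
by exfalso; apply: h; exists r.
Qed.

Let bS : bounded_op S := diag_bounded hdot oe te (cmod_decr_bound sge0 sm).

Lemma trace_gen : trace S = 1.
Proof.
rewrite -(rop_unit S) trace_rop; apply/trE/ulim_cst => k.
by rewrite /W window_trace_unit -rmorphM mulVf// gt_eqF// Z0.
Qed.

(** P has a presentation by rank one operators through e 0, and all the windows avoid
    the index 0. *)
Lemma trace_finite_rank P : finite_rank_projection dot P -> trace P = 0.
Proof.
move=> [bP _ aP [m [eps hP]]].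
have o0 : orthn dot (fun=> 0) 0 by [].
have [f [q [of_ _ _ fv]]] := gram_schmidt hdot [seq eps i | i <- enum 'I_m] o0.
have fP x : proj dot f q (P x) = P x.
  have [c ->] := hP x; rewrite (lin_sum (@proj_lin _ _ dot f q)); apply: eq_bigr => i _.
  by rewrite (linZ (@proj_lin _ _ dot f q)) fv// map_f// mem_enum.
pose r := Rep q (fun l => rank1_bounded (f l) (e 0%N))
  (fun l => bounded_scale (s 0%N)^-1%:C%C (rank1_bounded (e 0%N) (P (f l)))).
have -> : P = rop S r.
  apply/funext => x; rewrite -fP /proj; apply: eq_bigr => l _ /=.
  have Se : S (e 0%N) = (s 0%N)%:C%C *: e 0%N := diag_e hdot oe te (cmod_decr_bound sge0 sm) 0%N.
  rewrite fctE /rank1 !(linZ (bounded_lin bS)) Se.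
  rewrite (adjointP hdot oe te bP) aP; congr (_ *: _).
  by rewrite !dotZl oe eqxx mulr1 mulrCA -rmorphM mulVf ?gt_eqF// rmorph1 mulr1.
rewrite trace_rop; apply/trE/ulim_cst => k.
rewrite /W /window_trace big1_seq ?mulr0// => j; rewrite mem_index_iota /= => /andP[nj _].
have j0 : j != 0%N by have /andP[kn _] := nN k; rewrite -lt0n (leq_trans _ nj)// (leq_trans _ kn).
rewrite big1 ?mulr0// => l _.
rewrite /= [rank1 (f l) _ _]/rank1 oe (negPf j0) scale0r.
by rewrite (lin0 (bounded_lin (bounded_scale _ (rank1_bounded _ _)))) dot0l.
Qed.

Lemma trace_singular : singular_trace dot (ideal_generated S) trace.
Proof.
split.
- move=> c X Y /(ideal_rep bS)[r <-] /(ideal_rep bS)[r' <-].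
  by rewrite -rop_scale -rop_cat !trace_rop tr_cat tr_scale.
- move=> X /(ideal_rep bS)[r <-] X0; rewrite trace_rop; exact: tr_positive.
- move=> V X [bV aV _] /(ideal_rep bS)[r <-].
  have bA := adjoint_bounded hdot oe te bV.
  rewrite -(rop_mul S bV bA) !trace_rop; apply: trE; have := trP r; congr ulim.
  by apply/funext => k; rewrite /W window_trace_mul.
- by move=> P _; exact: trace_finite_rank.
Qed.

End Trace.

Theorem singular_trace_exists :
  (forall (eps : R) K, 0 < eps -> exists n N, [/\ (K <= n < N)%N &
    n%:R * s n + N%:R * s N <= eps * \sum_(n <= j < N) s j]) ->
  exists tau, singular_trace dot (ideal_generated S) tau /\ tau S = 1.
Proof.
move=> win.
have /choice[w hw] : forall k, exists w : nat * nat, (k < w.1 < w.2)%N /\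
    w.1%:R * s w.1 + w.2%:R * s w.2 <= k.+1%:R^-1 * \sum_(w.1 <= j < w.2) s j.
  move=> k; have k0 : 0 < k.+1%:R^-1 :> R by rewrite invr_gt0 ltr0n.
  by have [n [N [h1 h2]]] := win _ k.+1 k0; exists (n, N).
have [U [UU Uoo]] := @ultraFilterLemma nat \oo _.
exists (trace U (fst \o w) (snd \o w)); split.
  by apply: trace_singular => // k; case: (hw k).
by apply: trace_gen => // k; case: (hw k).
Qed.

End TraceConstruction.

(** * Operator limits and square roots *)

Section OperatorLimits.
Context {R : realType} {H : completeNormedModType R[i]}.
Implicit Types (S T X Y : H -> H) (M N q : R).

Definition norm_le M T := linear T /\ forall x, hnorm (T x) <= M * hnorm x.

Lemma norm_le_bounded M T : 0 <= M -> norm_le M T -> bounded_op T.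
Proof. by move=> M0 [lT hT]; apply/bounded_opP; split=> //; exists M. Qed.

Lemma bounded_norm_le T : bounded_op T -> exists2 M, 0 <= M & norm_le M T.
Proof. by move=> /bounded_opP[lT [M M0 hM]]; exists M. Qed.

Lemma norm_le_comp M N S T : 0 <= M -> norm_le M S -> norm_le N T -> norm_le (M * N) (S \o T).
Proof.
move=> M0 [lS hS] [lT hT]; split=> [a x y|x] /=; first by rewrite lT lS.
by apply: (le_trans (hS _)); rewrite -mulrA ler_wpM2l.
Qed.

Lemma norm_le_add M N S T : norm_le M S -> norm_le N T -> norm_le (M + N) (S + T).
Proof.
move=> [lS hS] [lT hT]; split=> [a x y|x].
  by rewrite !fctE lS lT scalerDr addrACA.
by rewrite fctE mulrDl; apply: (le_trans (hnormD _ _)); rewrite lerD.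
Qed.

Lemma norm_le_scale M c T : norm_le M T -> norm_le (cmod c * M) (c *: T).
Proof.
move=> [lT hT]; split=> [a x y|x].
  by rewrite !fctE lT scalerDr !scalerA mulrC.
by rewrite fctE hnormZ -mulrA ler_wpM2l ?cmod_ge0.
Qed.

Lemma norm_le_id : norm_le 1 (id : H -> H).
Proof. by split=> // x; rewrite mul1r. Qed.

Lemma norm_le_opp M T : norm_le M T -> norm_le M (- T).
Proof.
move=> [lT hT]; split=> [a x y|x]; first by rewrite !fctE lT opprD scalerN.
by rewrite fctE hnormN.
Qed.

Lemma norm_le_sub M N S T : norm_le M S -> norm_le N T -> norm_le (M + N) (S - T).
Proof. by move=> hS hT; apply: norm_le_add => //; exact: norm_le_opp. Qed.

Lemma norm_le_le M N T : M <= N -> norm_le M T -> norm_le N T.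
Proof.
by move=> MN [lT hT]; split=> // x; apply: (le_trans (hT x)); rewrite ler_wpM2r ?hnorm_ge0.
Qed.

Lemma norm_le_sum M (n : nat) (F : 'I_n -> H -> H) : (forall i, norm_le M (F i)) ->
  norm_le (n%:R * M) (\sum_(i < n) F i).
Proof.
elim: n F => [|n IH] F hF.
  rewrite big_ord0 mul0r; split=> [a x y|x]; first by rewrite scaler0 addr0.
  by rewrite mul0r hnorm0.
rewrite big_ord_recr -natr1 mulrDl mul1r; apply: norm_le_add => //; exact: IH.
Qed.

Lemma geometric_le0 q K (t : R) : 0 < q < 1 -> (forall n, t <= K * q ^+ n) -> t <= 0.
Proof.
move=> /andP[q0 q1] h; apply: le_eps => eps eps0; rewrite add0r.
have [J hJ] := @expr_unbounded R q^-1 (K / eps) ltac:(by rewrite invf_gt1).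
have := hJ J (leqnn _); rewrite exprVn ltr_pdivrMr// => h2.
have := h J; have qJ : 0 < q ^+ J by rewrite exprn_gt0.
have : K * q ^+ J < eps.
  by rewrite -ltr_pdivlMr// mulrC.
lra.
Qed.

Lemma geometric_small q K (z : H) : 0 < q < 1 -> (forall n, hnorm z <= K * q ^+ n) -> z = 0.
Proof.
by move=> q01 h; apply/hnorm_eq0/eqP; rewrite eq_le hnorm_ge0 andbT; exact: geometric_le0 h.
Qed.

Context (dot : {dot H for conjC}) (hdot : hilbert_dot dot).

Lemma operator_limit (Y : nat -> H -> H) (C q : R) : 0 <= C -> 0 < q < 1 ->
  (forall n, linear (Y n)) ->
  (forall n x, hnorm (Y n.+1 x - Y n x) <= C * q ^+ n * hnorm x) ->
  exists Z : H -> H, linear Z /\ forall n x, hnorm (Z x - Y n x) <= C / (1 - q) * q ^+ n * hnorm x.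
Proof.
move=> C0 /andP[q0 q1] lY hY; have q10 : 0 < 1 - q by lra.
have K0 : 0 <= C / (1 - q) by rewrite divr_ge0// ltW.
have tele n m x : hnorm (Y (n + m)%N x - Y n x) <= C / (1 - q) * (q ^+ n - q ^+ (n + m)) * hnorm x.
  elim: m => [|m IH]; first by rewrite addn0 !subrr hnorm0 mulr0 mul0r.
  have -> : Y (n + m.+1)%N x - Y n x = (Y (n + m).+1 x - Y (n + m)%N x) + (Y (n + m)%N x - Y n x).
    by rewrite addnS subrKA.
  apply: (le_trans (hnormD _ _)); apply: (le_trans (lerD (hY _ _) IH)).
  rewrite -mulrDl ler_wpM2r ?hnorm_ge0// addnS exprS.
  suff -> : C * q ^+ (n + m) = C / (1 - q) * (q ^+ (n + m) - q * q ^+ (n + m)).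
    by rewrite -mulrDr [X in _ * X <= _]addrC subrKA.
  by field; rewrite gt_eqF.
have dist n m x : hnorm (Y (n + m)%N x - Y n x) <= C / (1 - q) * q ^+ n * hnorm x.
  apply: (le_trans (tele n m x)); rewrite ler_wpM2r ?hnorm_ge0// ler_wpM2l//.
  by rewrite gerDl oppr_le0 exprn_ge0// ltW.
have small (x : H) (eps : R) : 0 < eps -> exists N : nat, C / (1 - q) * q ^+ N * hnorm x < eps.
  move=> eps0.
  have [J hJ] := @expr_unbounded R q^-1 (C / (1 - q) * hnorm x / eps) ltac:(by rewrite invf_gt1).
  exists J; have := hJ J (leqnn _); rewrite exprVn ltr_pdivrMr// => h2.
  by rewrite mulrAC -ltr_pdivlMr ?exprn_gt0// [ltRHS]mulrC.
have ex x : exists z, forall n, hnorm (z - Y n x) <= C / (1 - q) * q ^+ n * hnorm x.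
  have [eps eps0|z hz] := hnorm_cauchy (u := Y ^~ x).
    have e20 : 0 < eps / 2 by rewrite divr_gt0.
    have [N hN] := small x _ e20.
    exists N => m n Nm Nn.
    have -> : Y m x - Y n x = (Y m x - Y N x) - (Y n x - Y N x) by rewrite opprB addrA subrK.
    apply: (le_lt_trans (hnormB _ _)).
    have := dist N (m - N)%N x; have := dist N (n - N)%N x; rewrite !subnKC//; lra.
  exists z => n; apply: le_eps => eps eps0; have [N hN] := hz _ eps0.
  have := hN (n + N)%N (leq_addl _ _); rewrite hnormC => h1.
  have := hnormD (z - Y (n + N)%N x) (Y (n + N)%N x - Y n x); rewrite subrKA.
  have := dist n N x; lra.
have /choice[Z hZ] := ex; exists Z; split=> //.
move=> a x y; apply/eqP; rewrite -subr_eq0; apply/eqP.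
apply: (@geometric_small q (C / (1 - q) * (hnorm (a *: x + y) + cmod a * hnorm x + hnorm y))); rewrite ?q0// => n.
have -> : Z (a *: x + y) - (a *: Z x + Z y) =
   (Z (a *: x + y) - Y n (a *: x + y)) - a *: (Z x - Y n x) - (Z y - Y n y).
  by rewrite lY; apply: (dot_ext hdot) => w; rewrite !(dotDl, dotBl, dotNl, dotZl); ring.
apply: (le_trans (hnormB _ _)); apply: (le_trans (lerD (hnormB _ _) (lexx _))); rewrite hnormZ.
have h1 := hZ (a *: x + y) n; have h2 := ler_wpM2l (cmod_ge0 a) (hZ x n); have h3 := hZ y n.
move: h1 h2 h3; move: (hnorm _) (hnorm _) (hnorm _) (hnorm _) (hnorm _) (hnorm _) (cmod a) (C / (1 - q)) (q ^+ n) => a1 a2 a3 a4 a5 a6 a7 a8 a9.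
lra.
Qed.

End OperatorLimits.

Section SquareRoot.
Context {R : realType} {H : completeNormedModType R[i]}.
Context (dot : {dot H for conjC}) (hdot : hilbert_dot dot).

Definition symmetric T := forall x y : H, dot (T x) y = dot x (T y).

(** The iteration Y' = (X + Y^2) / 2 started at 0 contracts to a solution Z of
    Z = (X + Z^2) / 2, and Q = 1 - Z. Each iterate is a polynomial in X, hence the
    last clause. *)
Lemma sqrt_one_minus (X : H -> H) (r : R) : 0 < r < 1 -> norm_le r X -> symmetric X ->
  exists Q : H -> H, [/\ bounded_op Q, symmetric Q, forall x, Q (Q x) = x - X x &
    forall C : H -> H, bounded_op C -> (forall x, C (X x) = X (C x)) -> forall x, C (Q x) = Q (C x)].
Proof.
move=> /andP[r0 r1] [lX hX] sX.
pose Y := fix Y n x := if n is k.+1 then 2^-1 *: (X x + Y k (Y k x)) else 0 : H.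
have c2 : cmod (2^-1 : R[i]) = 2^-1.
  by rewrite -(rmorph_nat (real_complex R)) -fmorphV cmodR ger0_norm// invr_ge0.
have lY n : linear (Y n).
  elim: n => [|n IH] a x y /=; first by rewrite scaler0 addr0.
  by rewrite lX !IH !scalerDr !scalerA (mulrC a) addrACA.
have bY n x : hnorm (Y n x) <= r * hnorm x.
  elim: n x => [|n IH] x /=; first by rewrite hnorm0 mulr_ge0 ?hnorm_ge0// ltW.
  rewrite hnormZ c2; have := hnormD (X x) (Y n (Y n x)); have := hX x.
  have := IH (Y n x); have := ler_wpM2l (ltW r0) (IH x).
  have : r * (r * hnorm x) <= r * hnorm x by rewrite ler_wpM2l ?(ltW r0)// ler_piMl ?hnorm_ge0// ltW.
  lra.
have dY n x : hnorm (Y n.+1 x - Y n x) <= 1 * r ^+ n * hnorm x.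
  rewrite mul1r; elim: n x => [|n IH] x.
    rewrite expr0 mul1r subr0; apply: (le_trans (bY 1%N x)).
    by rewrite ler_piMl ?hnorm_ge0// ltW.
  have -> : Y n.+2 x - Y n.+1 x = 2^-1 *: (Y n.+1 (Y n.+1 x - Y n x) + (Y n.+1 (Y n x) - Y n (Y n x))).
    rewrite -[Y n.+2 x]/(2^-1 *: (X x + Y n.+1 (Y n.+1 x))) -[X in _ - X = _]/(2^-1 *: (X x + Y n (Y n x))).
    rewrite -scalerBr; congr (_ *: _).
    by rewrite (linB (lY n.+1)) subrKA opprD addrACA subrr add0r.
  rewrite hnormZ c2; have := hnormD (Y n.+1 (Y n.+1 x - Y n x)) (Y n.+1 (Y n x) - Y n (Y n x)).
  have := bY n.+1 (Y n.+1 x - Y n x); have := ler_wpM2l (ltW r0) (IH x).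
  have := IH (Y n x); have := ler_wpM2l (exprn_ge0 n (ltW r0)) (bY n x).
  rewrite exprS; lra.
have [Z [lZ hZ]] := operator_limit hdot (ler01 : 0 <= 1 :> R) (introT andP (conj r0 r1)) lY dY.
have r10 : 0 < 1 - r by lra.
set K := 1 / (1 - r) in hZ; have K0 : 0 <= K by rewrite divr_ge0// ltW.
have rI : 0 < r < 1 by rewrite r0.
have bZ x : hnorm (Z x) <= K * hnorm x by have := hZ 0%N x; rewrite subr0 expr0 mulr1.
have ZZ x : Z x + Z x = X x + Z (Z x).
  apply/eqP; rewrite -subr_eq0; apply/eqP.
  apply: (@geometric_small _ _ r ((2 * K + r * K + K * K) * hnorm x)) => // n.
  have E : Y n.+1 x + Y n.+1 x = X x + Y n (Y n x).
    by rewrite -[Y n.+1 x]/(2^-1 *: (X x + Y n (Y n x))) -scalerDl -div1r -splitr scale1r.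
  have -> : Z x + Z x - (X x + Z (Z x)) = (Z x - Y n.+1 x) + (Z x - Y n.+1 x)
      - Y n (Z x - Y n x) - (Z (Z x) - Y n (Z x)).
    have -> : X x = Y n.+1 x + Y n.+1 x - Y n (Y n x) by rewrite E addrK.
    rewrite (linB (lY n)); apply: (dot_ext hdot) => w.
    by rewrite !(dotDl, dotBl, dotNl); ring.
  apply: (le_trans (hnormB _ _)); apply: (le_trans (lerD (hnormB _ _) (lexx _))).
  apply: (le_trans (lerD (lerD (hnormD _ _) (lexx _)) (lexx _))).
  have h1 := hZ n.+1 x; have h2 := bY n (Z x - Y n x); have h3 := ler_wpM2l (ltW r0) (hZ n x).
  have h4 := hZ n (Z x); have q0 : 0 <= r ^+ n by rewrite exprn_ge0 ?ltW.
  have h5 : K * r ^+ n * hnorm (Z x) <= K * r ^+ n * (K * hnorm x) by apply: ler_wpM2l => //; exact: mulr_ge0.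
  have h6 : K * r ^+ n.+1 * hnorm x <= K * r ^+ n * hnorm x.
    by rewrite ler_wpM2r ?hnorm_ge0// ler_wpM2l// exprS ler_piMl// ltW.
  have -> : (2 * K + r * K + K * K) * hnorm x * r ^+ n =
    2 * (K * r ^+ n * hnorm x) + r * (K * r ^+ n * hnorm x) + K * r ^+ n * (K * hnorm x) by ring.
  lra.
exists (id - Z); split.
- by apply: (@norm_le_bounded _ _ (1 + K)); [lra|apply: norm_le_sub => //; exact: norm_le_id].
- suff sZ : symmetric Z by move=> x y; rewrite !fctE dotBl dotBr sZ.
  have sY n : symmetric (Y n).
    elim: n => [|n IH] x y /=; first by rewrite dot0l dot0r.
    rewrite dotZl dotZr dotDl dotDr sX !IH -(rmorph_nat (real_complex R)) -fmorphV.
    by rewrite conjRC.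
  move=> x y; apply/eqP; rewrite -subr_eq0; apply/eqP/cmod_eq0/eqP; rewrite eq_le cmod_ge0 andbT.
  apply: (@geometric_le0 _ r (2 * (K * hnorm x * hnorm y))) => // n.
  have -> : dot (Z x) y - dot x (Z y) = dot (Z x - Y n x) y - dot x (Z y - Y n y).
    by rewrite dotBl dotBr sY opprB subrKA.
  apply: (le_trans (cmodD _ _)); rewrite cmodN.
  apply: (le_trans (lerD (cauchy_schwarz hdot _ _) (cauchy_schwarz hdot _ _))).
  have h1 := ler_wpM2r (hnorm_ge0 y) (hZ n x); have h2 := ler_wpM2l (hnorm_ge0 x) (hZ n y).
  have -> : 2 * (K * hnorm x * hnorm y) * r ^+ n = K * r ^+ n * hnorm x * hnorm y + hnorm x * (K * r ^+ n * hnorm y) by ring.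
  lra.
- move=> x; rewrite !fctE (linB lZ); apply/eqP; rewrite -subr_eq0.
  have -> : X x = Z x + Z x - Z (Z x) by rewrite ZZ addrK.
  by apply/eqP; apply: (dot_ext hdot) => w; rewrite !(dotDl, dotBl, dotNl, dot0l); ring.
- move=> C /bounded_norm_le[M M0 [lC hC]] CX x; rewrite !fctE (linB lC); congr (_ - _).
  have CY n z : C (Y n z) = Y n (C z).
    by elim: n z => [|n IH] z /=; rewrite ?(lin0 lC)// (linZ lC) (linD lC) CX !IH.
  apply/eqP; rewrite -subr_eq0; apply/eqP.
  apply: (@geometric_small _ _ r (M * (K * hnorm x) + K * hnorm (C x))) => // n.
  have -> : C (Z x) - Z (C x) = C (Z x - Y n x) - (Z (C x) - Y n (C x)).
    by rewrite (linB lC) CY opprB subrKA.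
  apply: (le_trans (hnormB _ _)); have := hC (Z x - Y n x); have := ler_wpM2l M0 (hZ n x).
  have := hZ n (C x).
  have -> : (M * (K * hnorm x) + K * hnorm (C x)) * r ^+ n = M * (K * r ^+ n * hnorm x) + K * r ^+ n * hnorm (C x) by ring.
  lra.
Qed.

End SquareRoot.

(** * Cyclicity, positivity and continuity of singular traces *)

Section SingularTraces.
Context {R : realType} {H : completeNormedModType R[i]}.
Context (dot : {dot H for conjC}) (hdot : hilbert_dot dot).
Context (e : nat -> H).
Hypothesis oe : forall i j, dot (e i) (e j) = (i == j)%:R.
Hypothesis te : forall x, (forall i, dot x (e i) = 0) -> x = 0.
Implicit Types (A B X Y : H -> H).

Let adjP A : bounded_op A -> forall x y, dot (A x) y = dot x (adjoint dot A y) := adjointP hdot oe te (T := A).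

Lemma conjiC : ('i%C : R[i])^* = - 'i%C.
Proof. by apply: complex_eqP; rewrite ?(cReJ, cImJ, cReN, cImN) /= ?oppr0. Qed.

Lemma mulii : ('i%C : R[i]) * 'i%C = -1.
Proof. by rewrite -expr2 sqr_i. Qed.

(** The unitaries are A + i Q and A - i Q, where Q is the square root of 1 - A^2. *)
Lemma unitary_mean A : norm_le 2^-1 A -> symmetric dot A ->
  exists U V : H -> H, [/\ unitary_op dot U, unitary_op dot V & forall x, U x + V x = A x + A x].
Proof.
move=> hA sA; have [lA _] := hA.
have h2 : 0 <= 2^-1 :> R by rewrite invr_ge0.
have hX := norm_le_comp h2 hA hA.
have sX : symmetric dot (A \o A) by move=> x y /=; rewrite sA sA.
have rI : 0 < (2^-1 * 2^-1 : R) < 1 by apply/andP; split; lra.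
have [Q [bQ sQ QQ cQ]] := sqrt_one_minus hdot rI hX sX.
have bA : bounded_op A by exact: norm_le_bounded hA.
have AQ x : A (Q x) = Q (A x) by apply: cQ.
have lQ := bounded_lin bQ.
have key (c : R[i]) : c * c = -1 -> c^* = - c -> unitary_op dot (A + c *: Q).
  move=> cc cJ; have bU : bounded_op (A + c *: Q) by apply: bounded_add => //; exact: bounded_scale.
  have aU : adjoint dot (A + c *: Q) = A - c *: Q.
    apply: (adjoint_unique hdot oe te bU) => x y.
    by rewrite !fctE dotDl dotBr dotZl dotZr sA sQ cJ mulNr opprK.
  have scal z : c *: (c *: z) = - z by rewrite scalerA cc scaleN1r.
  split=> // x; rewrite aU !fctE /= !(linD lA, linN lA, linZ lA, linD lQ, linN lQ, linZ lQ) AQ.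
    rewrite scalerDr scal QQ /=; apply: (dot_ext hdot) => w.
    by rewrite !(dotDl, dotBl, dotNl); ring.
  rewrite scalerDr scalerN scal QQ /=; apply: (dot_ext hdot) => w.
  by rewrite !(dotDl, dotBl, dotNl); ring.
exists (A + 'i%C *: Q), (A + (- 'i%C) *: Q); split.
- by apply: key; rewrite ?mulii ?conjiC.
- by apply: key; rewrite ?mulrNN ?mulii// rmorphN /= conjiC.
- by move=> x; rewrite !fctE scaleNr addrACA subrr addr0.
Qed.

Lemma adjoint_norm_le A M : 0 <= M -> norm_le M A -> norm_le M (adjoint dot A).
Proof.
move=> M0 [lA hA]; have [S [lS nS hS]] := adjoint_ex hdot oe te lA M0 hA.
by rewrite (adjoint_unique hdot oe te _ hS)//; apply: (norm_le_bounded M0).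
Qed.

Lemma symmetric_parts B M : 0 <= M -> norm_le M B -> exists A1 A2 : H -> H,
  [/\ norm_le M A1, norm_le M A2, symmetric dot A1, symmetric dot A2 & B = A1 + 'i%C *: A2].
Proof.
move=> M0 hB; have hB' := adjoint_norm_le M0 hB; have bB := norm_le_bounded M0 hB.
set B' := adjoint dot B in hB'.
have BB' x y : dot (B x) y = dot x (B' y) by exact: adjP.
have B'B x y : dot (B' x) y = dot x (B y) by rewrite dotC -BB' -dotC.
have c2 : cmod (2^-1 : R[i]) = 2^-1.
  by rewrite -(rmorph_nat (real_complex R)) -fmorphV cmodR ger0_norm// invr_ge0.
have ci : cmod ('i%C : R[i]) = 1.
  by apply/eqP; rewrite -(@eqrXn2 _ 2) ?cmod_ge0// cmod_sqr /= !expr0n add0r.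
have half : 2^-1 * (M + M) = M by lra.
exists (2^-1 *: (B + B')), ((- 'i%C) *: (2^-1 *: (B - B'))); split.
- by rewrite -{1}half -{1}c2; apply: norm_le_scale; exact: norm_le_add.
- have -> : M = cmod (- 'i%C : R[i]) * (2^-1 * (M + M)) by rewrite cmodN ci half mul1r.
  by apply: norm_le_scale; rewrite -{1}c2; apply: norm_le_scale; exact: norm_le_sub.
- move=> x y; rewrite !fctE dotZl dotZr dotDl dotDr BB' B'B -(rmorph_nat (real_complex R)) -fmorphV conjRC.
  by rewrite addrC.
- move=> x y; rewrite !fctE !dotZl !dotZr dotBl dotBr BB' B'B -(rmorph_nat (real_complex R)) -fmorphV conjRC.
  by rewrite rmorphN /= conjiC; ring.
- apply/funext => x; rewrite !fctE scalerA mulrN mulii opprK scale1r -scalerDr addrACA subrr addr0.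
  by rewrite scalerDr -scalerDl -div1r -splitr scale1r.
Qed.

Context (s : nat -> R) (s0 : forall n, 0 < s n) (sm : forall m n, (m <= n)%N -> s n <= s m).
Let S := diag dot e (fun n => (s n)%:C%C).
Let sge0 n : 0 <= s n. Proof. exact: ltW. Qed.
Let Sc x i : dot (S x) (e i) = (s i)%:C%C * dot x (e i) := diag_coef hdot oe te (cmod_decr_bound sge0 sm) x i.
Let bS : bounded_op S := diag_bounded hdot oe te (cmod_decr_bound sge0 sm).
Let lS : linear S := bounded_lin bS.
Let J := ideal_generated S.
Context (tau : (H -> H) -> R[i]) (htau : singular_trace dot J tau) (tau1 : tau S = 1).

Let JS : J S. Proof. exact: ideal_generated_gen. Qed.
Let Jid : two_sided_ideal J. Proof. exact: ideal_generated_ideal. Qed.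
Let J0 : J 0. Proof. by case: Jid. Qed.
Let JD X Y : J X -> J Y -> J (X + Y). Proof. by case: Jid => _ _ h _; exact: h. Qed.
Let JL B X : bounded_op B -> J X -> J (B \o X). Proof. by move=> bB hX; case: Jid => _ _ _ /(_ _ _ bB hX)[]. Qed.
Let JR B X : bounded_op B -> J X -> J (X \o B). Proof. by move=> bB hX; case: Jid => _ _ _ /(_ _ _ bB hX)[]. Qed.
Let Jb X : J X -> bounded_op X. Proof. by case: Jid => h _ _ _; exact: h. Qed.

Lemma tau_lin c X Y : J X -> J Y -> tau (c *: X + Y) = c * tau X + tau Y.
Proof. by case: htau => h _ _ _; exact: h. Qed.

Lemma tauD X Y : J X -> J Y -> tau (X + Y) = tau X + tau Y.
Proof. by move=> hX hY; rewrite -[X]scale1r tau_lin// mul1r scale1r. Qed.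

Lemma tau_0 : tau 0 = 0.
Proof. by apply: (@addrI _ (tau 0)); rewrite -tauD// !addr0. Qed.

Lemma tauZ c X : J X -> tau (c *: X) = c * tau X.
Proof. by move=> hX; rewrite -[c *: X]addr0 tau_lin// tau_0 addr0. Qed.

Lemma tau_unitary U X : unitary_op dot U -> J X -> tau (U \o X) = tau (X \o U).
Proof.
move=> uU hX; have [bU _ UU] := uU; case: htau => _ _ h _.
rewrite -(h U (X \o U) uU (JR bU hX)); congr tau; apply/funext => x /=.
by have := UU x; rewrite /= => ->.
Qed.

Lemma tau_symmetric A X : bounded_op A -> symmetric dot A -> J X -> tau (A \o X) = tau (X \o A).
Proof.
move=> bA sA hX; have [M M0 hA] := bounded_norm_le bA.
pose t : R := (2 * (M + 1))^-1.
have t0 : 0 < t by rewrite invr_gt0 mulr_gt0//; lra.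
have hA' : norm_le 2^-1 (t%:C%C *: A).
  apply: (norm_le_le _ (norm_le_scale _ hA)); rewrite cmodR gtr0_norm// /t invfM -mulrA ler_piMr ?invr_ge0//.
  by rewrite mulrC ler_pdivrMr; lra.
have sA' : symmetric dot (t%:C%C *: A) by move=> x y; rewrite !fctE dotZl dotZr conjRC sA.
have [U [V [uU uV UV]]] := unitary_mean hA' sA'.
have [bU _ _] := uU; have [bV _ _] := uV; have lX := bounded_lin (Jb hX).
have h1 : (2 * t%:C%C) *: (A \o X) = (U \o X) + (V \o X).
  apply/funext => x; rewrite !fctE /= UV !fctE -scalerDl mulr_natl mulr2n.
  by [].
have h2 : (2 * t%:C%C) *: (X \o A) = (X \o U) + (X \o V).
  apply/funext => x; rewrite !fctE /= -(linD lX) UV !fctE -scalerDl (linZ lX) mulr_natl mulr2n.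
  by [].
have t2 : 2 * t%:C%C != 0 :> R[i].
  by rewrite mulf_neq0 ?pnatr_eq0//; apply/eqP => /(@complexI _ _ 0)/eqP; rewrite gt_eqF.
apply: (mulfI t2); rewrite -!tauZ ?h1 ?h2; [|exact: JR|exact: JL].
by rewrite (tauD (JL bU hX) (JL bV hX)) (tauD (JR bU hX) (JR bV hX)) (tau_unitary uU hX) (tau_unitary uV hX).
Qed.

(** Unitary invariance says that tau (U X) = tau (X U) for unitary U, and a bounded
    operator is a linear combination of four unitaries. *)
Lemma tau_cyclic B X : bounded_op B -> J X -> tau (B \o X) = tau (X \o B).
Proof.
move=> /bounded_norm_le[M M0 hB] hX; have lX := bounded_lin (Jb hX).
have [A1 [A2 [h1 h2 s1 s2 ->]]] := symmetric_parts M0 hB.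
have b1 := norm_le_bounded M0 h1; have b2 := norm_le_bounded M0 h2.
have -> : (A1 + 'i%C *: A2) \o X = (A1 \o X) + 'i%C *: (A2 \o X) by apply/funext.
have -> : X \o (A1 + 'i%C *: A2) = (X \o A1) + 'i%C *: (X \o A2).
  by apply/funext => x; rewrite -[LHS]/(X (A1 x + 'i%C *: A2 x)) (linD lX) (linZ lX).
rewrite addrC [X in _ = tau X]addrC (tau_lin _ (JL b2 hX) (JL b1 hX)) (tau_lin _ (JR b2 hX) (JR b1 hX)).
by rewrite (tau_symmetric b1 s1 hX) (tau_symmetric b2 s2 hX).
Qed.

Lemma JZ c X : J X -> J (c *: X).
Proof.
move=> hX; have -> : c *: X = (c *: (id : H -> H)) \o X by [].
by apply: JL => //; apply: bounded_scale; exact: bounded_id.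
Qed.

(** The state of interest is the composite of this functional with the representation
    of the algebra. *)
Definition phi X := tau (X \o S).

Lemma phiD X Y : bounded_op X -> bounded_op Y -> phi (X + Y) = phi X + phi Y.
Proof. by move=> bX bY; exact: tauD (JL bX JS) (JL bY JS). Qed.

Lemma phiZ c X : bounded_op X -> phi (c *: X) = c * phi X.
Proof. by move=> bX; exact: tauZ (JL bX JS). Qed.

Lemma phiB X Y : bounded_op X -> bounded_op Y -> phi (X - Y) = phi X - phi Y.
Proof.
by move=> bX bY; rewrite -scaleN1r phiD ?phiZ ?mulN1r//; exact: bounded_scale.
Qed.

Lemma phi_id : phi id = 1.
Proof. exact: tau1. Qed.

Lemma phi_rotate X Y : bounded_op X -> bounded_op Y -> tau (X \o S \o Y) = phi (Y \o X).
Proof. by move=> bX bY; rewrite -(tau_cyclic bY (JL bX JS)). Qed.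

Lemma positive_symmetric A : linear A -> positive_op dot A -> symmetric dot A.
Proof.
move=> lA A0 x y; rewrite [RHS]dotC.
have Im0 z : complex.Im (dot (A z) z) = 0 by apply: ger0_Im; exact: A0.
have := Im0 (x + y); have := Im0 (x + 'i%C *: y).
rewrite !(linD lA, linZ lA) !(dotDl, dotDr, dotZl, dotZr) !(cImD, cReD, cImM, cReM).
rewrite !(cReJ, cImJ) /= !Im0 => h1 h2.
by apply: complex_eqP; rewrite ?cReJ ?cImJ; lra.
Qed.

(** For small eps > 0, A + eps is a positive multiple of Q Q for a symmetric Q, and
    tau (Q Q S) = tau (Q S Q), where Q S Q is positive. *)
Lemma phi_positive A : bounded_op A -> positive_op dot A -> 0 <= phi A.
Proof.
move=> bA A0; have [M M0 [lA hA]] := bounded_norm_le bA.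
have sA := positive_symmetric lA A0.
have S_pos : positive_op dot S by exact: diag_positive.
have step (eps : R) : 0 < eps -> 0 <= phi A + eps%:C%C.
  (* For this t, X = 1 - t (A + eps) is a strict contraction. *)
  move=> eps0; pose M' := M + eps + 1; pose t := eps / M' ^+ 2.
  have M'0 : 0 < M' by rewrite /M'; lra.
  have M'2 : 0 < M' ^+ 2 by rewrite exprn_gt0.
  have t0 : 0 < t by rewrite divr_gt0.
  have tM : t * M' ^+ 2 = eps by rewrite divfK// gt_eqF.
  pose P := A + eps%:C%C *: (id : H -> H).
  have PE x : P x = A x + eps%:C%C *: x by [].
  have [lP hP] : norm_le M' P.
    apply: (norm_le_le _ (norm_le_add (conj lA hA : norm_le M A) (norm_le_scale eps%:C%C (@norm_le_id R H)))).
    by rewrite cmodR gtr0_norm// /M'; lra.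
  have sP : symmetric dot P.
    by move=> x y; rewrite !PE dotDl dotDr sA dotZl dotZr conjRC.
  have Pge x : eps * hnorm x ^+ 2 <= complex.Re (dot (P x) x).
    rewrite PE dotDl dotZl cReD ReRM (dotxx hdot) /=.
    by have := A0 x; rewrite lecE /= => /andP[_]; lra.
  pose r := Num.sqrt (1 - t * eps).
  have te1 : t * eps < 1.
    rewrite -(ltr_pM2r M'2) mul1r mulrAC tM.
    have : eps < M' by rewrite /M'; lra.
    by move: eps0; nra.
  have r2 : r ^+ 2 = 1 - t * eps by rewrite sqr_sqrtr; lra.
  have r01 : 0 < r < 1.
    rewrite sqrtr_gt0 subr_gt0 te1 /=.
    rewrite -(ltr_pXn2r (n:=2)) ?nnegrE ?sqrtr_ge0// r2 expr1n.
    by rewrite gtrBl mulr_gt0.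
  pose X := id - t%:C%C *: P.
  have XE x : X x = x - t%:C%C *: P x by [].
  have hX : norm_le r X.
    split=> [a x y|x]; first by rewrite !XE lP scalerDr scalerBr opprD addrACA !scalerA (mulrC a).
    have r0 : 0 <= r by case/andP: r01 => /ltW.
    rewrite -(ler_pXn2r (n:=2)) ?nnegrE ?mulr_ge0 ?hnorm_ge0//.
    rewrite XE (hnormB_sqr hdot) hnormZ cmodR gtr0_norm// dotZr conjRC ReRM -(cReJ (dot x _)) -dotC.
    rewrite [X in _ <= X]exprMn r2.
    have h1 := Pge x; have h2 : hnorm (P x) ^+ 2 <= M' ^+ 2 * hnorm x ^+ 2.
      by rewrite -exprMn lerXn2r ?nnegrE ?mulr_ge0 ?hnorm_ge0 ?(ltW M'0).
    have h3 := ler_wpM2l (ltW t0) h1.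
    have h4 : t * (t * hnorm (P x) ^+ 2) <= t * (eps * hnorm x ^+ 2).
      by rewrite ler_wpM2l ?(ltW t0)// -tM -mulrA ler_wpM2l ?(ltW t0).
    have -> : (t * hnorm (P x)) ^+ 2 = t * (t * hnorm (P x) ^+ 2) by ring.
    lra.
  have sX : symmetric dot X by move=> x y; rewrite !XE dotBl dotBr dotZl dotZr conjRC sP.
  have [Q [bQ sQ QQ _]] := sqrt_one_minus hdot r01 hX sX.
  have -> : phi A + eps%:C%C = t^-1%:C%C * phi (Q \o Q).
    have -> : Q \o Q = t%:C%C *: P.
      by apply/funext => x; rewrite fctE /= QQ XE opprB addrC subrK.
    have bI := @bounded_id R H.
    rewrite phiZ; last by apply: bounded_add => //; exact: bounded_scale.
    rewrite mulrA -rmorphM mulVf ?gt_eqF// rmorph1 mul1r /P phiD//; last exact: bounded_scale.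
    by rewrite phiZ// phi_id mulr1.
  have JQSQ : J (Q \o S \o Q) by apply: JR => //; exact: JL.
  rewrite mulr_ge0//; first by rewrite ler0c invr_ge0 ltW.
  rewrite -phi_rotate//; case: htau => _ h _ _; apply: h => // x /=.
  by rewrite sQ.
have h1 (eps : R) : 0 < eps -> - complex.Re (phi A) <= 0 + eps.
  by move=> eps0; have := step eps eps0; rewrite lecE cReD /= => /andP[_]; lra.
rewrite lecE; apply/andP; split.
  by have := step 1 ltr01; rewrite lecE cImD /= addr0 => /andP[].
by have := le_eps h1; rewrite /=; lra.
Qed.

(** Both M + A and M - A are positive. *)
Lemma phi_bound_symmetric A M : 0 <= M -> norm_le M A -> symmetric dot A -> cmod (phi A) <= M.
Proof.
move=> M0 hA sA; have bA := norm_le_bounded M0 hA; have bI := @bounded_id R H.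
have Re_le x : `|complex.Re (dot (A x) x)| <= M * hnorm x ^+ 2.
  apply: (le_trans (Re_dot_le hdot _ _)); rewrite expr2 mulrA ler_wpM2r ?hnorm_ge0//.
  by case: hA => _; apply.
have Im0 x : complex.Im (dot (A x) x) = 0.
  have : dot (A x) x = (dot (A x) x)^* by rewrite -dotC sA.
  by move=> /(congr1 (fun z => complex.Im z)); rewrite cImJ; lra.
have key (c : R) : `|c| = 1 -> 0 <= M%:C%C + c%:C%C * phi A.
  move=> c1; have bM : bounded_op (M%:C%C *: (id : H -> H)) by exact: bounded_scale.
  have bcA : bounded_op (c%:C%C *: A) by exact: bounded_scale.
  have -> : M%:C%C + c%:C%C * phi A = phi (M%:C%C *: (id : H -> H) + c%:C%C *: A).
    by rewrite phiD// !phiZ// phi_id mulr1.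
  apply: phi_positive; first exact: bounded_add.
  move=> x; rewrite !fctE dotDl !dotZl (dotxx hdot) lecE cImD ImRM ImRM Im0 /= !mulr0 addr0 eqxx /=.
  rewrite cReD !ReRM /=; have := Re_le x.
  have : `|c * complex.Re (dot (A x) x)| = `|complex.Re (dot (A x) x)| by rewrite normrM c1 mul1r.
  move=> <-; rewrite ler_norml => /andP[]; lra.
have := key 1 (normr1 _); have := key (-1) ltac:(by rewrite normrN normr1).
rewrite !lecE !cImD !cReD !ReRM !ImRM /= => /andP[/eqP i1 r1] /andP[_ r2].
have i0 : complex.Im (phi A) = 0 by lra.
rewrite -(ler_pXn2r (n:=2)) ?nnegrE ?cmod_ge0// cmod_sqr i0.
nra.
Qed.

Lemma phi_bound A M : 0 <= M -> norm_le M A -> cmod (phi A) <= 2 * M.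
Proof.
move=> M0 hA; have [A1 [A2 [h1 h2 s1 s2 ->]]] := symmetric_parts M0 hA.
have b1 := norm_le_bounded M0 h1; have b2 := norm_le_bounded M0 h2.
rewrite phiD//; last exact: bounded_scale.
rewrite phiZ//; apply: (le_trans (cmodD _ _)); rewrite cmodM.
have -> : cmod ('i%C : R[i]) = 1.
  by apply/eqP; rewrite -(@eqrXn2 _ 2) ?cmod_ge0// cmod_sqr /= !expr0n add0r.
have := phi_bound_symmetric M0 h1 s1; have := phi_bound_symmetric M0 h2 s2; lra.
Qed.

Lemma rank1_mem u v : J (rank1 dot u v).
Proof.
have -> : rank1 dot u v = (s 0%N)^-1%:C%C *: (rank1 dot u (e 0%N) \o S \o rank1 dot (e 0%N) v).
  apply/funext => x; change (dot x v *: u = (s 0%N)^-1%:C%C *: (dot (S (dot x v *: e 0%N)) (e 0%N) *: u)).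
  rewrite Sc dotZl oe eqxx mulr1 scalerA mulrA -rmorphM.
  by rewrite mulVf ?gt_eqF// rmorph1 mul1r.
exact: (JZ _ (JR (rank1_bounded hdot _ _) (JL (rank1_bounded hdot _ _) JS))).
Qed.

Lemma tau_rank1_diag u : tau (rank1 dot u u) = 0.
Proof.
have [->|u0] := eqVneq u 0.
  have -> : rank1 dot 0 0 = 0 by apply/funext => x; rewrite /rank1 scaler0.
  exact: tau_0.
have up := hnorm_gt0 u0; pose w := (hnorm u)^-1%:C%C *: u.
have ww : dot w w = 1.
  rewrite (dotxx hdot) hnormZ cmodR ger0_norm ?invr_ge0 ?hnorm_ge0// mulVf ?gt_eqF//.
  by rewrite expr1n.
have -> : rank1 dot u u = (hnorm u ^+ 2)%:C%C *: rank1 dot w w.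
  apply/funext => x; rewrite fctE /rank1 /w dotZr conjRC !scalerA; congr (_ *: _).
  rewrite mulrA mulrAC -!rmorphM (_ : _ * _ * _ = 1) ?rmorph1 ?mul1r//.
  by field; rewrite gt_eqF.
rewrite tauZ; last exact: rank1_mem.
clearbody w; case: htau => _ _ _ ->; rewrite ?mulr0//; first exact: rank1_mem.
have bw : bounded_op (rank1 dot w w) by exact: (rank1_bounded hdot).
split=> //.
- by move=> x; rewrite /= /rank1 dotZl ww mulr1.
- move=> x; rewrite (adjoint_unique hdot oe te bw (S := rank1 dot w w))// => y z.
  by rewrite /rank1 dotZl dotZr (dotC _ w z) mulrC.
- exists 1%N, (fun=> w) => x; exists (fun=> dot x w); rewrite big_ord1; exact: erefl.
Qed.

(** Polarization of the case u = v, where the operator is a multiple of a projection. *)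
Lemma tau_rank1 u v : tau (rank1 dot u v) = 0.
Proof.
have pol (c : R[i]) : c * tau (rank1 dot v u) + c^* * tau (rank1 dot u v) = 0.
  have := tau_rank1_diag (u + c *: v).
  have -> : rank1 dot (u + c *: v) (u + c *: v) = c *: rank1 dot v u +
     (c^* *: rank1 dot u v + (rank1 dot u u + (c * c^*) *: rank1 dot v v)).
    apply/funext => x; rewrite !fctE /rank1; apply: (dot_ext hdot) => w.
    by rewrite !(dotDl, dotZl) dotDr dotZr; ring.
  have j1 := rank1_mem u u; have j2 := JZ (c * c^*) (rank1_mem v v).
  have j3 := rank1_mem u v.
  rewrite (tau_lin _ (rank1_mem v u) (JD (JZ _ j3) (JD j1 j2))).
  rewrite (tau_lin _ j3 (JD j1 j2)) (tauD j1 j2) (tauZ _ (rank1_mem v v)) !tau_rank1_diag.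
  by rewrite mulr0 !addr0.
have := pol 1; have := pol 'i%C; rewrite conjiC rmorph1 !mul1r mulNr -mulrBr => /eqP.
rewrite mulf_eq0 => /orP[/eqP i0|/eqP].
  by have := mulii; rewrite i0 mul0r => /eqP; rewrite eq_sym oppr_eq0 oner_eq0.
move=> /eqP; rewrite subr_eq0 => /eqP -> /eqP; rewrite -mulr2n mulrn_eq0 /= => /eqP.
by [].
Qed.

Lemma tau_proj X Y n : bounded_op X -> bounded_op Y -> tau (X \o proj dot e n \o Y) = 0.
Proof.
move=> bX bY; have lX := bounded_lin bX.
have -> : X \o proj dot e n \o Y = \sum_(i < n) rank1 dot (X (e i)) (adjoint dot Y (e i)).
  apply/funext => x; rewrite fct_sumE /= /proj (lin_sum lX); apply: eq_bigr => i _.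
  by rewrite (linZ lX) /rank1 -adjP.
have [] : J (\sum_(i < n) rank1 dot (X (e i)) (adjoint dot Y (e i))) /\
    tau (\sum_(i < n) rank1 dot (X (e i)) (adjoint dot Y (e i))) = 0; last by [].
apply: (big_ind (fun Z => J Z /\ tau Z = 0)) => [|Z1 Z2 [j1 t1] [j2 t2]|i _].
- by split; [exact: J0|exact: tau_0].
- by split; [exact: JD|rewrite tauD// t1 t2 addr0].
- by split; [exact: rank1_mem|exact: tau_rank1].
Qed.

End SingularTraces.

(** * Off-diagonal decay of operators with bounded commutator *)

Section Blocks.
Context {R : realType} {H : completeNormedModType R[i]}.
Context (dot : {dot H for conjC}) (hdot : hilbert_dot dot).
Context (e : nat -> H).
Hypothesis oe : forall i j, dot (e i) (e j) = (i == j)%:R.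
Hypothesis te : forall x, (forall i, dot x (e i) = 0) -> x = 0.

Definition indicator (P : pred nat) : H -> H := diag dot e (fun n => (P n)%:R).

Lemma indicator_bound (P : pred nat) n : cmod ((P n)%:R : R[i]) <= 1.
Proof.
by rewrite -(rmorph_nat (real_complex R)) cmodR ger0_norm ?ler0n//; case: (P n); rewrite ?ler01.
Qed.

Lemma indicator_coef P x i : dot (indicator P x) (e i) = (P i)%:R * dot x (e i).
Proof. exact: (diag_coef hdot oe te (@indicator_bound P)). Qed.

Lemma indicator_norm_le P : norm_le 1 (indicator P).
Proof.
by split; [exact: (diag_lin hdot oe te (@indicator_bound P))|exact: (diag_norm hdot oe te (@indicator_bound P))].
Qed.

Lemma indicator_norm P x : hnorm (indicator P x) <= hnorm x.
Proof. by have [_ h] := indicator_norm_le P; rewrite -[leRHS]mul1r. Qed.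

Lemma indicator_lin P : linear (indicator P).
Proof. by case: (indicator_norm_le P). Qed.

Lemma indicator_e P n : indicator P (e n) = (P n)%:R *: e n.
Proof. exact: (diag_e hdot oe te (@indicator_bound P)). Qed.

Context (dl : nat -> R) (dl0 : forall n, dl n != 0).
Context (T : H -> H) (Tc : forall x i, dot (T x) (e i) = (dl i)^-1%:C%C * dot x (e i)).
Context (a : H -> H) (Ma : R) (Ma0 : 0 <= Ma) (ha : norm_le Ma a).
Context (c : H -> H) (C : R) (C0 : 0 <= C) (hc : forall x, hnorm (c x) <= C * hnorm (T x)).
Context (comm : forall x, a (T x) = T (a x + c x)).

Section Gap.
Context (al be : R) (al0 : 0 < al) (ab : al < be) (P Q : pred nat).
Hypothesis (hP : forall n, P n -> be <= `|dl n|) (hQ : forall n, Q n -> `|dl n| <= al).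

Let be0 : 0 < be. Proof. exact: lt_trans ab. Qed.

Let up := diag dot e (fun n => if Q n then (dl n)%:C%C else 0).
Let down := diag dot e (fun n => if P n then (dl n)^-1%:C%C else 0).

Let up_bound n : cmod (if Q n then (dl n)%:C%C else 0) <= al.
Proof. by case: ifP => [/hQ|_]; [rewrite cmodR|rewrite cmod0 ltW]. Qed.

Let down_bound n : cmod (if P n then (dl n)^-1%:C%C else 0) <= be^-1.
Proof.
case: ifP => [/hP h|_]; last by rewrite cmod0 invr_ge0 ltW.
by rewrite cmodR normfV lef_pV2 ?posrE ?normr_gt0.
Qed.

Let up_coef x i : dot (up x) (e i) = (if Q i then (dl i)%:C%C else 0) * dot x (e i).
Proof. exact: (diag_coef hdot oe te up_bound). Qed.
Let down_coef x i : dot (down x) (e i) = (if P i then (dl i)^-1%:C%C else 0) * dot x (e i).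
Proof. exact: (diag_coef hdot oe te down_bound). Qed.

Let dlV i : (dl i)^-1%:C%C * (dl i)%:C%C = 1 :> R[i].
Proof. by rewrite -rmorphM mulVf// rmorph1. Qed.

Let K := C / (be - al).
Let rho := al / be.

Let rho01 : 0 < rho < 1.
Proof. by rewrite divr_gt0//= ltr_pdivrMr// mul1r. Qed.

Let Kstep B : (al * (K + B) + C) / be = K + B * rho.
Proof.
rewrite /K /rho; field; rewrite gt_eqF//= subr_eq0 gt_eqF//.
Qed.

Let finish (f : H -> R) : (forall j x, f x <= (K + Ma * rho ^+ j) * hnorm x) -> forall x, f x <= K * hnorm x.
Proof.
move=> h x; rewrite -subr_le0; apply: (geometric_le0 rho01 (K := Ma * hnorm x)) => j.
by rewrite lerBlDl; apply: (le_trans (h j x)); rewrite mulrDl (mulrAC Ma).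
Qed.

(** Let x be in the range of Q and x = T y. Then a x = T (a y + c y), where |y| <= al |x|
    and T has norm 1 / be on the range of P. So a bound B on P a Q improves to
    (al B + C) / be. Iterated from B = Ma, this tends to the fixed point
    C / (be - al). *)
Lemma gap_up x : hnorm (indicator P (a (indicator Q x))) <= C / (be - al) * hnorm x.
Proof.
have [la na] := ha; move: x; apply: finish; elim=> [|j IH] x.
  rewrite expr0 mulr1 mulrDl; apply: (le_trans (indicator_norm _ _)).
  apply: (le_trans (na _)); have := ler_wpM2l Ma0 (indicator_norm Q x).
  suff : 0 <= K * hnorm x by lra.
  by rewrite mulr_ge0 ?hnorm_ge0// divr_ge0// subr_ge0 ltW.
pose y := up x.
have Ty : T y = indicator Q x.
  apply: (coef_ext te) => i; rewrite Tc up_coef indicator_coef; case: ifP => _; last by rewrite !mul0r mulr0.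
  by rewrite mulrA dlV.
have Qy : indicator Q y = y.
  by apply: (coef_ext te) => i; rewrite indicator_coef up_coef; case: ifP => _; rewrite ?mul1r// !mul0r.
have PT z : indicator P (T z) = down (indicator P z).
  apply: (coef_ext te) => i; rewrite indicator_coef Tc down_coef indicator_coef.
  by case: ifP => _; rewrite ?mul1r// !mul0r.
rewrite -Ty comm PT (linD (indicator_lin P)).
apply: (le_trans (diag_norm hdot oe te down_bound _)).
have hy : hnorm y <= al * hnorm x := diag_norm hdot oe te up_bound x.
have h1 : hnorm (indicator P (a y)) <= (K + Ma * rho ^+ j) * (al * hnorm x).
  rewrite -Qy; apply: (le_trans (IH _)); apply: ler_wpM2l => //.
  have r0 : 0 <= rho ^+ j by rewrite exprn_ge0// ltW//; case/andP: rho01.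
  by apply: addr_ge0; [rewrite divr_ge0// subr_ge0 ltW|rewrite mulr_ge0].
have h2 : hnorm (indicator P (c y)) <= C * hnorm x.
  apply: (le_trans (indicator_norm _ _)); apply: (le_trans (hc _)); rewrite Ty.
  by apply: ler_wpM2l => //; exact: indicator_norm.
have -> : K + Ma * rho ^+ j.+1 = (al * (K + Ma * rho ^+ j) + C) / be by rewrite Kstep exprSr mulrA.
rewrite [leRHS]mulrAC mulrC; apply: ler_wpM2r; first by rewrite invr_ge0 ltW.
apply: (le_trans (hnormD _ _)); apply: (le_trans (lerD h1 h2)).
by rewrite le_eqVlt; apply/orP; left; apply/eqP; ring.
Qed.

(** The same iteration: for x in the range of P, Q a x = D (Q a T x) - Q c x, where
    |T x| <= |x| / be and D, the inverse of T, has norm at most al on the range of Q. *)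
Lemma gap_down x : hnorm (indicator Q (a (indicator P x))) <= C / (be - al) * hnorm x.
Proof.
have [la na] := ha; move: x; apply: finish; elim=> [|j IH] x.
  rewrite expr0 mulr1 mulrDl; apply: (le_trans (indicator_norm _ _)).
  apply: (le_trans (na _)); have := ler_wpM2l Ma0 (indicator_norm P x).
  suff : 0 <= K * hnorm x by lra.
  by rewrite mulr_ge0 ?hnorm_ge0// divr_ge0// subr_ge0 ltW.
pose y := indicator P x.
have Ty : T y = down x.
  apply: (coef_ext te) => i; rewrite Tc indicator_coef down_coef.
  by case: ifP => _; rewrite ?mul1r// !mul0r mulr0.
have PTy : indicator P (T y) = T y.
  by apply: (coef_ext te) => i; rewrite indicator_coef Ty down_coef; case: ifP => _; rewrite ?mul1r// !mul0r.
have nTy : hnorm (T y) <= be^-1 * hnorm x by rewrite Ty; exact: (diag_norm hdot oe te down_bound).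
have E : indicator Q (a y) = up (indicator Q (a (indicator P (T y)))) - indicator Q (c y).
  rewrite PTy comm; apply: (coef_ext te) => i.
  rewrite dotBl up_coef !indicator_coef Tc dotDl; case: ifP => _; last by rewrite !mul0r subr0.
  by rewrite !mul1r mulrA (mulrC (dl i)%:C%C) dlV mul1r addrK.
rewrite E; apply: (le_trans (hnormB _ _)).
have h1 : hnorm (up (indicator Q (a (indicator P (T y))))) <= al * ((K + Ma * rho ^+ j) * (be^-1 * hnorm x)).
  apply: (le_trans (diag_norm hdot oe te up_bound _)); apply: ler_wpM2l; first exact: ltW.
  apply: (le_trans (IH _)); apply: ler_wpM2l => //.
  have r0 : 0 <= rho ^+ j by rewrite exprn_ge0// ltW//; case/andP: rho01.
  by apply: addr_ge0; [rewrite divr_ge0// subr_ge0 ltW|rewrite mulr_ge0].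
have h2 : hnorm (indicator Q (c y)) <= C * (be^-1 * hnorm x).
  apply: (le_trans (indicator_norm _ _)); apply: (le_trans (hc _)).
  exact: ler_wpM2l.
apply: (le_trans (lerD h1 h2)).
have -> : K + Ma * rho ^+ j.+1 = (al * (K + Ma * rho ^+ j) + C) / be by rewrite Kstep exprSr mulrA.
by rewrite le_eqVlt; apply/orP; left; apply/eqP; ring.
Qed.

End Gap.

(** A coefficient of the sum will always come from a single term, which is what the
    last clause is for. *)
Lemma op_series (F : nat -> H -> H) (c0 rho : R) : 0 <= c0 -> 0 < rho < 1 ->
  (forall l, norm_le (c0 * rho ^+ l) (F l)) ->
  exists Z : H -> H, [/\ norm_le (c0 / (1 - rho)) Z,
    forall N, norm_le (c0 / (1 - rho) * rho ^+ N) (Z - \sum_(l < N) F l) &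
    forall n m l0 z, (forall l, dot (F l (e n)) (e m) = if l == l0 then z else 0) ->
      dot (Z (e n)) (e m) = z].
Proof.
move=> c00 r01 hF; pose Y N := \sum_(l < N) F l.
have bF l : linear (F l) by case: (hF l).
have lY N : linear (Y N).
  move=> b x y; rewrite /Y !fct_sumE scaler_sumr -big_split /=; apply: eq_bigr => l _.
  exact: bF.
have dY n x : hnorm (Y n.+1 x - Y n x) <= c0 * rho ^+ n * hnorm x.
  have -> : Y n.+1 x = Y n x + F n x by rewrite /Y big_ord_recr.
  by rewrite addrC addKr; case: (hF n) => _; apply.
have [Z [lZ hZ]] := operator_limit hdot c00 r01 lY dY.
exists Z; split.
- split=> // x; have := hZ 0%N x.
  by rewrite /Y big_ord0 subr0 expr0 mulr1.
- move=> N; split=> [b x y|x]; last exact: hZ.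
  by rewrite !fctE -[(\sum_(l < N) F l) _]/(Y N (b *: x + y)) lY lZ scalerBr opprD addrACA.
move=> n m l0 z hz.
apply/eqP; rewrite -subr_eq0; apply/eqP/cmod_eq0/eqP; rewrite eq_le cmod_ge0 andbT.
apply: (geometric_le0 r01 (K := c0 / (1 - rho) * rho ^+ l0.+1)) => j.
have -> : z = dot (Y (l0.+1 + j)%N (e n)) (e m).
  rewrite /Y fct_sumE dot_suml (eq_bigr (fun l : 'I__ => if (l : nat) == l0 then z else 0)) => [|l _]; last exact: hz.
  rewrite (bigD1 (Ordinal (leq_addr j l0.+1 : (l0 < l0.+1 + j)%N)))//= eqxx big1 ?addr0// => l.
  by rewrite -val_eqE /= => /negPf ->.
rewrite -dotBl -mulrA -exprD; apply: (le_trans (coef_bound hdot oe _ _)).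
by apply: (le_trans (hZ _ _)); rewrite (hnorm_basis hdot oe) mulr1.
Qed.

Context (kap : nat -> nat) (La q : R) (La0 : 0 < La) (q1 : 1 < q).
(* kap n is the level of dl n; level 0 contains all the small eigenvalues. *)
Hypothesis kap_up : forall n, `|dl n| < La * q ^+ (kap n).+1.
Hypothesis kap_lo : forall n, (0 < kap n)%N -> La * q ^+ kap n <= `|dl n|.
Hypothesis kap_oo : forall l, exists M, forall n, (M <= n)%N -> (l < kap n)%N.
Hypothesis small : C / (La * (q - 1)) / (1 - q^-1) <= 1.

Let q0 : 0 < q. Proof. exact: lt_trans q1. Qed.
Let qV01 : 0 < q^-1 < 1. Proof. by rewrite invr_gt0 q0 invf_lt1. Qed.
Let c0 := C / (La * (q - 1)).
Let c00 : 0 <= c0.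
Proof. by rewrite divr_ge0// mulr_ge0 ?(ltW La0)// subr_ge0 ltW. Qed.

Let gap_const l : C / (La * q ^+ l.+2 - La * q ^+ l.+1) <= c0 * q^-1 ^+ l.
Proof.
have ql : 0 < q ^+ l by rewrite exprn_gt0.
have -> : C / (La * q ^+ l.+2 - La * q ^+ l.+1) = c0 * q^-1 ^+ l * q^-1.
  have h1 : q - 1 != 0 by rewrite subr_eq0 gt_eqF.
  have h2 : La * (q * (q * q ^+ l)) - La * (q * q ^+ l) != 0.
    rewrite (_ : _ - _ = La * (q - 1) * (q * q ^+ l)); last by ring.
    by rewrite !mulf_neq0// gt_eqF.
  by rewrite /c0 !exprS exprVn; field; rewrite h1 h2 !gt_eqF.
rewrite ler_piMr//; last by case/andP: qV01 => _ /ltW.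
by rewrite mulr_ge0// exprn_ge0// ltW//; case/andP: qV01.
Qed.

Let hgap l : 0 < La * q ^+ l.+1 /\ La * q ^+ l.+1 < La * q ^+ l.+2.
Proof.
split; first by rewrite mulr_gt0// exprn_gt0.
by rewrite ltr_pM2l// [X in _ < X]exprS ltr_pMl// exprn_gt0.
Qed.

Let hPl l n : (l.+2 <= kap n)%N -> La * q ^+ l.+2 <= `|dl n|.
Proof.
move=> lk; apply: (le_trans _ (kap_lo (leq_trans _ lk)))=> //.
by rewrite ler_pM2l// ler_weXn2l// ltW.
Qed.

Let hQl l n : kap n == l -> `|dl n| <= La * q ^+ l.+1.
Proof. by move=> /eqP <-; rewrite ltW. Qed.

(** U collects the blocks of a that raise the level by at least 2, and V those that
    lower it by at least 2. Levels that are not adjacent are separated by a gap, which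
    makes these blocks geometrically small; finitely many of them have finite rank,
    because each level is finite. *)
Lemma near_diagonal : exists nu U V : H -> H,
  [/\ a = nu + (U + V), norm_le (Ma + 2) nu,
    forall m n, ~~ ((kap m <= (kap n).+1) && (kap n <= (kap m).+1))%N -> dot (nu (e n)) (e m) = 0,
    (norm_le 1 U /\ forall eps : R, 0 < eps -> exists X M, bounded_op X /\ norm_le eps (U - (X \o proj dot e M))) &
    (norm_le 1 V /\ forall eps : R, 0 < eps -> exists X M, bounded_op X /\ norm_le eps (V - (proj dot e M \o X)))].
Proof.
have [la na] := ha.
pose far l := indicator (fun n => l.+2 <= kap n)%N.
pose blk l := indicator (fun n => kap n == l).
have nbl X l : linear X -> (forall x, hnorm (X x) <= C / (La * q ^+ l.+2 - La * q ^+ l.+1) * hnorm x) ->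
    norm_le (c0 * q^-1 ^+ l) X.
  move=> lX hX; by split=> // x; apply: (le_trans (hX x)); rewrite ler_wpM2r ?hnorm_ge0// gap_const.
have lc P Q : linear (indicator P \o a \o indicator Q).
  by move=> b x y /=; rewrite (indicator_lin Q) la (indicator_lin P).
have hF l : norm_le (c0 * q^-1 ^+ l) (far l \o a \o blk l).
  have [g1 g2] := hgap l; apply: nbl; first exact: lc.
  by move=> x; apply: gap_up => //; [exact: hPl|exact: hQl].
have hG l : norm_le (c0 * q^-1 ^+ l) (blk l \o a \o far l).
  have [g1 g2] := hgap l; apply: nbl; first exact: lc.
  by move=> x; apply: gap_down => //; [exact: hPl|exact: hQl].
have [U [nU hU cU]] := op_series c00 qV01 hF.
have [V [nV hV cV]] := op_series c00 qV01 hG.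
have {}nU : norm_le 1 U := norm_le_le small nU.
have {}nV : norm_le 1 V := norm_le_le small nV.
have Uc n m : dot (U (e n)) (e m) = ((kap n).+2 <= kap m)%N%:R * dot (a (e n)) (e m).
  apply: (cU n m (kap n)) => l; rewrite /= /far /blk indicator_coef indicator_e (linZ la) dotZl eq_sym.
  by case: eqVneq => [->|_]; rewrite ?mul1r// mul0r mulr0.
have Vc n m : dot (V (e n)) (e m) = ((kap m).+2 <= kap n)%N%:R * dot (a (e n)) (e m).
  apply: (cV n m (kap m)) => l; rewrite /= /far /blk indicator_coef indicator_e (linZ la) dotZl [l == _]eq_sym.
  by case: eqVneq => [->|_]; rewrite ?mul1r// mul0r.
have bsum F N : (forall l, norm_le (c0 * q^-1 ^+ l) (F l)) -> bounded_op (\sum_(l < N) F l : H -> H).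
  move=> hX; apply: (@norm_le_bounded _ _ (N%:R * c0)); first by rewrite mulr_ge0.
  have /andP[/ltW qV0 /ltW qV1] := qV01.
  by apply: norm_le_sum => l; apply: norm_le_le (hX l); rewrite ler_piMr// exprn_ile1.
have tail (eps : R) : 0 < eps -> exists N M, c0 / (1 - q^-1) * q^-1 ^+ N <= eps /\
    forall n, (M <= n)%N -> (N < kap n)%N.
  move=> eps0; have [N hN] := expr_unbounded (c0 / (1 - q^-1) / eps) q1.
  have [M hM] := kap_oo N; exists N, M; split=> //.
  by rewrite exprVn ler_pdivrMr ?exprn_gt0// [eps * _]mulrC -ler_pdivrMr// ltW// hN.
exists (a - (U + V)), U, V; split.
- by rewrite subrK.
- by apply: norm_le_sub => //; exact: norm_le_add.
- move=> m n nmn; rewrite !fctE dotBl dotDl Uc Vc -mulrDl -[X in X - _]mul1r -mulrBl.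
  suff -> : 1 - (((kap n).+2 <= kap m)%N%:R + ((kap m).+2 <= kap n)%N%:R) = 0 :> R[i] by rewrite mul0r.
  move: nmn; rewrite negb_and -!ltnNge => /orP[h|h]; rewrite h.
    by rewrite (_ : (kap m).+2 <= kap n = false)%N ?addr0 ?subrr//; apply/negP; move: h; clear; lia.
  by rewrite (_ : (kap n).+2 <= kap m = false)%N ?add0r ?subrr//; apply/negP; move: h; clear; lia.
- split=> // eps /tail[N [M [Neps hM]]].
  exists (\sum_(l < N) (far l \o a \o blk l)), M; split; first exact: bsum hF.
  have -> : (\sum_(l < N) (far l \o a \o blk l)) \o proj dot e M = \sum_(l < N) (far l \o a \o blk l).
    apply/funext => x; rewrite /= !fct_sumE; apply: eq_bigr => l _ /=.
    suff -> : blk l (proj dot e M x) = blk l x by [].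
    apply: (coef_ext te) => i; rewrite !indicator_coef; case: eqVneq => [kl|]; last by rewrite !mul0r.
    rewrite !mul1r (coef_proj oe); case: ltnP => [_|/hM]; first by rewrite mul1r.
    by rewrite kl ltnNge ltnW.
  exact: norm_le_le Neps (hU N).
- split=> // eps /tail[N [M [Neps hM]]].
  exists (\sum_(l < N) (blk l \o a \o far l)), M; split; first exact: bsum hG.
  have -> : proj dot e M \o (\sum_(l < N) (blk l \o a \o far l)) = \sum_(l < N) (blk l \o a \o far l).
    apply/funext => x; rewrite /= !fct_sumE (lin_sum (@proj_lin _ _ dot e M)); apply: eq_bigr => l _ /=.
    apply: (coef_ext te) => i; rewrite (coef_proj oe); have [iM|Mi] := ltnP i M; first by rewrite mul1r.
    have kl : (kap i == l) = false.
      by apply/negP => /eqP kl; have := hM i Mi; rewrite kl ltnNge ltnW.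
    by rewrite indicator_coef kl !mul0r.
  exact: norm_le_le Neps (hV N).
Qed.

End Blocks.

(** * The trace property *)

Section Commutators.
Context {R : realType} {H : completeNormedModType R[i]}.
Context (dot : {dot H for conjC}) (hdot : hilbert_dot dot).
Context (e : nat -> H).
Hypothesis oe : forall i j, dot (e i) (e j) = (i == j)%:R.
Hypothesis te : forall x, (forall i, dot x (e i) = 0) -> x = 0.
Context (s : nat -> R) (s0 : forall n, 0 < s n) (sm : forall m n, (m <= n)%N -> s n <= s m).
Let S := diag dot e (fun n => (s n)%:C%C).
Let J := ideal_generated S.
Context (tau : (H -> H) -> R[i]) (htau : singular_trace dot J tau) (tau1 : tau S = 1).
Let phi := phi dot e s tau.

Let Sb n : cmod ((s n)%:C%C : R[i]) <= s 0%N.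
Proof. by apply: cmod_decr_bound => // m; exact: ltW. Qed.
Let bS : bounded_op S.
Proof. exact: (diag_bounded hdot oe te Sb). Qed.
Let phD X Y : bounded_op X -> bounded_op Y -> phi (X + Y) = phi X + phi Y.
Proof. exact: phiD. Qed.
Let phB X Y : bounded_op X -> bounded_op Y -> phi (X - Y) = phi X - phi Y.
Proof. exact: phiB. Qed.
Let ph_bound X M : 0 <= M -> norm_le M X -> cmod (phi X) <= 2 * M.
Proof. exact: (phi_bound hdot oe te s0 sm htau tau1). Qed.

Lemma phi_limit0 Z : bounded_op Z -> (forall eps : R, 0 < eps -> exists Y,
  [/\ bounded_op Y, phi Y = 0 & norm_le eps (Z - Y)]) -> phi Z = 0.
Proof.
move=> bZ h; apply/cmod_eq0/eqP; rewrite eq_le cmod_ge0 andbT; apply: le_eps => eps eps0.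
have [Y [bY Y0 hY]] := h (eps / 2) (divr_gt0 eps0 (ltr0n _ 2)).
rewrite add0r -[phi Z]subr0 -Y0 -phB//.
by apply: (le_trans (ph_bound _ hY)); lra.
Qed.

Lemma phi_proj X Y n : bounded_op X -> bounded_op Y -> phi (X \o proj dot e n \o Y) = 0.
Proof. by move=> bX bY; exact: (@tau_proj _ _ _ hdot _ oe te _ s0 sm _ htau X (Y \o S) n bX (bounded_comp bY bS)). Qed.

Let bproj n : bounded_op (proj dot e n).
Proof.
apply: (@norm_le_bounded _ _ 1) => //; split=> [c x y|x]; first exact: proj_lin.
by rewrite mul1r; exact: (hnorm_proj_le hdot _ (basis_orthn oe n)).
Qed.

(** phi is continuous and vanishes on finite rank operators. *)
Lemma phi_finite_limit X Y Z : bounded_op X -> bounded_op Y -> bounded_op Z ->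
  (forall eps : R, 0 < eps -> exists Z1 Z2 M, [/\ bounded_op Z1, bounded_op Z2 &
     norm_le eps (Z - (Z1 \o proj dot e M \o Z2))]) ->
  phi (X \o Z \o Y) = 0.
Proof.
move=> bX bY bZ h; have [Mx Mx0 hX] := bounded_norm_le bX; have [My My0 hY] := bounded_norm_le bY.
apply: phi_limit0; first by apply: bounded_comp => //; exact: bounded_comp.
move=> eps eps0; have K0 : 0 < Mx * My + 1 by rewrite ltr_wpDl// mulr_ge0.
have [Z1 [Z2 [M [b1 b2 hZ]]]] := h (eps / (Mx * My + 1)) (divr_gt0 eps0 K0).
exists ((X \o Z1) \o proj dot e M \o (Z2 \o Y)); split.
- by apply: bounded_comp (bounded_comp b2 bY); apply: bounded_comp (bproj _); exact: bounded_comp.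
- by apply: phi_proj; exact: bounded_comp.
- have -> : X \o Z \o Y - ((X \o Z1) \o proj dot e M \o (Z2 \o Y)) =
      X \o (Z - (Z1 \o proj dot e M \o Z2)) \o Y.
    by apply/funext => x; rewrite !fctE /= (linB (bounded_lin bX)).
  have q0 : 0 <= eps / (Mx * My + 1) by rewrite divr_ge0// ltW.
  apply: norm_le_le (norm_le_comp (mulr_ge0 Mx0 q0) (norm_le_comp Mx0 hX hZ) hY).
  rewrite mulrAC mulrA ler_pdivrMr// mulrC ler_wpM2l ?ltW//.
  by rewrite ltrDl.
Qed.

(** Finitely many entries of h contribute an operator of finite rank. *)
Lemma phi_diag_small X h (M0 : nat) (M B de : R) : 0 <= M -> 0 <= B -> 0 <= de -> norm_le M X ->
  (forall n, cmod (h n) <= B) -> (forall n, (M0 <= n)%N -> cmod (h n) <= de) ->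
  cmod (phi (X \o diag dot e h)) <= 2 * M * de.
Proof.
move=> M0' B0 de0 hX hB hde; have bX := norm_le_bounded M0' hX.
pose h' n := if (n < M0)%N then 0 else h n.
have h'B n : cmod (h' n) <= de.
  by rewrite /h'; case: ltnP => [_|/hde //]; rewrite cmod0.
have bh : bounded_op (diag dot e h) by exact: (diag_bounded hdot oe te hB).
have nh' : norm_le de (diag dot e h').
  by split; [exact: (diag_lin hdot oe te h'B)|exact: (diag_norm hdot oe te h'B)].
have bh' := norm_le_bounded de0 nh'.
have -> : X \o diag dot e h = X \o diag dot e h \o proj dot e M0 \o id + (X \o diag dot e h').
  apply/funext => x; rewrite !fctE -(linD (bounded_lin bX)); congr (X _).
  apply: (coef_ext te) => i; rewrite dotDl !(diag_coef hdot oe te hB, diag_coef hdot oe te h'B).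
  rewrite (coef_proj oe) /h'; case: ifP => _; first by rewrite mul0r mul1r addr0.
  by rewrite mul0r mulr0 add0r.
have b1 : bounded_op (X \o diag dot e h) by exact: bounded_comp.
have b2 : bounded_op (X \o diag dot e h \o proj dot e M0 \o id).
  by apply: bounded_comp; [exact: bounded_comp|exact: bounded_id].
rewrite phD//; last exact: bounded_comp.
rewrite phi_proj//; last exact: bounded_id.
by rewrite add0r -mulrA; apply: ph_bound; [exact: mulr_ge0|exact: norm_le_comp].
Qed.

Section Tridiagonal.
Context (kap : nat -> nat) (nu : H -> H) (M : R) (M0 : 0 <= M) (hnu : norm_le M nu).
Hypothesis tri : forall m n,
  ~~ ((kap m <= (kap n).+1) && (kap n <= (kap m).+1))%N -> dot (nu (e n)) (e m) = 0.

(* The rest modulo 3 separates the three block diagonals: up raises the level by 1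
   and down lowers it by 1. *)
Let res (r : nat) := indicator dot e (fun n => kap n %% 3 == r)%N.
Let up := \sum_(r < 3) (res (r.+1 %% 3)%N \o nu \o res r).
Let down := \sum_(r < 3) (res r \o nu \o res (r.+1 %% 3)%N).

Let res_nb r : norm_le 1 (res r). Proof. exact: (indicator_norm_le hdot oe te). Qed.

Let res_comp r r' : norm_le M (res r \o nu \o res r').
Proof. by rewrite -[M]mulr1 -[M]mul1r; apply: norm_le_comp => //; [rewrite mul1r|apply: norm_le_comp]. Qed.

Let res_coef r r' n m : dot ((res r \o nu \o res r') (e n)) (e m) =
  ((kap m %% 3 == r) && (kap n %% 3 == r'))%N%:R * dot (nu (e n)) (e m).
Proof.
have [lnu _] := hnu; rewrite /= /res (indicator_coef hdot oe te) (indicator_e hdot oe te) (linZ lnu) dotZl mulrA.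
by rewrite -natrM mulnb.
Qed.

Let up_nb : norm_le (3 * M) up. Proof. exact: (@norm_le_sum _ _ M 3). Qed.
Let down_nb : norm_le (3 * M) down. Proof. exact: (@norm_le_sum _ _ M 3). Qed.

Let up_coef n m : dot (up (e n)) (e m) = (kap m == (kap n).+1)%:R * dot (nu (e n)) (e m).
Proof.
rewrite /up fct_sumE dot_suml (eq_bigr _ (fun r _ => res_coef _ _ n m)) -mulr_suml.
have [|/negbTE h] := boolP ((kap m <= (kap n).+1) && (kap n <= (kap m).+1))%N; last first.
  by rewrite tri ?h// !mulr0.
move=> h; congr (_ * _); rewrite 3!big_ord_recl big_ord0 /= /bump /= !addn0 addr0.
rewrite -!natrD; congr (_%:R); move: h; clear; lia.
Qed.

Let down_coef n m : dot (down (e n)) (e m) = (kap n == (kap m).+1)%:R * dot (nu (e n)) (e m).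
Proof.
rewrite /down fct_sumE dot_suml (eq_bigr _ (fun r _ => res_coef _ _ n m)) -mulr_suml.
have [|/negbTE h] := boolP ((kap m <= (kap n).+1) && (kap n <= (kap m).+1))%N; last first.
  by rewrite tri ?h// !mulr0.
move=> h; congr (_ * _); rewrite 3!big_ord_recl big_ord0 /= /bump /= !addn0 addr0.
rewrite -!natrD; congr (_%:R); move: h; clear; lia.
Qed.

Context (g : nat -> R) (W de : R) (n0 : nat) (de0 : 0 < de) (de1 : de <= 1).
Hypothesis g01 : forall n, 0 <= g n <= 1 + de.
Hypothesis g1 : forall n, (n0 <= n)%N -> `|1 - g n| <= de.
Hypothesis gs : forall n, g n * s n = W / (1 + de) ^+ kap n.

Let t := (1 + de)^-1.
(* The sequence g n * s n depends on the level only, with ratio t between adjacent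
   levels; so diag (g s) nu = (nu + Th) diag (g s). *)
Let Th := (t - 1)%:C%C *: up + de%:C%C *: down.
Let h n : R[i] := (1 - g n)%:C%C.

Let Th_nb : norm_le (6 * M * de) Th.
Proof.
have dp : 0 < 1 + de by have d0 := de0; lra.
have t1 : cmod ((t - 1)%:C%C : R[i]) <= de.
  have tE : 1 - t = de * t by rewrite /t; field; rewrite gt_eqF.
  have tl : t <= 1 by rewrite invf_le1// lerDl ltW.
  rewrite cmodR distrC tE normrM !ger0_norm ?invr_ge0 ?(ltW dp) ?(ltW de0)//.
  by rewrite ler_piMr// ltW.
have t2 : cmod (de%:C%C : R[i]) = de by rewrite cmodR gtr0_norm.
apply: (norm_le_le _ (norm_le_add (norm_le_scale _ up_nb) (norm_le_scale _ down_nb))); rewrite t2.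
have M3 : 0 <= 3 * M by rewrite mulr_ge0.
have := ler_wpM2r M3 t1; lra.
Qed.

(** With G = diag g and D = diag h, S nu = nu S + Th G S + D S nu - nu D S. The first
    correction is small because Th is, and the other two because h is small up to
    finitely many entries. The constant is 28 = 24 + 2 + 2. *)
Lemma tridiagonal_commutator b Mb : 0 <= Mb -> norm_le Mb b ->
  cmod (phi (nu \o b) - phi (b \o nu)) <= 28 * Mb * M * de.
Proof.
move=> Mb0 hb; have bb := norm_le_bounded Mb0 hb; have bnu := norm_le_bounded M0 hnu.
have d0 := de0; have d1 := de1.
have gB n : cmod ((g n)%:C%C : R[i]) <= 2.
  by rewrite cmodR; have /andP[? ?] := g01 n; rewrite ger0_norm//; lra.
have hB n : cmod (h n) <= 1.
  by rewrite cmodR; have /andP[? ?] := g01 n; rewrite ler_norml; lra.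
have hde n : (n0 <= n)%N -> cmod (h n) <= de by rewrite cmodR; exact: g1.
pose G := diag dot e (fun n => (g n)%:C%C); pose D := diag dot e h.
have nG : norm_le 2 G by split; [exact: (diag_lin hdot oe te gB)|exact: (diag_norm hdot oe te gB)].
have nD : norm_le 1 D by split; [exact: (diag_lin hdot oe te hB)|exact: (diag_norm hdot oe te hB)].
have bG : bounded_op G by exact: norm_le_bounded nG.
have bD : bounded_op D by exact: norm_le_bounded nD.
have M6 : 0 <= 6 * M * de by rewrite !mulr_ge0// ltW.
have bTh : bounded_op Th := norm_le_bounded M6 Th_nb.
have b1 := bounded_comp bnu bS.
have b2 := bounded_comp (bounded_comp bTh bG) bS.
have b3 := bounded_comp (bounded_comp bD bS) bnu.
have b4 := bounded_comp (bounded_comp bnu bD) bS.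
have E : S \o nu = (nu \o S) + (Th \o G \o S) + (D \o S \o nu) - (nu \o D \o S).
  apply: (bounded_ext hdot oe te); first exact: bounded_comp.
    rewrite -scaleN1r; apply: bounded_add; last exact: bounded_scale.
    by apply: bounded_add => //; exact: bounded_add.
  move=> n; apply: (coef_ext te) => m.
  have [lTh lnu lG lD] := And4 (bounded_lin bTh) (bounded_lin bnu) (bounded_lin bG) (bounded_lin bD).
  have Se : S (e n) = (s n)%:C%C *: e n by exact: (diag_e hdot oe te Sb).
  have Ge : G (e n) = (g n)%:C%C *: e n by exact: (diag_e hdot oe te gB).
  have De : D (e n) = h n *: e n by exact: (diag_e hdot oe te hB).
  rewrite !fctE dotBl 2!dotDl /= !(diag_coef hdot oe te Sb, diag_coef hdot oe te hB) Se.
  rewrite (linZ lnu) (linZ lG) (linZ lD) Ge De !(linZ lTh) !(linZ lnu) !dotZl.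
  rewrite dotDl !dotZl up_coef down_coef /h.
  set N := dot (nu (e n)) (e m).
  pose th : R := (t - 1) * (kap m == (kap n).+1)%:R + de * (kap n == (kap m).+1)%:R.
  have key : (g m * s m)%:C%C * N = ((1 + th) * (g n * s n))%:C%C * N.
    have [hk|hk] := boolP ((kap m <= (kap n).+1) && (kap n <= (kap m).+1))%N; last first.
      by rewrite /N tri// !mulr0.
    have dp : 1 + de != 0 by rewrite gt_eqF//; lra.
    congr (_%:C%C * N); rewrite !gs /th /t.
    have [k1|[k1|k1]] : kap m = kap n \/ kap m = (kap n).+1 \/ kap n = (kap m).+1.
      by move: hk; clear; lia.
    - by rewrite k1 !(ltn_eqF (ltnSn _)) !mulr0 !addr0 mul1r.
    - rewrite k1 eqxx (_ : (kap n == _) = false)%N; last by move: k1; clear; lia.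
      have := expf_neq0 (kap n) dp; rewrite exprS; move: (_ ^+ kap n) => p p0 /=.
      by field; rewrite p0 dp.
    - rewrite k1 eqxx (_ : (kap m == _) = false)%N; last by move: k1; clear; lia.
      have := expf_neq0 (kap m) dp; rewrite exprS; move: (_ ^+ kap m) => p p0 /=.
      by field; rewrite p0 dp.
  move: key; rewrite /th !(rmorphM, rmorphB, rmorphD, rmorphN, rmorph1, rmorph_nat) /= => /eqP.
  rewrite -subr_eq0 => /eqP key; apply/eqP; rewrite -subr_eq0 -key; apply/eqP; ring.
have bP := bounded_comp bTh bG; have bnD := bounded_comp bnu bD.
have -> : phi (nu \o b) = phi (b \o nu) + phi (b \o (Th \o G)) - phi ((b \o nu) \o D) + phi ((nu \o b) \o D).
  have [_ _ _ JM] := ideal_generated_ideal bS; have JS : J S := @ideal_generated_gen _ _ S.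
  transitivity (tau ((b \o (nu + (Th \o G) - (nu \o D))) \o S + (b \o D \o S \o nu))).
    transitivity (tau (b \o S \o nu)); first by rewrite (phi_rotate hdot oe te s0 sm htau bb bnu).
    rewrite -[b \o S \o nu]/(b \o (S \o nu)) E; congr (tau _); apply/funext => x.
    by rewrite !fctE -(linD (bounded_lin bb)) addrAC.
  have bs : bounded_op (nu + (Th \o G) - (nu \o D)).
    by rewrite -scaleN1r; apply: bounded_add; [exact: bounded_add|exact: bounded_scale].
  have j1 := (JM _ _ (bounded_comp bb bs) JS).1.
  have j2 := (JM _ _ bnu (JM _ _ (bounded_comp bb bD) JS).1).2.
  rewrite (tauD htau j1 j2) (phi_rotate hdot oe te s0 sm htau (bounded_comp bb bD) bnu).
  have n1 := bounded_comp bb bnu; have n2 := bounded_comp bb bP; have n3 := bounded_comp n1 bD.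
  congr (_ + _); rewrite -phD// -phB//; last exact: bounded_add.
  congr phi; apply/funext => x.
  by rewrite !fctE (linB (bounded_lin bb)) (linD (bounded_lin bb)).
have h1 : cmod (phi (b \o (Th \o G))) <= 2 * (Mb * (6 * M * de * 2)).
  by apply: ph_bound; [rewrite !mulr_ge0// ltW|apply: norm_le_comp => //; exact: norm_le_comp].
have h2 : cmod (phi ((nu \o b) \o D)) <= 2 * (M * Mb) * de.
  by apply: (phi_diag_small (M0 := n0) (B := 1)) => //; [rewrite mulr_ge0|exact: ltW|exact: norm_le_comp].
have h3 : cmod (phi ((b \o nu) \o D)) <= 2 * (Mb * M) * de.
  by apply: (phi_diag_small (M0 := n0) (B := 1)) => //; [rewrite mulr_ge0|exact: ltW|exact: norm_le_comp].
set x := phi (b \o (Th \o G)) in h1 *; set y := phi ((nu \o b) \o D) in h2 *.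
set z := phi ((b \o nu) \o D) in h3 *.
rewrite (_ : _ - _ = x + (y - z)); last by ring.
have := cmodD x (y - z); have := cmodD y (- z); rewrite cmodN.
lra.
Qed.

End Tridiagonal.

Context (dl : nat -> R) (d : R) (d0 : 0 < d).
Hypothesis dl0 : forall n, dl n != 0.
Hypothesis dloo : forall C, exists N, forall n, (N <= n)%N -> C < `|dl n|.
Hypothesis sE : forall n, s n = `|dl n| `^ (- d).
Context (T : H -> H) (Tc : forall x i, dot (T x) (e i) = (dl i)^-1%:C%C * dot x (e i)).

(** The level kap n locates |dl n| in the annuli of ratio q, level 0 receiving all that
    is below La * q. Rounding |dl n| down to La * q ^+ kap n changes s n by the factor
    g n, which is at most q ^ d. *)
Lemma geometric_scale (La q de : R) : 0 < La -> 1 < q -> q `^ d = 1 + de ->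
  exists (kap : nat -> nat) (g : nat -> R) (n0 : nat),
  [/\ forall n, `|dl n| < La * q ^+ (kap n).+1,
      forall n, (0 < kap n)%N -> La * q ^+ kap n <= `|dl n|,
      forall l, exists M, forall n, (M <= n)%N -> (l < kap n)%N &
      [/\ forall n, 0 <= g n <= 1 + de,
          forall n, (n0 <= n)%N -> `|1 - g n| <= de &
          forall n, g n * s n = (La `^ d)^-1 / (1 + de) ^+ kap n]].
Proof.
move=> La0 q1 qd; have q0 : 0 < q by exact: lt_trans q1.
have ex n : exists k, `|dl n| < La * q ^+ k.+1.
  have [k hk] := expr_unbounded (`|dl n| / La) q1; exists k.
  by rewrite mulrC -ltr_pdivrMr//; apply: hk.
pose kap n := ex_minn (ex n).
have kup n : `|dl n| < La * q ^+ (kap n).+1 by rewrite /kap; case: ex_minnP.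
have klo n : (0 < kap n)%N -> La * q ^+ kap n <= `|dl n|.
  rewrite /kap; case: ex_minnP => -[//|k] _ kmin _.
  by rewrite leNgt; apply/negP => /kmin; rewrite ltnn.
have Lq k : 0 < La * q ^+ k by rewrite mulr_gt0// exprn_gt0.
have koo l : exists M, forall n, (M <= n)%N -> (l < kap n)%N.
  have [M hM] := dloo (La * q ^+ l.+1); exists M => n /hM h.
  have := lt_trans h (kup n); rewrite ltr_pM2l// ltr_eXn2l//.
have [n0 hnorm0] := koo 0%N.
pose g n := (`|dl n| / (La * q ^+ kap n)) `^ d.
have gle n : g n <= 1 + de.
  rewrite -qd; apply: ge0_ler_powR; rewrite ?nnegrE ?divr_ge0 ?(ltW (Lq _)) ?(ltW q0) ?(ltW d0)//.
  by rewrite ler_pdivrMr// mulrCA -exprS ltW.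
exists kap, g, n0; split=> //; split=> [n|n /hnorm0 kn|n].
- by rewrite powR_ge0 gle.
- have g1 : 1 <= g n.
    have <- : (1 : R) `^ d = 1 by rewrite powR1.
    apply: ge0_ler_powR; rewrite ?nnegrE ?divr_ge0 ?(ltW (Lq _)) ?(ltW d0)//.
    by rewrite ler_pdivlMr// mul1r klo.
  by have := gle n; rewrite ler_norml; lra.
have dn0 : `|dl n| `^ d != 0 by rewrite powR_eq0 normr_eq0 (negPf (dl0 n)).
rewrite sE powRN /g powRM ?invr_ge0 ?(ltW (Lq _))//.
rewrite -powR_inv1 ?(ltW (Lq _))// -powRrM mulN1r powRN powRM ?(ltW La0) ?exprn_ge0 ?(ltW q0)//.
rewrite -powR_mulrn ?(ltW q0)// -powRrM [_ * d]mulrC powRrM qd powR_mulrn; last first.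
  by rewrite -qd powR_ge0.
by rewrite mulrAC divff// mul1r invfM.
Qed.

(** The bound given by [tridiagonal_commutator] holds for every de with the same
    constant. *)
Theorem phi_tracial a b (Ma C : R) c : 0 <= Ma -> norm_le Ma a -> 0 <= C ->
  (forall x, hnorm (c x) <= C * hnorm (T x)) -> (forall x, a (T x) = T (a x + c x)) ->
  bounded_op b -> phi (a \o b) = phi (b \o a).
Proof.
move=> Ma0 ha C0 hc comm bb; have [Mb Mb0 hb] := bounded_norm_le bb.
have ba := norm_le_bounded Ma0 ha; have d0' := d0.
have M2 : 0 <= Ma + 2 by rewrite addr_ge0.
have key de : 0 < de -> de <= 1 -> cmod (phi (a \o b) - phi (b \o a)) <= 28 * Mb * (Ma + 2) * de.
  move=> de0 de1; pose q := (1 + de) `^ d^-1.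
  have dp : 0 <= 1 + de by lra.
  have qd : q `^ d = 1 + de by rewrite -powRrM mulVf ?gt_eqF// powRr1.
  have q1 : 1 < q.
    have <- : (1 : R) `^ d^-1 = 1 by rewrite powR1.
    by apply: gt0_ltr_powR; rewrite ?invr_gt0// ?nnegrE//; lra.
  have q0 : 0 < q by exact: lt_trans q1.
  have qV : 0 < 1 - q^-1 by rewrite subr_gt0 invf_lt1.
  have qB : 0 < q - 1 by rewrite subr_gt0.
  (* La is so large that the far blocks have total norm at most 1, whatever de. *)
  pose La := C / ((q - 1) * (1 - q^-1)) + 1.
  have La0 : 0 < La by rewrite ltr_wpDl// divr_ge0// mulr_ge0 ?ltW.
  have sml : C / (La * (q - 1)) / (1 - q^-1) <= 1.
    rewrite -mulrA -invfM -mulrA ler_pdivrMr ?mulr_gt0// mul1r -ler_pdivrMr ?mulr_gt0//.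
    by rewrite lerDl.
  have [kap [g [n0 [kup klo koo [g01 g1 gs]]]]] := geometric_scale La0 q1 qd.
  have [nu [U [V [aE hnu tri [hU appU] [hV appV]]]]] :=
    near_diagonal hdot oe te dl0 Tc Ma0 ha C0 hc comm La0 q1 kup klo koo sml.
  have := tridiagonal_commutator M2 hnu tri de0 de1 g01 g1 gs Mb0 hb.
  have bI := @bounded_id R H.
  have bnu := norm_le_bounded M2 hnu.
  have bU := norm_le_bounded ler01 hU; have bV := norm_le_bounded ler01 hV.
  have zU X Y : bounded_op X -> bounded_op Y -> phi (X \o U \o Y) = 0.
    move=> bX bY; apply: phi_finite_limit => // eps eps0.
    by have [Z [M [bZ hZ]]] := appU eps eps0; exists Z, id, M.
  have zV X Y : bounded_op X -> bounded_op Y -> phi (X \o V \o Y) = 0.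
    move=> bX bY; apply: phi_finite_limit => // eps eps0.
    by have [Z [M [bZ hZ]]] := appV eps eps0; exists id, Z, M.
  have -> : phi (a \o b) = phi (nu \o b).
    have -> : a \o b = nu \o b + (U \o b + (V \o b)) by rewrite {1}aE.
    have [b1 b2 b3] := And3 (bounded_comp bnu bb) (bounded_comp bU bb) (bounded_comp bV bb).
    rewrite phD//; last exact: bounded_add.
    by rewrite phD// (zU id b)// (zV id b)// !addr0.
  have -> // : phi (b \o a) = phi (b \o nu).
    have -> : b \o a = b \o nu + (b \o U + (b \o V)).
      by apply/funext => x; rewrite {1}aE !fctE !(linD (bounded_lin bb)).
    have [b1 b2 b3] := And3 (bounded_comp bb bnu) (bounded_comp bb bU) (bounded_comp bb bV).
    rewrite phD//; last exact: bounded_add.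
    by rewrite phD// (zU b id)// (zV b id)// !addr0.
apply/eqP; rewrite -subr_eq0; apply/eqP/cmod_eq0/eqP; rewrite eq_le cmod_ge0 andbT.
apply: le_eps => eps eps0; rewrite add0r; pose K := 28 * Mb * (Ma + 2) + eps.
have K28 : 0 <= 28 * Mb * (Ma + 2) by rewrite !mulr_ge0.
have K0 : 0 < K by rewrite ltr_wpDl.
have e1 : eps / K <= 1 by rewrite ler_pdivrMr// mul1r lerDr.
apply: (le_trans (key _ (divr_gt0 eps0 K0) e1)).
by rewrite mulrCA ler_piMr ?(ltW eps0)// ler_pdivrMr// mul1r lerDl ltW.
Qed.

End Commutators.

(** * Powers of |D| *)

Section PowersOfD.
Context {R : realType} {H : completeNormedModType R[i]}.
Context (dot : {dot H for conjC}) (hdot : hilbert_dot dot).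
Context (D : unbounded_op H) (sa : self_adjoint dot D) (cr : compact_resolvent D) (tk : trivial_kernel D).
Context (e : nat -> H) (dl : nat -> R).
Hypothesis oe : forall i j, dot (e i) (e j) = (i == j)%:R.
Hypothesis te : forall x, (forall i, dot x (e i) = 0) -> x = 0.
Hypothesis De : forall n, op_dom D (e n) /\ D (e n) = (dl n)%:C%C *: e n.
Hypothesis dl0 : forall n, dl n != 0.

Lemma op_inv_coef x i : dot (op_inv D x) (e i) = (dl i)^-1%:C%C * dot x (e i).
Proof.
have [di Di] := De i; have [dd Dd] := op_domZ (dl i)^-1%:C%C di.
rewrite (op_inv_sym hdot sa cr tk) (op_inv_unique hdot sa cr tk dd (y := e i)) ?dotZr ?conjRC//.
by rewrite Dd Di scalerA -rmorphM mulVf// rmorph1 scale1r.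
Qed.

(** An eigenvector of D for l has coefficients only on those e i for which dl i = l. *)
Lemma abs_power_diag (p B : R) : (forall n, cmod ((`|dl n| `^ p)%:C%C : R[i]) <= B) ->
  abs_power D p = diag dot e (fun n => (`|dl n| `^ p)%:C%C).
Proof.
move=> hB; apply: xget_unique => [|F [bF hF]].
  split=> [|l x dx Dx]; first exact: (diag_bounded hdot oe te hB).
  apply: (coef_ext te) => i; rewrite (diag_coef hdot oe te hB) dotZl.
  have [di Di] := De i; have := sa_sym sa dx di; rewrite Dx Di dotZl dotZr conjRC.
  have [-> //|dli] := eqVneq l (dl i).
  move=> /eqP; rewrite -subr_eq0 -mulrBl mulf_eq0 -rmorphB => /orP[/eqP|/eqP ->].
    by move=> /complexI /eqP; rewrite subr_eq0 (negPf dli).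
  by rewrite !mulr0.
apply: (bounded_ext hdot oe te bF (diag_bounded hdot oe te hB)) => n.
by have [di Di] := De n; rewrite (diag_e hdot oe te hB) (hF _ _ di Di).
Qed.

(** With T the inverse of D this is a T = T a + T [D, a] T, that is c = [D, a] T: it
    expresses the commutator bound by everywhere defined operators. *)
Lemma commutator_inv (a : H -> H) : bounded_op a ->
  (forall x, op_dom D x -> op_dom D (a x)) ->
  (exists M : R[i], forall x, op_dom D x -> `|D (a x) - a (D x)| <= M * `|x|) ->
  exists c (C : R), [/\ 0 <= C, forall x, hnorm (c x) <= C * hnorm (op_inv D x) &
    forall x, a (op_inv D x) = op_inv D (a x + c x)].
Proof.
move=> ba da [M hM]; exists (fun x => D (a (op_inv D x)) - a x), (cmod M).
split=> [|x|x]; first exact: cmod_ge0.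
- have [dx Dx] := op_invP hdot sa cr tk x; have := hM _ dx; rewrite Dx => h.
  rewrite -lecR -normHE (le_trans h)// -[leLHS]ger0_norm ?(le_trans _ h)//.
  by rewrite normrM normr_id normHE normCE -rmorphM.
- have [dx Dx] := op_invP hdot sa cr tk x; rewrite addrC subrK.
  by rewrite (op_inv_unique hdot sa cr tk (da _ dx) erefl).
Qed.

End PowersOfD.

Theorem proposition2p5 (R : realType) (H : completeNormedModType R[i])
    (dot : {dot H for conjC}) (hdot : hilbert_dot dot)
    (A : lmodType R[i]) (mulA : A -> A -> A) (pi : A -> H -> H)
    (D : unbounded_op H)
    (hST : spectral_triple dot mulA pi D) (hker : trivial_kernel D)
    (d : R) (hd : box_dimension dot D = d%:E) (hd0 : d != 0) :
  singularly_traceable dot (abs_power D (- d)) /\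
  (exists tau : (H -> H) -> R[i],
     singular_trace dot (ideal_generated (abs_power D (- d))) tau /\
     tau (abs_power D (- d)) = 1) /\
  (forall tau : (H -> H) -> R[i],
     singular_trace dot (ideal_generated (abs_power D (- d))) tau ->
     tau (abs_power D (- d)) = 1 ->
     trace_state dot mulA pi (fun a => tau (pi a \o abs_power D (- d)))).
Proof.
have [_ _ _ pl pm pb sa cr hc] := hST.
have [e [dl [[oe te] [De dl0] [mono dloo] d0 win]]] := spectral_data hdot sa cr hker hd hd0.
pose s n := `|dl n| `^ (- d).
have s0 n : 0 < s n by rewrite powR_gt0 ?normr_gt0.
have s0' n : 0 <= s n := ltW (s0 n).
have sN n : s n = (`|dl n| `^ d)^-1 by rewrite /s powRN.
have sm m n : (m <= n)%N -> s n <= s m.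
  move=> /mono h; rewrite !sN lef_pV2 ?posrE ?powR_gt0 ?normr_gt0//.
  by apply: ge0_ler_powR; rewrite ?nnegrE// ltW.
have s_0 (eps : R) : 0 < eps -> exists N, forall n, (N <= n)%N -> s n < eps.
  move=> eps0; have [N hN] := dloo (eps `^ (- d^-1)); exists N => n /hN h.
  have e0 : 0 <= eps `^ (- d^-1) by exact: powR_ge0.
  rewrite sN invf_plt ?posrE ?powR_gt0 ?normr_gt0//.
  have := gt0_ltr_powR d0 e0 (normr_ge0 _) h.
  by rewrite -powRrM mulNr mulVf ?gt_eqF// powR_inv1 ?ltW.
have sB n : cmod ((s n)%:C%C : R[i]) <= s 0%N by exact: cmod_decr_bound.
rewrite (abs_power_diag hdot sa oe te De sB) -/s.
have [tau [htau tau1]] := singular_trace_exists hdot oe te s0 sm win.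
have bS := diag_bounded hdot oe te sB.
split; last split.
- split; [exact: (diag_compact hdot oe te s0' sm s_0)|exact: (diag_positive hdot oe te s0' sm)|].
  exists tau; split=> //; exists (diag dot e (fun n => (s n)%:C%C)); first exact: ideal_generated_gen.
  by rewrite tau1 oner_neq0.
- by exists tau.
move=> {htau tau1}tau htau tau1; rewrite -/(phi dot e s tau).
split=> [c a b|a a0|a b|a a1].
- rewrite -[LHS]/(phi dot e s tau _) pl; have ba := pb a; have bb := pb b.
  rewrite (phiD hdot oe te s0 sm htau (bounded_scale c ba) bb).
  by rewrite (phiZ hdot oe te s0 sm htau c ba).
- exact: (phi_positive hdot oe te s0 sm htau tau1 (pb a) a0).
- have [Ma Ma0 ha] := bounded_norm_le (pb a); have [da hM] := hc a.
  have [c [C [C0 cC ac]]] := commutator_inv hdot sa cr hker (pb a) da hM.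
  rewrite !pm.
  apply: (phi_tracial hdot oe te s0 sm htau tau1 d0 dl0 dloo (fun=> erefl) _ Ma0 ha C0 cC ac (pb b)).
  exact: (op_inv_coef hdot sa cr hker De dl0).
- have -> : pi a = id by apply/funext.
  exact: tau1.
Qed.
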